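(* Let $n\ge 4$, let $(p,q)$ be a signature with $p+q=n$, let $M$ be a smooth $n$-dimensional manifold, and let $r\ge 0$ be an integer. Let $f\colon M^r_{O_n}\to\mathbb{R}$ be a scalar metric invariant of $r$-order on $M$, i.e. a scalar invariant of $r$-order of $O_n$-structures on $M$. Then the assignment $$F\bigl(j^{r+2}_m\sigma_{[g]}\bigr):=f\bigl(j^{r}_m\sigma_{g'}\bigr)$$ gives a well-defined smooth function $F\colon \mathcal{U}^{r+2}\to\mathbb{R}$ on the open set $\mathcal{U}^{r+2}\subset M^{r+2}_{C_n}$ of $(r+2)$-jets $j^{r+2}_m\sigma_{[g]}$ of local conformal structures $[g]$ of signature $(p,q)$ for which $m$ is a generic point. Here $g'=|H_g|^{1/2}g$ is the preferred metric of $[g]$ on a neighborhood of $m$. Moreover $F$ is a scalar conformal invariant of $(r+2)$-order, that is, $F\circ\widehat{\varphi}^{\,r+2}=F$ over the domain of $\varphi$ for every local diffeomorphism $\varphi$ of $M$. Thus each scalar metric invariant of $r$-order on $M$ determines a corresponding scalar conformal invariant of $(r+2)$-order on $M$, for generic conformal structures.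
   Context: Fix a signature $(p,q)$ with $p+q=n$. $O_n\subset GL(n,\mathbb{R})$ denotes the orthogonal group of signature $(p,q)$, and $C_n=\mathbb{R}^+\cdot O_n$ the conformal orthogonal group. **Bundles of $G$-structures.** For a closed subgroup $G\subset GL(n,\mathbb{R})$, $M_G$ is the bundle of $G$-structures on $M$: the bundle associated to the linear frame bundle of $M$ with typical fiber $GL(n,\mathbb{R})/G$. Its local sections correspond to local $G$-structures on $M$. $M^r_G$ is the bundle of $r$-jets of local sections of $M_G$. - For $G=O_n$, local sections of $M_{O_n}$ are the local pseudo-Riemannian metrics $g$ of signature $(p,q)$, given in a chart by the matrix $(g_{ij})$. The section corresponding to $g$ is denoted $\sigma_g$. - For $G=C_n$, local sections of $M_{C_n}$ are the local conformal structures $[g]=\{\alpha g:\alpha \text{ a smooth positive function}\}$ of signature $(p,q)$, given in a chart by the matrix $|\det(g_{ij})|^{-1/n}(g_{ij})$. The section corresponding to $[g]$ is denoted $\sigma_{[g]}$. **Action of diffeomorphisms.** A local diffeomorphism $\varphi$ of $M$ acts on jets by $$\widehat{\varphi}^{\,r}(j^r_m\sigma)=j^r_{\varphi(m)}(\bar\varphi\circ\sigma\circ\varphi^{-1}),$$ where $\bar\varphi$ is the standard lift of $\varphi$ to $M_G$. Explicitly, $\bar\varphi\circ\sigma_g\circ\varphi^{-1}=\sigma_{(\varphi^{-1})^*g}$ for metrics and $\bar\varphi\circ\sigma_{[g]}\circ\varphi^{-1}=\sigma_{[(\varphi^{-1})^*g]}$ for conformal structures. **Scalar invariants.** A scalar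 invariant of $r$-order of $G$-structures on $M$ is a smooth function $f\colon M^r_G\to\mathbb{R}$ such that $f\circ\widehat{\varphi}^{\,r}=f$ over the domain of $\varphi$, for every local diffeomorphism $\varphi$ of $M$. It is called a scalar metric invariant when $G=O_n$ and a scalar conformal invariant when $G=C_n$. For conformal structures the same definition is used for functions defined only on the jets of conformal structures at generic points, which form an open subset of $M^{r}_{C_n}$ (for $r\ge 2$) invariant under all $\widehat{\varphi}^{\,r}$. **Generic points and the preferred metric.** For a metric $g$, let $C^i{}_{jkl}$ be its Weyl conformal curvature tensor and let $H_g=C_{ijkl}C^{ijkl}$, with indices raised and lowered by $g$. A point $m$ is generic for a conformal structure $[g]$ if $H_g(m)\neq 0$ for some (equivalently, every) $g\in[g]$. Near a generic point, the metric $g'=|H_g|^{1/2}g\in[g]$ does not depend on the choice of $g\in[g]$ (known fact); it is called the preferred metric of $[g]$. *)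

(* Defs.v *)
From HB Require Import structures.
From mathcomp Require Import all_boot all_order all_algebra.
From mathcomp Require Import all_classical all_reals all_analysis.
Import numFieldNormedType.Exports.

Set Implicit Arguments.
Unset Strict Implicit.
Unset Printing Implicit Defensive.

Import Order.TTheory GRing.Theory Num.Theory.
Local Open Scope classical_set_scope.
Local Open Scope ring_scope.

Section Calculus.
Context {R : realType}.

Definition partial N (i : 'I_N) (f : 'rV[R]_N -> R) : 'rV[R]_N -> R :=
  fun x => 'D_(delta_mx 0 i) (f : 'rV[R]_N -> R^o) x.

(* partials [:: i1; ...; ik] f = d_i1 (... (d_ik f)) *)
Definition partials N (s : seq 'I_N) (f : 'rV[R]_N -> R) : 'rV[R]_N -> R :=
  foldr (@partial N) f s.

(* C^oo on the open set U: all iterated partial derivatives exist and are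
   continuous at the points of U. *)
Definition smooth_on N (U : set 'rV[R]_N) (f : 'rV[R]_N -> R) : Prop :=
  forall (s : seq 'I_N) (x : 'rV[R]_N), U x ->
    {for x, continuous (partials s f)} /\
    forall i : 'I_N, derivable (partials s f : 'rV[R]_N -> R^o) x (delta_mx 0 i).

(* Row-vector convention: entry (i, k) is d_i h^k. *)
Definition jac N (h : 'rV[R]_N -> 'rV[R]_N) (x : 'rV[R]_N) : 'M[R]_N :=
  \matrix_(i, k) partial i (fun y => h y 0 k) x.

End Calculus.

(* An n-dimensional smooth manifold: a Hausdorff second countable space with a
   smooth atlas. The chart c is the homeomorphism crd c : dom c -> crd c @` dom c,
   with inverse par c; values of crd c and par c off these sets are junk. *)
Record manifold (R : realType) (n : nat) := Manifold {
  pt :> topologicalType ;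
  pt_hausdorff : hausdorff_space pt ;
  pt_second_countable : @second_countable pt ;
  chart : Type ;
  dom : chart -> set pt ;
  crd : chart -> pt -> 'rV[R]_n ;
  par : chart -> 'rV[R]_n -> pt ;
  dom_open : forall c, open (dom c) ;
  cod_open : forall c, open (crd c @` dom c) ;
  crdK : forall c m, dom c m -> par c (crd c m) = m ;
  crd_continuous : forall c m, dom c m -> {for m, continuous (crd c)} ;
  par_continuous : forall c x, (crd c @` dom c) x -> {for x, continuous (par c)} ;
  dom_cover : forall m, exists c, dom c m ;
  crd_smooth : forall c c' k,
    smooth_on (crd c @` (dom c `&` dom c')) (fun x => crd c' (par c x) 0 k)
}.

Arguments chart {R n} _.
Arguments dom {R n} {_} c.
Arguments crd {R n} {_} c.
Arguments par {R n} {_} c.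

Section Manifolds.
Context {R : realType} {n : nat} {M : manifold R n}.

(* An arbitrarily chosen chart around m. *)
Definition chart_at (m : M) : chart M := sval (cid (dom_cover m)).

Definition smooth_function (W : set M) (a : M -> R) : Prop :=
  forall c : chart M, smooth_on (crd c @` (dom c `&` W)) (a \o par c).

Definition smooth_map (W : set M) (h : M -> M) : Prop :=
  (forall m, W m -> {for m, continuous h}) /\
  forall (c c' : chart M) k,
    smooth_on (crd c @` (dom c `&` W `&` h @^-1` dom c'))
      (fun x => crd c' (h (par c x)) 0 k).

End Manifolds.

(* A local diffeomorphism of M: a diffeomorphism between two open subsets. *)
Record local_diffeo (R : realType) (n : nat) (M : manifold R n) := LocalDiffeo {
  ld_fun :> M -> M ;
  ld_inv : M -> M ;
  ld_dom : set M ;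
  ld_dom_open : open ld_dom ;
  ld_cod_open : open (ld_fun @` ld_dom) ;
  ld_funK : forall m, ld_dom m -> ld_inv (ld_fun m) = m ;
  ld_fun_smooth : smooth_map ld_dom ld_fun ;
  ld_inv_smooth : smooth_map (ld_fun @` ld_dom) ld_inv
}.

Section GStructures.
Context {R : realType} {n : nat}.

(* The pseudo-Euclidean matrix of signature (p, q), for p + q = n. *)
Definition sigmx (p q : nat) : 'M[R]_n :=
  diag_mx (\row_(i < n) (if (i < p)%N then 1 else if (i < p + q)%N then -1 else 0)).

(* The typical fibre GL(n, R)/G is realized as the orbit of sigmx p q under an
   action of GL(n, R) on matrices for which the stabilizer of sigmx p q is G:
   - act_O has stabilizer O_n, and its orbit is the set of symmetric matrices of
     signature (p, q), i.e. of matrices (g_ij) of metrics at a point;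
   - act_C has stabilizer C_n = R^+ . O_n, and its orbit is the set of those
     symmetric matrices of signature (p, q) whose determinant is +1 or -1, i.e.
     of matrices |det (g_ij)|^(-1/n) (g_ij). *)
Definition act_O (P A : 'M[R]_n) : 'M[R]_n := P *m A *m P^T.

Definition act_C (P A : 'M[R]_n) : 'M[R]_n :=
  (`|\det P| `^ (- (2 / n%:R))) *: act_O P A.

Definition fibre (act : 'M[R]_n -> 'M[R]_n -> 'M[R]_n) (p q : nat) : set 'M[R]_n :=
  [set A | exists2 P : 'M[R]_n, P \in unitmx & A = act P (sigmx p q)].

(* A matrix field on an open set of M: for each chart, a matrix-valued function
   of the coordinates. It only matters at coordinates of points of fdom. *)
Record mxfield (M : manifold R n) := MxField {
  fdom : set M ;
  fmat : chart M -> 'rV[R]_n -> 'M[R]_n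
}.

Context {M : manifold R n}.

(* Local sections of M_G, i.e. local G-structures, in terms of their matrices in
   the charts. *)
Definition local_section (act : 'M[R]_n -> 'M[R]_n -> 'M[R]_n) (p q : nat)
    (s : mxfield M) : Prop :=
  [/\ open (fdom s),
      forall c m, dom c m -> fdom s m -> fibre act p q (fmat s c (crd c m)),
      forall c i j,
        smooth_on (crd c @` (dom c `&` fdom s)) (fun x => fmat s c x i j) &
      forall c c' m, dom c m -> dom c' m -> fdom s m ->
        fmat s c (crd c m) =
        act (jac (crd c' \o par c) (crd c m)) (fmat s c' (crd c' m))].

Definition metric (p q : nat) (g : mxfield M) : Prop := local_section act_O p q g.

(* phibar \o s \o phi^-1 for the standard lift phibar of phi to M_G; for metrics,
   this is (phi^-1)^* s. The matrix at m is computed with a chart around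
   phi^-1 m; the choice of that chart is immaterial for a local section. *)
Definition push (act : 'M[R]_n -> 'M[R]_n -> 'M[R]_n) (phi : local_diffeo M)
    (s : mxfield M) : mxfield M :=
  MxField [set m | (phi @` ld_dom phi) m /\ fdom s (ld_inv phi m)]
    (fun c x => let m' := ld_inv phi (par c x) in
       act (jac (crd (chart_at m') \o ld_inv phi \o par c) x)
           (fmat s (chart_at m') (crd (chart_at m') m'))).

(* Jets at a point, encoded by the coordinates that they have in every chart
   around that point: entry s of jet_coef c, with s = [:: i1; ...; ik] and k <= r,
   is the matrix of derivatives d_i1 ... d_ik of the components in the chart c.
   Thus two jets of fields are equal iff the derivatives up to order r agree.
   Listing the derivatives by sequences of indices rather than by multi-indices
   only repeats coordinates. *)
Record jet_space (r : nat) := Jet {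
  jet_base : M ;
  jet_coef : chart M -> r.-bseq 'I_n -> 'M[R]_n
}.

Definition jet (r : nat) (s : mxfield M) (m : M) : jet_space r :=
  Jet m (fun c l => if `[< dom c m >]
                    then \matrix_(i, j) partials l (fun x => fmat s c x i j) (crd c m)
                    else 0).

(* The bundle M^r_G of r-jets of local sections of M_G. *)
Definition jet_bundle act (p q r : nat) : set (jet_space r) :=
  [set j | exists s m, [/\ local_section act p q s, fdom s m & j = jet r s m]].

(* The coordinates of M^r_G over dom c identify it with an embedded submanifold
   of the Euclidean space 'rV_(jet_dim r). *)
Definition jet_index (r : nat) : finType :=
  ('I_n + r.-bseq 'I_n * ('I_n * 'I_n))%type.

Definition jet_dim (r : nat) : nat := #|jet_index r|.

Definition jet_crd (r : nat) (c : chart M) (j : jet_space r) : 'rV[R]_(jet_dim r) :=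
  \row_(k < jet_dim r)
    match (enum_val k : jet_index r) with
    | inl i => crd c (jet_base j) 0 i
    | inr (l, (a, b)) => jet_coef j c l a b
    end.

(* W is an open subset of the jet bundle B. *)
Definition jet_open (r : nat) (B W : set (jet_space r)) : Prop :=
  W `<=` B /\
  forall (c : chart M) j, W j -> dom c (jet_base j) ->
    exists V : set 'rV[R]_(jet_dim r),
      [/\ open V, V (jet_crd c j) &
          forall j', B j' -> dom c (jet_base j') -> V (jet_crd c j') -> W j'].

(* Smoothness of the restriction of f to W, an open subset of a jet bundle: in
   the coordinates given by any chart, f extends locally to a smooth function on
   an open set of the ambient Euclidean space. *)
Definition jet_smooth (r : nat) (W : set (jet_space r)) (f : jet_space r -> R) : Prop :=
  forall (c : chart M) j, W j -> dom c (jet_base j) ->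
    exists (V : set 'rV[R]_(jet_dim r)) (h : 'rV[R]_(jet_dim r) -> R),
      [/\ open V, V (jet_crd c j), smooth_on V h &
          forall j', W j' -> dom c (jet_base j') -> V (jet_crd c j') ->
            f j' = h (jet_crd c j')].

(* jet r (push act phi s) (phi m) is the image of the jet of s at m under the
   action of phi on M^r_G. *)
Definition jet_invariant_set act (p q r : nat) (W : set (jet_space r)) : Prop :=
  forall (phi : local_diffeo M) (s : mxfield M) (m : M),
    local_section act p q s -> fdom s m -> ld_dom phi m ->
    W (jet r s m) -> W (jet r (push act phi s) (phi m)).

(* Scalar invariants of order r defined on the part W of M^r_G. *)
Definition scalar_invariant act (p q r : nat) (W : set (jet_space r))
    (f : jet_space r -> R) : Prop :=
  jet_smooth W f /\
  forall (phi : local_diffeo M) (s : mxfield M) (m : M),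
    local_section act p q s -> fdom s m -> ld_dom phi m ->
    W (jet r s m) -> f (jet r (push act phi s) (phi m)) = f (jet r s m).

End GStructures.

Arguments mxfield {R n} M.
Arguments jet_space {R n} M r.
Arguments jet_bundle {R n} M act p q r.

Section Curvature.
Context {R : realType} {n : nat}.
Variable g : 'rV[R]_n -> 'M[R]_n.

Let gi (x : 'rV[R]_n) : 'M[R]_n := invmx (g x).

(* Gamma^i_jk *)
Definition christoffel (i j k : 'I_n) (x : 'rV[R]_n) : R :=
  2^-1 * \sum_l gi x i l * (partial j (fun y => g y l k) x
                            + partial k (fun y => g y l j) x
                            - partial l (fun y => g y j k) x).

(* R^i_jkl *)
Definition riemann (i j k l : 'I_n) (x : 'rV[R]_n) : R :=
  partial k (christoffel i l j) x - partial l (christoffel i k j) x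
  + \sum_m (christoffel i k m x * christoffel m l j x
            - christoffel i l m x * christoffel m k j x).

Definition ricci (j l : 'I_n) (x : 'rV[R]_n) : R := \sum_i riemann i j i l x.

Definition ricci_up (i l : 'I_n) (x : 'rV[R]_n) : R :=
  \sum_j gi x i j * ricci j l x.

Definition scalar_curv (x : 'rV[R]_n) : R := \sum_i ricci_up i i x.

(* C^i_jkl *)
Definition weyl (i j k l : 'I_n) (x : 'rV[R]_n) : R :=
  riemann i j k l x
  - (n%:R - 2)^-1 * ((i == k)%:R * ricci j l x - (i == l)%:R * ricci j k x
                     + g x j l * ricci_up i k x - g x j k * ricci_up i l x)
  + scalar_curv x / ((n%:R - 1) * (n%:R - 2))
    * ((i == k)%:R * g x j l - (i == l)%:R * g x j k).

(* C_ijkl *)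
Definition weyl_low (i j k l : 'I_n) (x : 'rV[R]_n) : R :=
  \sum_a g x i a * weyl a j k l x.

(* C^ijkl *)
Definition weyl_up (i j k l : 'I_n) (x : 'rV[R]_n) : R :=
  \sum_b \sum_c \sum_d gi x j b * gi x k c * gi x l d * weyl i b c d x.

Definition weyl_sq_loc (x : 'rV[R]_n) : R :=
  \sum_i \sum_j \sum_k \sum_l weyl_low i j k l x * weyl_up i j k l x.

End Curvature.

Section Conformal.
Context {R : realType} {n : nat} {M : manifold R n}.

(* The function H_g; for a metric, the choice of the chart is immaterial. *)
Definition weyl_sq (g : mxfield M) (m : M) : R :=
  weyl_sq_loc (fmat g (chart_at m)) (crd (chart_at m) m).

(* [g] = {alpha g : alpha smooth positive} *)
Definition conf_class (g : mxfield M) : set (mxfield M) :=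
  [set h | fdom h = fdom g /\
     exists a : M -> R,
       [/\ smooth_function (fdom g) a,
           forall m, fdom g m -> 0 < a m &
           forall c m, dom c m -> fdom g m ->
             fmat h c (crd c m) = a m *: fmat g c (crd c m)]].

(* m is a generic point for [g] *)
Definition generic (g : mxfield M) (m : M) : Prop :=
  exists2 h, conf_class g h & weyl_sq h m != 0.

(* sigma_[g] *)
Definition conf_section (g : mxfield M) : mxfield M :=
  MxField (fdom g)
    (fun c x => (`|\det (fmat g c x)| `^ (- n%:R^-1)) *: fmat g c x).

(* The preferred metric |H_g|^(1/2) g of [g] *)
Definition preferred (g : mxfield M) : mxfield M :=
  MxField [set m | fdom g m /\ weyl_sq g m != 0]
    (fun c x => Num.sqrt `|weyl_sq g (par c x)| *: fmat g c x).

End Conformal.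

Arguments conf_section {R n M} g.
Arguments preferred {R n M} g.

Section ScalarInvariants.
Context {R : realType} {n : nat}.
Variables (M : manifold R n) (p q r : nat).

(* The r-jets of conformal structures of signature (p, q) at generic points *)
Definition generic_jets : set (jet_space M r) :=
  [set j | exists g m, [/\ metric p q g, fdom g m, generic g m &
                           j = jet r (conf_section g) m]].

Definition scalar_metric_invariant (f : jet_space M r -> R) : Prop :=
  scalar_invariant act_O p q (jet_bundle M act_O p q r) f.

Definition scalar_conformal_invariant (f : jet_space M r -> R) : Prop :=
  scalar_invariant act_C p q generic_jets f.

End ScalarInvariants.

Arguments generic_jets {R n} M p q r.

(* Main.v *)
(* In a chart, a conformal structure is represented by its unimodular matrix s, a
   positive multiple of the matrix of any metric g of the class. Since the Weyl
   tensor C^i_jkl is conformally invariant, H scales by a^-2 when g is multiplied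
   by a, so the matrix of the preferred metric is |H_s|^(1/2) s, where H_s is
   computed from s by the coordinate formula. Being a second order differential
   expression with non-vanishing denominators and radicands at generic points, it
   has r-jets that are smooth functions of the (r+2)-jets of s, by total
   differentiation. This yields F, its smoothness, and the openness of the set of
   generic jets. Invariance follows from that of f, because H is a scalar and
   hence taking preferred metrics commutes with diffeomorphisms.

   The curvature identities are proved for matrices of connection forms: under a
   change of coordinates or a conformal change, the new Levi-Civita connection is
   recognized as the only torsion-free metric connection. *)

Require Import Defs.
From HB Require Import structures.
From mathcomp Require Import all_boot all_order all_algebra.
From mathcomp Require Import all_classical all_reals all_analysis.
From mathcomp Require Import ring lra.
Import numFieldNormedType.Exports.

Set Implicit Arguments.
Unset Strict Implicit.
Unset Printing Implicit Defensive.

Import Order.TTheory GRing.Theory Num.Theory.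
Local Open Scope classical_set_scope.
Local Open Scope ring_scope.

(** * Differential calculus on R^N *)

Section Calc.
Context {R : realType}.

(** Smoothness is given by iterated derivatives along the coordinate axes, so differentiability, the
    chain rule and the symmetry of second derivatives have to be derived from these alone. That an
    expression is a smooth function of jets is proved by closure: the class [diffop] is stable under
    arithmetic, under inverses and powers of non-vanishing expressions, and under differentiation,
    which raises the order by one. The two derivatives in the curvature account for the shift from r
    to r + 2. A unimodular matrix field is not a metric, since a change of charts rescales it by a
    power of the Jacobian determinant. Conformal factors are therefore compared inside one chart, as
    functions of the coordinates. Conversely, invariance ranges over all sections of the conformal
    bundle while F is defined through metrics; a metric representing a section near one point is
    enough, because jets only see germs. Finally, H and push-forwards are defined with a chart
    picked separately at each point, so independence of the chart has to precede any statement on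
    their smoothness. *)

Lemma is_derive_line (V : normedModType R) (f : V -> R^o) (y v : V) (t : R) :
  derivable f (y + t *: v) v ->
  is_derive (t : R) (1 : R) (fun t : R => f (y + t *: v) : R) ('D_v f (y + t *: v)).
Proof.
have E : (fun h : R => h^-1 *: (((fun t : R => f (y + t *: v) : R) \o shift t) (h *: (1 : R))
   - f (y + t *: v))) =
   (fun h : R => h^-1 *: ((f \o shift (y + t *: v)) (h *: v) - f (y + t *: v))).
  apply/funext => h /=; congr (_ *: (f _ - _)).
  by rewrite [h *: 1]mulr1 scalerDl addrCA.
move=> df; apply: DeriveDef; rewrite /derivable /derive.
  by rewrite [X in cvg (X @ _)]E.
by rewrite [X in lim (X @ _)]E.
Qed.

Lemma mvt_line (V : normedModType R) (f : V -> R^o) (y v : V) (s : R) :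
  (forall t : R, `|t| <= `|s| -> derivable f (y + t *: v) v) ->
  exists2 t : R, `|t| <= `|s| & f (y + s *: v) - f y = s * 'D_v f (y + t *: v).
Proof.
move=> df.
pose g (t : R) : R := f (y + t *: v).
have gc (i : interval R) : (forall t : R, t \in i -> `|t| <= `|s|) ->
    {within [set` i], continuous g}.
  move=> H; apply: derivable_within_continuous => t ti.
  by have /@ex_derive := is_derive_line (df t (H _ ti)).
have [s0|s0] := leP 0 s.
  have tP t : t \in `[0, s] -> `|t| <= `|s|.
    by rewrite in_itv /= => /andP[t0 ts]; rewrite (ger0_norm t0) (ger0_norm s0).
  have [||t ts] := @MVT_segment R g (fun t => 'D_v f (y + t *: v)) 0 s s0.
  - by move=> t ts; apply/is_derive_line/df/tP/subset_itv_oo_cc.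
  - exact: gc.
  rewrite /g scale0r addr0 subr0 => E; exists t; first exact: tP.
  by rewrite E mulrC.
have tP t : t \in `[s, 0] -> `|t| <= `|s|.
  by rewrite in_itv /= => /andP[t0 ts]; rewrite (ler0_norm ts) (ltr0_norm s0) lerN2.
have [||t ts] := @MVT_segment R g (fun t => 'D_v f (y + t *: v)) s 0 (ltW s0).
- by move=> t ts; apply/is_derive_line/df/tP/subset_itv_oo_cc.
- exact: gc.
rewrite /g scale0r addr0 sub0r => E; exists t; first exact: tP.
by rewrite -opprB E mulrN opprK mulrC.
Qed.

Lemma norm_coord_le N (v : 'rV[R]_N) i : `|v 0 i| <= `|v|.
Proof.
rewrite [leRHS]mx_normrE.
by apply: (le_bigmax _ (fun i : 'I_1 * 'I_N => `|v i.1 i.2|) (0, i)).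
Qed.

Lemma norm_rV_le N (v : 'rV[R]_N) (e : R) :
  0 <= e -> (forall i, `|v 0 i| <= e) -> `|v| <= e.
Proof.
move=> e0 H; rewrite [leLHS]mx_normrE; apply/bigmax_leP; split => //= -[a b] _ /=.
by rewrite ord1.
Qed.

(** The points [x + trunc k h], for [k] from 0 to [N], form a staircase from [x] to [x + h] with
    steps parallel to the axes. *)
Definition trunc N (k : nat) (h : 'rV[R]_N) : 'rV[R]_N :=
  \row_j (if (j < k)%N then h 0 j else 0).

Lemma truncS N (k : 'I_N) (h : 'rV[R]_N) :
  trunc k.+1 h = trunc k h + h 0 k *: delta_mx 0 k.
Proof.
apply/rowP => j; rewrite !mxE /= -val_eqE /= ltnS leq_eqVlt.
have [E|] := eqVneq (j : nat) k.
  by rewrite -(ord_inj E) ltnn add0r mulr1.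
by rewrite mulr0 addr0.
Qed.

(** The increment is telescoped along the staircase; on each step the mean value theorem yields a
    partial derivative at a nearby point, which continuity compares with the one at [x]. *)
Lemma C1_expansion N (f : 'rV[R]_N -> R^o) (x : 'rV[R]_N) :
  (\forall y \near x, forall i, derivable f y (delta_mx 0 i)) ->
  (forall i, {for x, continuous (partial i f)}) ->
  forall e : R, 0 < e -> \forall h \near (0 : 'rV[R]_N),
    `|f (x + h) - f x - \sum_i h 0 i * partial i f x| <= e * `|h|.
Proof.
move=> df cf e e0.
(* Each of the [N] steps may contribute [e1 * |h|]; the successor keeps [e1] positive when [N] is
   0. *)
pose e1 := e / N.+1%:R.
have e10 : 0 < e1 by rewrite divr_gt0.
have : \forall y \near x, (forall i, derivable f y (delta_mx 0 i)) /\
    forall i, `|partial i f y - partial i f x| <= e1.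
  near=> y; split; first by near: y.
  move=> i; move: i; near: y.
  apply: filter_forall => i.
  have /cvgrPdist_le/(_ _ e10) := cf i.
  by apply: filterS => y; rewrite distrC.
move=> /nbhs_ballP[d /= d0 Hd].
near=> h.
have hd : `|h| < d.
  near: h; have := @nbhs0_lt R 'rV[R]_N _ d0; exact.
(* In the sup norm no point of the staircase is farther from [x] than [|h|], so all intermediate
   points lie in the ball. *)
have trh (k : 'I_N) (t : R) : `|t| <= `|h 0 k| -> ball x d (x + trunc k h + t *: delta_mx 0 k).
  move=> th; rewrite -ball_normE /ball_ /= -addrA opprD addNKr normrN.
  apply: le_lt_trans hd; apply: norm_rV_le => // j; rewrite !mxE /=.
  have [->|_] := eqVneq j k; rewrite /= ?ltnn ?add0r ?mulr1 ?mulr0 ?addr0.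
    by apply: le_trans th _; apply: norm_coord_le.
  by case: ifP => _; rewrite ?normr0 // norm_coord_le.
have step (k : 'I_N) : exists2 d, `|d| <= e1 &
    f (x + trunc k.+1 h) - f (x + trunc k h) = h 0 k * (partial k f x + d).
  rewrite truncS addrA.
  have [|t th ->] := @mvt_line _ f (x + trunc k h) (delta_mx 0 k) (h 0 k).
    by move=> t th; apply: (Hd _ (trh _ _ th)).1.
  exists (partial k f (x + trunc k h + t *: delta_mx 0 k) - partial k f x).
    exact: (Hd _ (trh _ _ th)).2.
  by rewrite addrCA subrr addr0.
have tele : f (x + h) - f x = \sum_(k < N) (f (x + trunc k.+1 h) - f (x + trunc k h)).
  rewrite -(big_mkord xpredT (fun k => f (x + trunc k.+1 h) - f (x + trunc k h))).
  rewrite telescope_sumr //; congr (f (x + _) - f _).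
    by apply/rowP => j; rewrite mxE ltn_ord.
  by apply/rowP => j; rewrite !mxE addr0.
rewrite tele -sumrB.
apply: le_trans (ler_norm_sum _ _ _) _.
have : \sum_(k < N) `|f (x + trunc k.+1 h) - f (x + trunc k h) - h 0 k * partial k f x|
   <= \sum_(k < N) e1 * `|h|.
  apply: ler_sum => k _; have [t te ->] := step k.
  rewrite mulrDr addrAC subrr add0r normrM mulrC.
  by apply: ler_pM => //; apply: norm_coord_le.
move=> /le_trans; apply.
rewrite sumr_const card_ord -mulrnAl ler_wpM2r // /e1 -mulr_natr mulrAC.
rewrite ler_pdivrMr //; apply: ler_wpM2l; first exact: ltW.
by rewrite ler_nat.
Unshelve. all: by end_near. Qed.

Lemma continuous_at_sum (T : topologicalType) (V : normedModType R) (I : Type) (r : seq I)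
    (F : I -> T -> V) (x : T) :
  (forall i, {for x, continuous (F i)}) ->
  {for x, continuous (fun y => \sum_(i <- r) F i y)}.
Proof.
move=> Fc; elim: r => [|i r IH].
  have -> : (fun y => \sum_(i <- [::]) F i y) = cst 0.
    by apply/funext => y; rewrite big_nil.
  exact: cst_continuous.
have -> : (fun y => \sum_(j <- i :: r) F j y) = (fun y => F i y + \sum_(j <- r) F j y).
  by apply/funext => y; rewrite big_cons.
by apply: continuousD; [exact: Fc | exact: IH].
Qed.

(** Upgrades derivatives along the axes, all that [smooth_on] offers, to a differential, as the
    chain rule requires. *)
Lemma C1_diff N (f : 'rV[R]_N -> R^o) (x : 'rV[R]_N) :
  (\forall y \near x, forall i, derivable f y (delta_mx 0 i)) ->
  (forall i, {for x, continuous (partial i f)}) ->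
  differentiable f x /\
  forall v, 'D_v f x = \sum_i v 0 i * partial i f x.
Proof.
move=> df cf.
pose L (h : 'rV[R]_N) : R^o := \sum_i h 0 i * partial i f x.
have L_lin : linear L.
  move=> a u v; rewrite /L scaler_sumr -big_split /=; apply: eq_bigr => i _.
  by rewrite !mxE mulrDl -mulrA.
pose Lm : {linear 'rV[R]_N -> R^o} := HB.pack L (GRing.isLinear.Build _ _ _ _ _ L_lin).
have Lc : continuous Lm.
  move=> y; apply: continuous_at_sum => i.
  by apply: continuousM; [exact: coord_continuous | exact: cst_continuous].
have E : f \o shift x = cst (f x) + Lm +o_ (0 : 'rV[R]_N) id.
  apply/eqaddoP => e e0; apply: filterS (C1_expansion df cf e0) => h.
  by rewrite -[X in _ -> is_true (`|X| <= _)]/(f (h + x) - (f x + L h)) [h + x]addrC opprD addrA.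
have dE := diff_unique Lc E.
have fd : differentiable f x.
  by apply/diff_locallyP; rewrite dE.
by split=> // v; rewrite deriveE // dE.
Qed.

Lemma continuous_dist_near (T : topologicalType) (g : T -> R) (x : T) (e : R) :
  {for x, continuous g} -> 0 < e -> \forall y \near x, `|g x - g y| <= e.
Proof. by move=> /cvgrPdist_le gc e0; apply: gc. Qed.

Lemma ge_min_l (a b : R) : Num.min a b <= a. Proof. by rewrite ge_min lexx. Qed.
Lemma ge_min_r (a b : R) : Num.min a b <= b. Proof. by rewrite ge_min lexx orbT. Qed.

Lemma derivable_translate (V : normedModType R) (f : V -> R^o) (c y v : V) :
  derivable f (y + c) v -> derivable (fun z => f (z + c) : R^o) y v.
Proof.
rewrite /derivable.
have -> // : (fun h : R => h^-1 *: (((fun z => f (z + c) : R^o) \o shift y) (h *: v) - f (y + c))) =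
  (fun h : R => h^-1 *: ((f \o shift (y + c)) (h *: v) - f (y + c))).
by apply/funext => h /=; rewrite addrA.
Qed.

Lemma derive_translate (V : normedModType R) (f : V -> R^o) (c y v : V) :
  'D_v (fun z => f (z + c) : R^o) y = 'D_v f (y + c).
Proof.
rewrite /derive.
have -> // : (fun h : R => h^-1 *: (((fun z => f (z + c) : R^o) \o shift y) (h *: v) - f (y + c))) =
  (fun h : R => h^-1 *: ((f \o shift (y + c)) (h *: v) - f (y + c))).
by apply/funext => h /=; rewrite addrA.
Qed.

(** The mean value theorem is used in direction [u] for the difference [phi], then in direction [v]
    for [g]. In [schwarz] it serves for both orders of the directions. *)
Lemma second_difference (V : normedModType R) (f g A : V -> R^o) (u v x : V) (s : R) :
  (forall y, 'D_u f y = g y) -> (forall y, 'D_v g y = A y) ->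
  (forall a b : R, `|a| <= `|s| -> `|b| <= `|s| ->
     derivable f (x + a *: u + b *: v) u /\ derivable g (x + a *: u + b *: v) v) ->
  exists a b : R, [/\ `|a| <= `|s|, `|b| <= `|s| &
    f (x + s *: u + s *: v) - f (x + s *: u) - (f (x + s *: v) - f x) =
    s * (s * A (x + a *: u + b *: v))].
Proof.
move=> fg gA H; pose phi (y : V) : R^o := f (y + s *: v) - f y.
have dphi (t : R) : `|t| <= `|s| -> derivable phi (x + t *: u) u /\
    'D_u phi (x + t *: u) = g (x + t *: u + s *: v) - g (x + t *: u).
  move=> ts.
  have d1 := derivable_translate (H t s ts (lexx _)).1.
  have d2 : derivable f (x + t *: u) u.
    by have := (H t 0 ts); rewrite scale0r addr0 normr0; case.
  split; first exact: (derivableB d1 d2).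
  by rewrite -!fg -(derive_translate f (s *: v)); exact: (deriveB d1 d2).
have [t ts E] := @mvt_line _ phi x u s (fun t ts => (dphi t ts).1).
have [|b bs E'] := @mvt_line _ g (x + t *: u) v s.
  by move=> b bs; exact: (H t b ts bs).2.
by exists t, b; split => //; rewrite -gA -E' -(dphi t ts).2 -E.
Qed.

Lemma continuous_eq_of_close (V : normedModType R) (A B : V -> R) (x : V) :
  {for x, continuous A} -> {for x, continuous B} ->
  (forall d : R, 0 < d -> exists y z, [/\ ball x d y, ball x d z & A y = B z]) ->
  A x = B x.
Proof.
move=> Ac Bc H.
apply/eqP; rewrite -subr_eq0 -normr_le0; apply/ler_addgt0Pr => e e0; rewrite add0r.
have e20 : 0 < e / 2 by rewrite divr_gt0.
have /nbhs_ballP[d1 /= d10 H1] := continuous_dist_near Ac e20.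
have /nbhs_ballP[d2 /= d20 H2] := continuous_dist_near Bc e20.
have [|y [z [yd zd E]]] := H (Num.min d1 d2); first by rewrite lt_min d10.
have {}H1 := H1 _ (le_ball (ge_min_l _ _) yd).
have {}H2 := H2 _ (le_ball (ge_min_r _ _) zd).
have := ler_normB (A x - A y) (B x - B z).
rewrite E in H1; rewrite E opprB addrA subrK => /le_trans; apply.
by rewrite [e]splitr lerD.
Qed.

(** The second difference over a small parallelogram is symmetric in [u] and [v], and each order of
    differencing equates it with [s * s] times a mixed derivative at a nearby point. *)
Lemma schwarz (V : normedModType R) (f fu fv A B : V -> R^o) (u v x : V) :
  (forall y, 'D_u f y = fu y) -> (forall y, 'D_v f y = fv y) ->
  (forall y, 'D_v fu y = A y) -> (forall y, 'D_u fv y = B y) ->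
  (\forall y \near x, [/\ derivable f y u, derivable f y v,
     derivable fu y v & derivable fv y u]) ->
  {for x, continuous A} -> {for x, continuous B} ->
  A x = B x.
Proof.
move=> fuE fvE AE BE /nbhs_ballP[d0 /= d00 Hd] cA cB.
apply: continuous_eq_of_close cA cB _ => d1 d10.
pose d := Num.min d0 d1.
have d_gt0 : 0 < d by rewrite lt_min d00.
(* This size keeps the parallelogram inside the ball of radius [d]; the 1 avoids a zero denominator
   when [u] and [v] vanish. *)
pose s := d / (2 * (1 + `|u| + `|v|)).
have K0 : 0 < 1 + `|u| + `|v| by rewrite ltr_wpDr // ltr_wpDr.
have s0 : 0 < s by rewrite divr_gt0 // mulr_gt0.
have inb (a b : R) : `|a| <= `|s| -> `|b| <= `|s| -> ball x d (x + a *: u + b *: v).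
  rewrite (gtr0_norm s0) => la lb.
  rewrite -ball_normE /ball_ /= -addrA opprD addNKr normrN.
  apply: le_lt_trans (ler_normD _ _) _; rewrite !normrZ.
  apply: (@le_lt_trans _ _ (s * `|u| + s * `|v|)); first by rewrite lerD // ler_wpM2r.
  rewrite -mulrDr /s -mulrA gtr_pMr // ltr_pdivrMl ?mulr_gt0 // mulr1.
  by have := normr_ge0 u; have := normr_ge0 v; lra.
have swap c k : x + k *: v + c *: u = x + c *: u + k *: v by apply: addrAC.
have inb0 a b la lb := Hd _ (le_ball (ge_min_l _ _) (inb a b la lb)).
have inb1 a b la lb := le_ball (ge_min_r _ _) (inb a b la lb).
have [|a [b [la lb E1]]] := second_difference fuE AE (x := x) (s := s).
  by move=> a b la lb; have [] := inb0 a b la lb.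
have [|b' [a' [lb' la' E2]]] := second_difference fvE BE (x := x) (s := s).
  by move=> b' a' lb' la'; rewrite (swap a' b'); have [] := inb0 a' b' la' lb'.
exists (x + a *: u + b *: v), (x + a' *: u + b' *: v).
split; [exact: inb1|exact: inb1|].
apply: (mulfI (lt0r_neq0 s0)); apply: (mulfI (lt0r_neq0 s0)).
rewrite -E1 -(swap a' b') -E2 (swap s s).
have aux (P Q S T : R) : P - Q - (S - T) = P - S - (Q - T) by ring.
exact: aux.
Qed.

End Calc.

(** * Functions of class C^k and their closure properties *)

Section Smooth.
Context {R : realType}.

(** Derivatives are counted rather than listed: the derivative of a product or a composite is a sum
    of such expressions, to whose factors induction on [k] applies. A fixed sequence of indices, as
    in [smooth_on], does not allow this. *)
Fixpoint Ck N (k : nat) (U : set 'rV[R]_N) (f : 'rV[R]_N -> R) : Prop :=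
  (forall x, U x -> {for x, continuous f}) /\
  if k is k'.+1 then
    (forall x, U x -> forall i, derivable (f : 'rV[R]_N -> R^o) x (delta_mx 0 i)) /\
    forall i, Ck k' U (partial i f)
  else True.

Lemma partials_rcons N (s : seq 'I_N) i (f : 'rV[R]_N -> R) :
  partials (rcons s i) f = partials s (partial i f).
Proof. by rewrite /partials -cats1 foldr_cat. Qed.

Lemma smooth_partial N (U : set 'rV[R]_N) i f : smooth_on U f -> smooth_on U (partial i f).
Proof. by move=> fs s x Ux; have := fs (rcons s i) x Ux; rewrite partials_rcons. Qed.

Lemma smooth_partials N (U : set 'rV[R]_N) s f : smooth_on U f -> smooth_on U (partials s f).
Proof. by move=> fs; elim: s => [//|i s IH]; exact: (@smooth_partial N U i _ IH). Qed.

Lemma smooth_continuous N (U : set 'rV[R]_N) f x :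
  smooth_on U f -> U x -> {for x, continuous f}.
Proof. by move=> fs /(fs [::])[]. Qed.

Lemma smooth_derivable N (U : set 'rV[R]_N) f x i :
  smooth_on U f -> U x -> derivable (f : 'rV[R]_N -> R^o) x (delta_mx 0 i).
Proof. by move=> fs /(fs [::])[]. Qed.

Lemma smoothP N (U : set 'rV[R]_N) f : smooth_on U f <-> forall k, Ck k U f.
Proof.
split=> [fs k|fC].
  have cf g : smooth_on U g -> forall x, U x -> {for x, continuous g}.
    by move=> gs x; exact: smooth_continuous.
  elim: k f fs => [|k IH] f fs; split; [exact: cf|by []|exact: cf|].
  by split=> [x Ux i|i]; [exact: smooth_derivable fs Ux | exact/IH/smooth_partial].
(* [partials] adds derivatives on the outside while [Ck] takes them from the inside, hence the
   induction from the end of the sequence. *)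
move=> s; elim/last_ind: s f fC => [|s i IH] f fC.
  by move=> x Ux; split; [exact: (fC 0%N).1 | exact: (fC 1%N).2.1].
rewrite partials_rcons; apply: IH => k.
exact: (fC k.+1).2.2.
Qed.

Lemma smooth_sub N (U V : set 'rV[R]_N) f : V `<=` U -> smooth_on U f -> smooth_on V f.
Proof. by move=> VU fs s x /VU; apply: fs. Qed.

Section Open.
Context {N : nat} {U : set 'rV[R]_N} (Uo : open U).
Implicit Types f g : 'rV[R]_N -> R.

Lemma near_eq_open f g x : {in U, f =1 g} -> U x -> \forall y \near x, f y = g y.
Proof.
move=> fg Ux; have : nbhs x U by apply: open_nbhs_nbhs.
by apply: filterS => y Uy; apply: fg; rewrite inE.
Qed.

Lemma eq_partial f g i : {in U, f =1 g} -> {in U, partial i f =1 partial i g}.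
Proof.
by move=> fg x; rewrite inE => Ux; apply/near_eq_derive/near_eq_open.
Qed.

Lemma eq_Ck k f g : {in U, f =1 g} -> Ck k U f -> Ck k U g.
Proof.
have E f1 g1 x : {in U, f1 =1 g1} -> U x -> {for x, continuous f1} -> {for x, continuous g1}.
  move=> fg Ux; rewrite /prop_for /continuous_at (fg x) ?inE // => H.
  apply: cvg_trans H; apply: (@near_eq_cvg _ _ (nbhs x)) => //.
  exact: near_eq_open fg Ux.
have D f1 g1 x i : {in U, f1 =1 g1} -> U x -> derivable (f1 : 'rV[R]_N -> R^o) x (delta_mx 0 i) ->
    derivable (g1 : 'rV[R]_N -> R^o) x (delta_mx 0 i).
  by move=> fg Ux; apply: near_eq_derivable; apply: near_eq_open.
elim: k f g => [|k IH] f g fg /= [cf].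
  by move=> _; split=> // x Ux; apply: E fg Ux (cf x Ux).
move=> [df pf]; split; first by move=> x Ux; apply: E fg Ux (cf x Ux).
split=> [x Ux i|i]; first by apply: D fg Ux (df x Ux i).
by apply: IH (pf i); apply: eq_partial.
Qed.

Lemma eq_smooth f g : {in U, f =1 g} -> smooth_on U f -> smooth_on U g.
Proof. by move=> fg /smoothP fs; apply/smoothP => k; apply: eq_Ck fg _. Qed.

Lemma eq_partials s f g : {in U, f =1 g} -> {in U, partials s f =1 partials s g}.
Proof. by move=> fg; elim: s => //= i s; apply: eq_partial. Qed.

Lemma CkW k f : Ck k.+1 U f -> Ck k U f.
Proof.
elim: k f => [|k IH] f [cf [df pf]]; first by [].
by split=> //; split=> // i; apply: IH.
Qed.

Lemma Ck_cont k f x : Ck k U f -> U x -> {for x, continuous f}.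
Proof. by case: k => [|k] [H _] /H. Qed.

Lemma Ck1_diff f x : Ck 1 U f -> U x ->
  differentiable (f : 'rV[R]_N -> R^o) x /\
  forall v, 'D_v (f : 'rV[R]_N -> R^o) x = \sum_i v 0 i * partial i f x.
Proof.
move=> [cf [df pf]] Ux; apply: C1_diff => [|i]; last exact: (pf i).1.
have : nbhs x U by apply: open_nbhs_nbhs.
by apply: filterS => y Uy i; apply: df.
Qed.

Lemma Ck_cst k (c : R) : Ck k U (fun=> c).
Proof.
elim: k c => [|k IH] c /=; split=> //; try by move=> x Ux; apply: cst_continuous.
split=> [x Ux i|i]; first exact: derivable_cst.
apply: (eq_Ck (f := fun=> 0)) => // x _.
by rewrite /partial derive_cst.
Qed.

Lemma partialD f g i x :
  derivable (f : 'rV[R]_N -> R^o) x (delta_mx 0 i) ->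
  derivable (g : 'rV[R]_N -> R^o) x (delta_mx 0 i) ->
  partial i (fun y => f y + g y) x = partial i f x + partial i g x.
Proof. exact: deriveD. Qed.

Lemma partialM f g i x :
  derivable (f : 'rV[R]_N -> R^o) x (delta_mx 0 i) ->
  derivable (g : 'rV[R]_N -> R^o) x (delta_mx 0 i) ->
  partial i (fun y => f y * g y) x = f x * partial i g x + g x * partial i f x.
Proof. exact: deriveM. Qed.

Lemma CkD k f g : Ck k U f -> Ck k U g -> Ck k U (fun x => f x + g x).
Proof.
elim: k f g => [|k IH] f g /= [cf Hf] [cg Hg].
  by split=> // x Ux; apply: continuousD; [exact: cf | exact: cg].
case: Hf Hg => [df pf] [dg pg]; split; [|split].
- by move=> x Ux; apply: continuousD; [exact: cf | exact: cg].
- by move=> x Ux i; apply: derivableD; [exact: df | exact: dg].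
- move=> i; apply: (eq_Ck (f := fun x => partial i f x + partial i g x)); last exact: IH.
  by move=> x; rewrite inE => Ux; rewrite partialD //; [exact: df | exact: dg].
Qed.

Lemma CkM k f g : Ck k U f -> Ck k U g -> Ck k U (fun x => f x * g x).
Proof.
elim: k f g => [|k IH] f g.
  move=> [cf _] [cg _].
  by split=> // x Ux; apply: continuousM; [exact: cf | exact: cg].
move=> Hf Hg; have Hf' := CkW Hf; have Hg' := CkW Hg.
case: Hf Hg => [cf [df pf]] [cg [dg pg]]; split; [|split].
- by move=> x Ux; apply: continuousM; [exact: cf | exact: cg].
- by move=> x Ux i; apply: derivableM; [exact: df | exact: dg].
- move=> i; apply: (eq_Ck (f := fun x => f x * partial i g x + g x * partial i f x)).
    by move=> x; rewrite inE => Ux; rewrite partialM //; [exact: df | exact: dg].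
  by apply: CkD; [exact: IH Hf' (pg i) | exact: IH Hg' (pf i)].
Qed.

Lemma partialV f i x : f x != 0 ->
  derivable (f : 'rV[R]_N -> R^o) x (delta_mx 0 i) ->
  partial i (fun y => (f y)^-1) x = - ((f x)^-1 * (f x)^-1 * partial i f x).
Proof.
move=> fx df; rewrite /partial.
by rewrite [LHS](deriveV fx df) -mulNr expr2 invfM.
Qed.

Lemma CkV k f : (forall x, U x -> f x != 0) -> Ck k U f -> Ck k U (fun x => (f x)^-1).
Proof.
move=> f0; elim: k => [|k IH].
  by move=> [cf _]; split=> // x Ux; apply: continuousV; [exact: f0 | exact: cf].
move=> Hf; have Hf' := CkW Hf; case: Hf => [cf [df pf]]; split; [|split].
- by move=> x Ux; apply: continuousV; [exact: f0 | exact: cf].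
- by move=> x Ux i; apply: derivableV; [exact: f0 | exact: df].
- move=> i; apply: (eq_Ck (f := fun x => -1 * ((f x)^-1 * (f x)^-1 * partial i f x))).
    move=> x; rewrite inE => Ux; rewrite partialV //; [by rewrite mulN1r|exact: f0|exact: df].
  apply: CkM; first exact: Ck_cst.
  by apply: CkM (pf i); apply: CkM; apply: IH.
Qed.

Lemma Ck_sum k (I : Type) (r : seq I) (P : pred I) (F : I -> 'rV[R]_N -> R) :
  (forall i, Ck k U (F i)) -> Ck k U (fun x => \sum_(i <- r | P i) F i x).
Proof.
move=> H; elim: r => [|i r IH].
  by apply: (eq_Ck (f := fun=> 0)); [move=> x _; rewrite big_nil | exact: Ck_cst].
apply: (eq_Ck (f := fun x => (if P i then F i x else 0) + \sum_(j <- r | P j) F j x)).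
  by move=> x _; rewrite big_cons; case: (P i); rewrite ?add0r.
by apply: CkD => //; case: (P i) => //; exact: Ck_cst.
Qed.

End Open.
End Smooth.

(** * Chain rule and real powers *)

Section Composition.
Context {R : realType}.

Lemma derive_lineE (V W : normedModType R) (f : V -> W) (x v : V) :
  'D_v f x = 'D_(1 : R) (fun t : R => f (t *: v + x)) (0 : R).
Proof.
rewrite /derive.
have -> // : (fun h : R => h^-1 *: ((f \o shift x) (h *: v) - f x)) =
  (fun h : R => h^-1 *: (((fun t : R => f (t *: v + x)) \o shift 0) (h *: 1) - f (0 *: v + x))).
by apply/funext => h /=; rewrite addr0 scale0r add0r [_ *: 1]mulr1.
Qed.

(** Only a directional derivative of [h] is assumed. On the line through [x] it becomes a function
    of one real variable, where derivable and differentiable agree, and the chain rule for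
    differentials applies. *)
Lemma derive_chain (V W : normedModType R) (h : V -> W) (F : W -> R^o) (x v : V) :
  derivable h x v -> differentiable F (h x) ->
  derivable (F \o h : V -> R^o) x v /\ 'D_v (F \o h : V -> R^o) x = 'D_('D_v h x) F (h x).
Proof.
move=> dh dF.
pose g (t : R) := h (t *: v + x).
have g0 : g 0 = h x by rewrite /g scale0r add0r.
have dg : differentiable g (0 : R).
  by apply/derivable1_diffP; move/derivable1P: dh.
have dF' : differentiable F (g 0) by rewrite g0.
have dFg : differentiable (F \o g) 0 by apply: differentiable_comp.
split; first by apply/derivable1P; move/derivable1_diffP: dFg.
rewrite derive_lineE [LHS](deriveE _ dFg) diff_comp //=.
by rewrite g0 -(deriveE _ dF) -(deriveE _ dg) -derive_lineE.
Qed.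

Lemma partial_comp n N (F : 'rV[R]_N -> R) (h : 'rV[R]_n -> 'rV[R]_N) V x i :
  open V -> V (h x) -> Ck 1 V F ->
  (forall k, derivable (fun y => h y 0 k : R^o) x (delta_mx 0 i)) ->
  derivable (F \o h : 'rV[R]_n -> R^o) x (delta_mx 0 i) /\
  partial i (F \o h) x = \sum_k partial k F (h x) * partial i (fun y => h y 0 k) x.
Proof.
move=> Vo Vx CF dh.
have [dF DF] := Ck1_diff Vo CF Vx.
have dh' : derivable h x (delta_mx 0 i).
  by apply/derivable_mxP => a k; rewrite ord1; apply: dh.
have [d1 d2] := derive_chain dh' dF; split; first exact: d1.
rewrite /partial [LHS]d2 [LHS]DF; apply: eq_bigr => k _.
by rewrite derive_mx // mxE mulrC.
Qed.

Lemma continuous_row N (T : topologicalType) (h : T -> 'rV[R]_N) (x : T) :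
  (forall k, {for x, continuous (fun y => h y 0 k)}) -> {for x, continuous h}.
Proof.
move=> hc; apply/cvgrPdist_le => e e0.
have : \forall y \near x, forall k, `|h x 0 k - h y 0 k| <= e.
  by apply: filter_forall => k; apply: continuous_dist_near (hc k) e0.
by apply: filterS => y H; apply: norm_rV_le; [exact: ltW | move=> k; rewrite !mxE].
Qed.

Lemma Ck_comp n N k (U : set 'rV[R]_n) (V : set 'rV[R]_N) (F : 'rV[R]_N -> R)
    (h : 'rV[R]_n -> 'rV[R]_N) :
  open U -> open V -> (forall x, U x -> V (h x)) ->
  (forall j, Ck k U (fun x => h x 0 j)) -> Ck k V F -> Ck k U (F \o h).
Proof.
move=> Uo Vo UV.
elim: k F => [|k IH] F Hh HF.
  split=> // x Ux; apply: continuous_comp; last exact: (Ck_cont HF (UV _ Ux)).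
  by apply: continuous_row => j; apply: (Ck_cont (Hh j)).
have Hh' j := CkW (Hh j).
have HF1 : Ck 1 V F.
  by case: HF => [cf [df pf]]; split=> //; split=> // i; split=> // y Vy; apply: Ck_cont (pf i) Vy.
have HF' := CkW HF.
have P x i : U x -> _ := fun Ux => partial_comp Vo (UV x Ux) HF1 (fun j => (Hh j).2.1 x Ux i).
split; [|split].
- move=> x Ux; apply: continuous_comp; last exact: (Ck_cont HF (UV _ Ux)).
  by apply: continuous_row => j; apply: (Ck_cont (Hh j)).
- by move=> x Ux i; have [] := P x i Ux.
- move=> i.
  apply: (eq_Ck Uo (f := fun x => \sum_j partial j F (h x) * partial i (fun y => h y 0 j) x)).
    by move=> x; rewrite inE => Ux; have [_ ->] := P x i Ux.
  apply: Ck_sum => // j; apply: CkM => //; last exact: ((Hh j).2.2 i).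
  exact: IH Hh' (HF.2.2 j).
Qed.

(** The derivative is written with |f|^a / f rather than |f|^(a - 1): this form is the same for both
    signs of [f], and it reproduces |f|^a, on which the induction in [Ck_powR] relies. *)
Lemma partial_powR_pos N (f : 'rV[R]_N -> R) (a : R) x i :
  0 < f x -> derivable (f : 'rV[R]_N -> R^o) x (delta_mx 0 i) ->
  {for x, continuous f} ->
  derivable (fun y => `|f y| `^ a : R^o) x (delta_mx 0 i) /\
  partial i (fun y => `|f y| `^ a) x = a * (`|f x| `^ a * (f x)^-1 * partial i f x).
Proof.
move=> fx df fc.
have nr : \forall y \near x, f y `^ a = `|f y| `^ a.
  have : \forall y \near x, 0 < f y by move: fc => /cvgr_gt; apply.
  by apply: filterS => y fy; rewrite gtr0_norm.
have H := @is_derive1_powR R a (f x) fx.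
have dp : differentiable (@powR R ^~ a : R -> R^o) (f x).
  by apply/derivable1_diffP; exact: ex_derive.
have [d1 d2] := derive_chain df dp.
split; first exact: (near_eq_derivable nr d1).
rewrite /partial -(near_eq_derive _ nr) [LHS]d2 (deriveE _ dp).
have -> : 'D_(delta_mx 0 i) (f : _ -> R^o) x =
   ('D_(delta_mx 0 i) (f : _ -> R^o) x : R) *: (1 : R^o) by rewrite [RHS]mulr1.
rewrite linearZ /= -(deriveE _ dp) derive_val gtr0_norm //.
rewrite powRD; last by apply/implyP => _; rewrite gt_eqF.
rewrite powR_inv1 ?ltW // /GRing.scale /= mulr1; ring.
Qed.

Lemma partial_powR N (f : 'rV[R]_N -> R) (a : R) x i :
  f x != 0 -> derivable (f : 'rV[R]_N -> R^o) x (delta_mx 0 i) ->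
  {for x, continuous f} ->
  derivable (fun y => `|f y| `^ a : R^o) x (delta_mx 0 i) /\
  partial i (fun y => `|f y| `^ a) x = a * (`|f x| `^ a * (f x)^-1 * partial i f x).
Proof.
move=> fx df fc; have [f0|f0] := ltP 0 (f x); first exact: partial_powR_pos.
have Nf0 : 0 < - f x by rewrite oppr_gt0 lt_neqAle fx.
have [|| d1] := @partial_powR_pos N (fun y => - f y) a x i Nf0.
- exact: derivableN.
- exact: continuousN.
have E : (fun y => `|- f y| `^ a) = (fun y => `|f y| `^ a).
  by apply/funext => y; rewrite normrN.
rewrite E normrN in d1 *; move=> ->; split=> //.
rewrite invrN mulrN mulNr -mulrN; congr (_ * (_ * _)).
by rewrite /partial [in LHS](deriveN df) opprK.
Qed.

Lemma Ck_powR N (U : set 'rV[R]_N) k (f : 'rV[R]_N -> R) (a : R) : open U ->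
  (forall x, U x -> f x != 0) -> Ck k U f -> Ck k U (fun x => `|f x| `^ a).
Proof.
move=> Uo f0.
have C0 : Ck 0 U f -> Ck 0 U (fun x => `|f x| `^ a).
  move=> [cf _]; split=> // x Ux.
  have c1 : {for x, continuous (fun x => `|f x|)}.
    apply: (@continuous_comp _ _ _ f (fun z : R => `|z|)); first exact: cf.
    exact: norm_continuous.
  have n0 : 0 < `|f x| by rewrite normr_gt0 f0.
  have [c2 _] := @is_derive1_powR R a _ n0.
  apply: (@continuous_comp _ _ _ (fun x => `|f x|) (@powR R ^~ a)) => //.
  by apply: differentiable_continuous; apply/derivable1_diffP.
elim: k => [//|k IH] Hf; have Hf' := CkW Hf.
have Hp := IH Hf'.
case: Hf => [cf [df pf]].
have P x i (Ux : U x) := partial_powR a (f0 x Ux) (df x Ux i) (cf x Ux).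
split; [|split].
- by case: C0.
- by move=> x Ux i; have [] := P x i Ux.
- move=> i; apply: (eq_Ck Uo (f := fun x => a * (`|f x| `^ a * (f x)^-1 * partial i f x))).
    by move=> x; rewrite inE => Ux; have [_ ->] := P x i Ux.
  apply: CkM => //; first exact: Ck_cst.
  apply: CkM (pf i) => //; apply: CkM => //; exact: CkV.
Qed.

Lemma partial_coord N (j i : 'I_N) (x : 'rV[R]_N) :
  derivable ((fun y : 'rV[R]_N => y 0 j) : _ -> R^o) x (delta_mx 0 i) /\
  partial i (fun y => y 0 j) x = ((j == i)%:R : R).
Proof.
have d : differentiable ((fun y : 'rV[R]_N => y 0 j) : _ -> R^o) x.
  exact: differentiable_coord.
split; first exact: diff_derivable.
have := @derive_mx R _ 1 N id x (delta_mx 0 i) (@derivable_id _ _ _ _).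
by rewrite derive_id => /rowP/(_ j); rewrite !mxE eqxx.
Qed.

Section Closure.
Context {N : nat} {U : set 'rV[R]_N} (Uo : open U).
Implicit Types f g : 'rV[R]_N -> R.

Lemma smooth_cst (c : R) : smooth_on U (fun=> c).
Proof. by apply/smoothP => k; apply: Ck_cst. Qed.

Lemma smoothD f g : smooth_on U f -> smooth_on U g -> smooth_on U (fun x => f x + g x).
Proof. by move=> /smoothP fs /smoothP gs; apply/smoothP => k; apply: CkD. Qed.

Lemma smoothM f g : smooth_on U f -> smooth_on U g -> smooth_on U (fun x => f x * g x).
Proof. by move=> /smoothP fs /smoothP gs; apply/smoothP => k; apply: CkM. Qed.

Lemma smoothV f : (forall x, U x -> f x != 0) -> smooth_on U f ->
  smooth_on U (fun x => (f x)^-1).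
Proof. by move=> f0 /smoothP fs; apply/smoothP => k; apply: CkV. Qed.

Lemma smooth_powR f (a : R) : (forall x, U x -> f x != 0) -> smooth_on U f ->
  smooth_on U (fun x => `|f x| `^ a).
Proof. by move=> f0 /smoothP fs; apply/smoothP => k; apply: Ck_powR. Qed.

Lemma smooth_sum (I : Type) (r : seq I) (P : pred I) (F : I -> 'rV[R]_N -> R) :
  (forall i, smooth_on U (F i)) -> smooth_on U (fun x => \sum_(i <- r | P i) F i x).
Proof.
by move=> H; apply/smoothP => k; apply: Ck_sum => // i; apply/smoothP : k; apply: H.
Qed.

Lemma smooth_comp n (W : set 'rV[R]_n) (F : 'rV[R]_N -> R) (h : 'rV[R]_n -> 'rV[R]_N) :
  open W -> (forall x, W x -> U (h x)) ->
  (forall j, smooth_on W (fun x => h x 0 j)) -> smooth_on U F -> smooth_on W (F \o h).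
Proof.
move=> Wo WU hs /smoothP Fs; apply/smoothP => k; apply: Ck_comp WU _ _ => // j.
by apply/smoothP : k; apply: hs.
Qed.

Lemma smooth_coord j : smooth_on U (fun x => x 0 j).
Proof.
have c0 (V : set 'rV[R]_N) x : V x -> {for x, continuous (fun x : 'rV[R]_N => x 0 j)}.
  by move=> _; exact: coord_continuous.
apply/smoothP => -[|k]; split; [exact: c0 | by [] | exact: c0 |].
split=> [x _ i|i]; first by have [] := partial_coord j i x.
apply: (eq_Ck Uo (f := fun=> (j == i)%:R)); last exact: Ck_cst.
by move=> x _; have [_ ->] := partial_coord j i x.
Qed.

End Closure.
End Composition.

(** * Differential operators and jets *)

Section DiffOp.
Context {R : realType} {n : nat}.
Implicit Types (U : set 'rV[R]_n) (g : 'rV[R]_n -> 'M[R]_n).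

Lemma smooth_partial_comp N (F : 'rV[R]_N -> R) (h : 'rV[R]_n -> 'rV[R]_N)
    (V : set 'rV[R]_N) U x i :
  open V -> V (h x) -> smooth_on V F -> U x ->
  (forall k, smooth_on U (fun y => h y 0 k)) ->
  partial i (F \o h) x = \sum_k partial k F (h x) * partial i (fun y => h y 0 k) x.
Proof.
move=> Vo Vx /smoothP Fs Ux hs.
by apply: (partial_comp Vo Vx (Fs 1%N) _).2 => k; exact: smooth_derivable (hs k) Ux.
Qed.

Definition msmooth m k N (U : set 'rV[R]_N) (A : 'rV[R]_N -> 'M[R]_(m, k)) :=
  forall i j, smooth_on U (fun x => A x i j).

Local Notation jidx r := (@jet_index n r).
Local Notation jdim r := (@jet_dim n r).

Definition jcoord r (k : jidx r) : 'I_(jdim r) := enum_rank k.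

Definition jentry r (k : jidx r) g (x : 'rV[R]_n) : R :=
  match k with
  | inl i => x 0 i
  | inr (l, (a, b)) => partials l (fun y => g y a b) x
  end.

Definition jetmap r g (x : 'rV[R]_n) : 'rV[R]_(jdim r) :=
  \row_(k < jdim r) jentry (enum_val k) g x.

Lemma jetmapE r (k : jidx r) g x : jetmap r g x 0 (jcoord k) = jentry k g x.
Proof. by rewrite mxE enum_rankK. Qed.

Lemma smooth_jentry r (k : jidx r) U g :
  open U -> msmooth U g -> smooth_on U (jentry k g).
Proof.
move=> Uo gs; case: k => [i|[l [a b]]] /=; first exact: smooth_coord.
exact: smooth_partials.
Qed.

Lemma smooth_jetmap r U g k : open U -> msmooth U g -> smooth_on U (fun x => jetmap r g x 0 k).
Proof.
move=> Uo gs; apply: (eq_smooth Uo (f := jentry (enum_val k) g)).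
  by move=> x _; rewrite mxE.
exact: smooth_jentry.
Qed.

Definition jwiden r (k : jidx r) : jidx r.+1 :=
  match k with
  | inl i => inl i
  | inr (l, ab) => inr (widen_bseq (leqnSn r) l, ab)
  end.

Definition jproj r (u : 'rV[R]_(jdim r.+1)) : 'rV[R]_(jdim r) :=
  \row_k u 0 (jcoord (jwiden (enum_val k))).

Lemma jproj_jetmap r g x : jproj (jetmap r.+1 g x) = jetmap r g x.
Proof.
apply/rowP => k; rewrite mxE jetmapE [RHS]mxE.
by case: (enum_val k) => [i|[l [a b]]].
Qed.

Lemma smooth_jproj r k : smooth_on setT (fun u => @jproj r u 0 k).
Proof.
apply: (eq_smooth openT (f := fun u => u 0 (jcoord (jwiden (enum_val k))))).
  by move=> u _; rewrite mxE.
exact: smooth_coord openT _.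
Qed.

Lemma open_preimage (S T : topologicalType) (h : S -> T) (W : set S) (V : set T) :
  open W -> (forall x, W x -> {for x, continuous h}) -> open V ->
  open [set x | W x /\ V (h x)].
Proof.
move=> Wo hc Vo; rewrite openE => x [Wx Vx].
apply: filterI; first exact: open_nbhs_nbhs.
by apply: (hc x Wx); apply: open_nbhs_nbhs.
Qed.

Lemma continuous_jproj r u : {for u, continuous (@jproj r)}.
Proof. by apply: continuous_row => k; apply: (smooth_continuous (@smooth_jproj r k)). Qed.

Variable adm : set 'rV[R]_n -> ('rV[R]_n -> 'M[R]_n) -> Prop.
Hypothesis adm_open : forall U g, adm U g -> open U.
Hypothesis adm_smooth : forall U g, adm U g -> msmooth U g.

(** A nonlinear differential operator of order at most [r] with a smooth symbol [Psi] common to all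
    admissible fields. The set [O] is existential because inverses and powers shrink the domain of
    the symbol; [adm] records the conditions that keep the jets of the fields inside it. *)
Definition diffop r (T : ('rV[R]_n -> 'M[R]_n) -> 'rV[R]_n -> R) : Prop :=
  exists (O : set 'rV[R]_(jdim r)) (Psi : 'rV[R]_(jdim r) -> R),
    [/\ open O, smooth_on O Psi &
        forall U g, adm U g -> forall x, U x ->
          O (jetmap r g x) /\ T g x = Psi (jetmap r g x)].

Lemma diffop_smooth r T U g : diffop r T -> adm U g -> smooth_on U (T g).
Proof.
move=> [ O [Psi [Oo Ps H]]] ag; have Uo := adm_open ag.
apply: (eq_smooth Uo (f := Psi \o jetmap r g)).
  by move=> x; rewrite inE => Ux; have [_ ->] := H _ _ ag x Ux.
apply: (smooth_comp Oo Uo) => // [x Ux|j]; first by have [] := H _ _ ag x Ux.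
exact/smooth_jetmap/adm_smooth.
Qed.

Lemma eq_diffop r T T' :
  (forall U g, adm U g -> {in U, T g =1 T' g}) -> diffop r T -> diffop r T'.
Proof.
move=> E [ O [Psi [Oo Ps H]]]; exists O, Psi; split=> // U g ag x Ux.
rewrite -(E U g ag x (mem_set Ux)); exact: (H U g ag x Ux).
Qed.

Lemma diffop_cst r c : diffop r (fun _ _ => c).
Proof. by exists setT, (fun=> c); split=> //; [exact: openT|exact: smooth_cst openT _]. Qed.

Lemma diffop_entry r (k : jidx r) : diffop r (jentry k).
Proof.
exists setT, (fun u => u 0 (jcoord k)); split; first exact: openT.
  exact: smooth_coord openT _.
by move=> U g ag x Ux; rewrite jetmapE.
Qed.

Lemma diffop_op2 r (op : R -> R -> R) T T' :
  (forall N (V : set 'rV[R]_N) f h, open V -> smooth_on V f -> smooth_on V h ->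
     smooth_on V (fun x => op (f x) (h x))) ->
  diffop r T -> diffop r T' -> diffop r (fun g x => op (T g x) (T' g x)).
Proof.
move=> Hop [ O [Psi [Oo Ps H]]] [ O' [Psi' [Oo' Ps' H']]].
exists (O `&` O'), (fun u => op (Psi u) (Psi' u)); split.
- exact: openI.
- apply: Hop; first exact: openI.
    by apply: smooth_sub Ps => ? [].
  by apply: smooth_sub Ps' => ? [].
- move=> U g ag x Ux; have [? ->] := H U g ag x Ux.
  by have [? ->] := H' U g ag x Ux.
Qed.

Lemma diffopD r T T' : diffop r T -> diffop r T' -> diffop r (fun g x => T g x + T' g x).
Proof. by apply: diffop_op2 => N V f h Vo; apply: smoothD. Qed.

Lemma diffopM r T T' : diffop r T -> diffop r T' -> diffop r (fun g x => T g x * T' g x).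
Proof. by apply: diffop_op2 => N V f h Vo; apply: smoothM. Qed.

Lemma diffopN r T : diffop r T -> diffop r (fun g x => - T g x).
Proof.
move=> dT; apply: (eq_diffop (T := fun g x => -1 * T g x)).
  by move=> U g _ x _; rewrite mulN1r.
by apply: diffopM => //; apply: diffop_cst.
Qed.

Lemma open_smooth_neq0 N (O : set 'rV[R]_N) (Psi : 'rV[R]_N -> R) :
  open O -> smooth_on O Psi -> open [set u | O u /\ Psi u != 0].
Proof.
move=> Oo Ps; apply: (open_preimage (V := [set y | y != 0])) => //.
by move=> u; apply: smooth_continuous.
Qed.

Lemma diffop_op1 r (op : R -> R) T :
  (forall N (V : set 'rV[R]_N) f, open V -> (forall x, V x -> f x != 0) -> smooth_on V f ->
     smooth_on V (fun x => op (f x))) ->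
  (forall U g, adm U g -> forall x, U x -> T g x != 0) ->
  diffop r T -> diffop r (fun g x => op (T g x)).
Proof.
move=> Hop T0 [ O [Psi [Oo Ps H]]].
(* Off this set [op (Psi u)] may be singular; by hypothesis the set contains the jets of all
   admissible fields. *)
exists [set u | O u /\ Psi u != 0], (fun u => op (Psi u)); split.
- exact: open_smooth_neq0.
- apply: Hop; [exact: open_smooth_neq0|by move=> x []|].
  by apply: smooth_sub Ps => ? [].
- move=> U g ag x Ux; have [? E] := H U g ag x Ux.
  by rewrite /= -E; do !split=> //; apply: T0 ag x Ux.
Qed.

Lemma diffopV r T : (forall U g, adm U g -> forall x, U x -> T g x != 0) ->
  diffop r T -> diffop r (fun g x => (T g x)^-1).
Proof. by apply: (diffop_op1 (op := GRing.inv)) => N V f Vo; apply: smoothV. Qed.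

Lemma diffop_powR r a T : (forall U g, adm U g -> forall x, U x -> T g x != 0) ->
  diffop r T -> diffop r (fun g x => `|T g x| `^ a).
Proof. by apply: (diffop_op1 (op := fun y => `|y| `^ a)) => N V f Vo; apply: smooth_powR. Qed.

Lemma diffop_sum r (I : Type) (s : seq I) (P : pred I) T :
  (forall i, diffop r (T i)) -> diffop r (fun g x => \sum_(i <- s | P i) T i g x).
Proof.
move=> H; elim: s => [|i s IH].
  by apply: eq_diffop (diffop_cst r 0) => U g _ x _; rewrite big_nil.
apply: (eq_diffop (T := fun g x => (if P i then T i g x else 0) + \sum_(j <- s | P j) T j g x)).
  by move=> U g _ x _; rewrite big_cons; case: (P i); rewrite ?add0r.
by apply: diffopD => //; case: (P i) => //; exact: diffop_cst.
Qed.

Lemma diffop_prod r (I : Type) (s : seq I) (P : pred I) T :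
  (forall i, diffop r (T i)) -> diffop r (fun g x => \prod_(i <- s | P i) T i g x).
Proof.
move=> H; elim: s => [|i s IH].
  by apply: eq_diffop (diffop_cst r 1) => U g _ x _; rewrite big_nil.
apply: (eq_diffop (T := fun g x => (if P i then T i g x else 1) * \prod_(j <- s | P j) T j g x)).
  by move=> U g _ x _; rewrite big_cons; case: (P i); rewrite ?mul1r.
by apply: diffopM => //; case: (P i) => //; exact: diffop_cst.
Qed.

Lemma diffopS r T : diffop r T -> diffop r.+1 T.
Proof.
move=> [ O [Psi [Oo Ps H]]].
have PO : open [set u | [set: 'rV[R]_(jdim r.+1)] u /\ O (jproj u)].
  by apply: open_preimage => //; [exact: openT|move=> u _; exact: continuous_jproj].
exists [set u | setT u /\ O (jproj u)], (Psi \o @jproj r); split => //.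
- apply: (smooth_comp Oo PO) => // [u []//|j].
  by apply: smooth_sub (@smooth_jproj r j).
- by move=> U g ag x Ux; rewrite /= jproj_jetmap; have [? ->] := H U g ag x Ux.
Qed.

Lemma diffop_partial r T i : diffop r T -> diffop r.+1 (fun g => partial i (T g)).
Proof.
move=> [ O [Psi [Oo Ps H]]].
have PO : open [set u | [set: 'rV[R]_(jdim r.+1)] u /\ O (jproj u)].
  by apply: open_preimage => //; [exact: openT|move=> u _; exact: continuous_jproj].
(* The derivative along x_i of each jet coordinate: a Kronecker delta for the base point, and for a
   derivative the coordinate with [i] prepended, which is available because [u] is a jet of order
   [r.+1]. *)
pose D (k : jidx r) (u : 'rV[R]_(jdim r.+1)) : R :=
  match k with
  | inl j => (j == i)%:R
  | inr (l, ab) => u 0 (jcoord (inr (cons_bseq i l, ab) : jidx r.+1))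
  end.
(* The witness is the total derivative of Psi along x_i. *)
exists [set u | setT u /\ O (jproj u)],
  (fun u => \sum_k partial k Psi (jproj u) * D (enum_val k) u); split => //.
- apply: smooth_sum => // k; apply: smoothM => //.
    apply: (smooth_comp Oo PO) => // [u []//|j|].
      by apply: smooth_sub (@smooth_jproj r j).
    exact: smooth_partial.
  case: (enum_val k) => [j|[l ab]]; first exact: smooth_cst.
  exact: smooth_coord.
- move=> U g ag x Ux; rewrite /= jproj_jetmap; have [Ox _] := H U g ag x Ux.
  split=> //.
  have -> : partial i (T g) x = partial i (Psi \o jetmap r g) x.
    apply: (eq_partial (adm_open ag)); last by rewrite inE.
    by move=> y; rewrite inE => Uy; have [_ ->] := H U g ag y Uy.
  rewrite (smooth_partial_comp i Oo Ox Ps Ux); last first.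
    by move=> k; apply: smooth_jetmap; [exact: adm_open ag | exact: adm_smooth].
  apply: eq_bigr => k _; congr (_ * _).
  have -> : (fun y => jetmap r g y 0 k) = jentry (enum_val k) g.
    by apply/funext => y; rewrite mxE.
  rewrite /D; case: (enum_val k) => [j|[l [a b]]] /=; first by have [] := partial_coord j i x.
  by rewrite jetmapE.
Qed.

Lemma diffop_partials r T (s : seq 'I_n) :
  diffop r T -> diffop (size s + r) (fun g => partials s (T g)).
Proof. by move=> dT; elim: s => // i s IH; apply: diffop_partial IH. Qed.

Lemma diffop_leq r r' T : (r <= r')%N -> diffop r T -> diffop r' T.
Proof.
move=> /subnK <-; elim: (r' - r)%N => // d IH dT.
by rewrite addSn; apply/diffopS/IH.
Qed.

Lemma diffop_det r m (A : ('rV[R]_n -> 'M[R]_n) -> 'rV[R]_n -> 'M[R]_m) :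
  (forall i j, diffop r (fun g x => A g x i j)) -> diffop r (fun g x => \det (A g x)).
Proof.
move=> H; rewrite /determinant; apply: diffop_sum => s.
by apply: diffopM; [exact: diffop_cst | apply: diffop_prod].
Qed.

Lemma diffop_invmx r m (A : ('rV[R]_n -> 'M[R]_n) -> 'rV[R]_n -> 'M[R]_m) i j :
  (forall U g, adm U g -> forall x, U x -> A g x \in unitmx) ->
  (forall i j, diffop r (fun g x => A g x i j)) -> diffop r (fun g x => invmx (A g x) i j).
Proof.
move=> Au H.
(* Cramer's rule: the inverse is polynomial in the entries up to one division by the determinant. *)
apply: (eq_diffop (T := fun g x => (\det (A g x))^-1 *
    ((-1) ^+ (j + i) * \det (row' j (col' i (A g x)))))).
  by move=> U g ag x; rewrite inE => Ux; rewrite /invmx (Au _ _ ag _ Ux) !mxE.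
apply: diffopM.
  apply: diffopV; last exact: diffop_det.
  by move=> U g ag x Ux; rewrite -unitfE -unitmxE; apply: Au ag x Ux.
apply: diffopM; first exact: diffop_cst.
apply: diffop_det => a b.
by apply: eq_diffop (H (lift j a) (lift i b)) => U g _ x _; rewrite !mxE.
Qed.

End DiffOp.

(** * Algebraic Weyl tensors *)

Section WeylAlgebra.
Context {K : fieldType} {n : nat}.
Implicit Types (g gi B U V J Ji A : 'M[K]_n) (F C : 'I_n -> 'I_n -> 'M[K]_n).

(** [F k l] stands for the matrix of R^i_jkl in [i] and [j], so that [F] is a matrix-valued 2-form;
    the Ricci contraction pairs [i] with [k]. *)
Definition ricM F : 'M[K]_n := \matrix_(j, l) \sum_i F i l i j.

(** The entry (i, j) is U_ik V_lj; to obtain B_jl, the second factor has to be the transpose of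
    B. *)
Definition outer U V (k l : 'I_n) : 'M[K]_n := col k U *m row l V.

Definition alt F k l := F k l - F l k.

(* The Kulkarni-Nomizu product of g and B, with one index raised by [gi]. *)
Definition kn g gi B k l := alt (outer 1%:M B^T) k l + alt (outer (gi *m B) g^T) k l.

Definition weylM g gi F k l : 'M[K]_n :=
  F k l - (n%:R - 2)^-1 *: kn g gi (ricM F) k l
  + (\tr (gi *m ricM F) / ((n%:R - 1) * (n%:R - 2))) *: alt (outer 1%:M g^T) k l.

Definition contract gi (Phi : 'I_n -> 'I_n -> K) : K := \sum_k \sum_c gi k c * Phi k c.

(** The trace contracts the indices [i] and [j] of two copies of C^i_jkl, with [g] and [gi]
    respectively; the outer contractions treat the form indices. *)
Definition sqM g gi C : K :=
  contract gi (fun k c => contract gi (fun l d => \tr ((C c d)^T *m g *m C k l *m gi))).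

Lemma outerE U V k l i j : outer U V k l i j = U i k * V l j.
Proof. by rewrite mxE big_ord1 !mxE. Qed.

Lemma alt_outerE U V k l i j :
  alt (outer U V) k l i j = U i k * V l j - U i l * V k j.
Proof. by rewrite /alt [LHS]mxE [X in _ + X]mxE !outerE. Qed.

Lemma knE g gi B k l i j : kn g gi B k l i j =
  (i == k)%:R * B j l - (i == l)%:R * B j k
  + ((gi *m B) i k * g j l - (gi *m B) i l * g j k).
Proof. by rewrite /kn [LHS]mxE !alt_outerE !(mxE trmx_key, mxE scalar_mx_key). Qed.

Lemma sum_delta_l (i : 'I_n) (f : 'I_n -> K) : \sum_k (i == k)%:R * f k = f i.
Proof.
rewrite (bigD1 i) //= eqxx mul1r big1 ?addr0 // => k.
by rewrite eq_sym => /negbTE ->; rewrite mul0r.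
Qed.

(** Of the four terms of the product, one contracts to n B, two to -B and one to the trace part:
    this is the origin of the factor n - 2 in the Weyl tensor. *)
Lemma ricM_kn g gi B : g *m gi = 1%:M ->
  ricM (kn g gi B) = (n%:R - 2) *: B + \tr (gi *m B) *: g.
Proof.
move=> ggi; apply/matrixP => j l; rewrite !mxE.
transitivity (\sum_i (B j l - (i == l)%:R * B j i
    + ((gi *m B) i i * g j l - (gi *m B) i l * g j i))).
  by apply: eq_bigr => i _; rewrite knE eqxx mul1r.
rewrite !big_split /= !sumrN sumr_const card_ord.
have -> : \sum_i (i == l)%:R * B j i = B j l.
  by under eq_bigr do rewrite eq_sym; exact: sum_delta_l.
have -> : \sum_i (gi *m B) i l * g j i = B j l.
  under eq_bigr do rewrite mulrC.
  by have := congr1 (fun X : 'M[K]_n => X j l) (mulmxA g gi B); rewrite mxE ggi mul1mx.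
rewrite -mulr_suml -/(\tr _) -mulr_natl; ring.
Qed.

Lemma kn_lin g gi B B' a k l : kn g gi (B + a *: B') k l = kn g gi B k l + a *: kn g gi B' k l.
Proof.
apply/matrixP => i j; rewrite [RHS]mxE [X in _ = _ + X]mxE !knE.
rewrite mulmxDr -scalemxAr !mxE; ring.
Qed.

Lemma kn_conf g gi B a k l : a != 0 -> kn (a *: g) (a^-1 *: gi) B k l = kn g gi B k l.
Proof.
move=> a0; apply/matrixP => i j; rewrite !knE -scalemxAl !mxE; field.
exact: a0.
Qed.

Lemma kn_self g gi k l : gi *m g = 1%:M -> kn g gi g k l = 2 *: alt (outer 1%:M g^T) k l.
Proof.
by move=> gig; apply/matrixP => i j; rewrite knE gig [RHS]mxE alt_outerE !mxE; ring.
Qed.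

Lemma ricM_sub F F' : ricM (fun k l => F k l - F' k l) = ricM F - ricM F'.
Proof.
by apply/matrixP => j l; rewrite !mxE -sumrB; apply: eq_bigr => i _; rewrite !mxE.
Qed.

(** By [ricM_kn] the Ricci part changes by -(n - 2) B - t g, where t is the trace of B. The B term
    undoes the change of [F]. The t term is, by [kn_self], a multiple of the last summand of
    [weylM], where it cancels against the change of the scalar curvature, -2 (n - 1) t up to the
    factor 1/a. *)
Lemma weylM_conf g gi F B a k l : n%:R - 1 != 0 :> K -> n%:R - 2 != 0 :> K ->
  a != 0 -> g *m gi = 1%:M ->
  weylM (a *: g) (a^-1 *: gi) (fun k l => F k l - kn g gi B k l) k l = weylM g gi F k l.
Proof.
move=> n1 n2 a0 ggi; have gig := mulmx1C ggi.
rewrite /weylM kn_conf // ricM_sub ricM_kn //.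
set t := \tr (gi *m B); set s := \tr (gi *m ricM F).
have -> : ricM F - ((n%:R - 2) *: B + t *: g) =
    (ricM F + (2 - n%:R) *: B) + (- t) *: g.
  by apply/matrixP => i j; rewrite !mxE; ring.
have -> : \tr ((a^-1 *: gi) *m (ricM F + (2 - n%:R) *: B + - t *: g)) =
    a^-1 * (s + (2 - n%:R) * t - t * n%:R).
  rewrite -scalemxAl mxtraceZ !mulmxDr -!scalemxAr gig.
  rewrite (mxtraceD (_ + _)) (mxtraceD (gi *m _)) !mxtraceZ mxtrace1 -/t -/s.
  by rewrite mulNr.
have -> : alt (outer 1%:M (a *: g)^T) k l = a *: alt (outer 1%:M g^T) k l.
  by apply/matrixP => i j; rewrite [RHS]mxE !alt_outerE !mxE; ring.
rewrite !kn_lin kn_self //.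
move: (F k l) (kn g gi B k l) (kn g gi (ricM F) k l) (alt _ k l) => f b c d.
apply/matrixP => i j; rewrite !mxE; field.
by rewrite n1 n2 a0.
Qed.

(** The form indices are carried by [J]; the conjugation involves transposes because Jacobian
    matrices follow the row-vector convention. *)
Definition pullF J Ji F k l : 'M[K]_n :=
  \sum_a \sum_b (J k a * J l b) *: (Ji^T *m F a b *m J^T).

Lemma pullF_entry J Ji F k l i j : pullF J Ji F k l i j =
  \sum_a \sum_b \sum_c \sum_d J k a * J l b * (Ji c i * F a b c d * J j d).
Proof.
rewrite summxE; apply: eq_bigr => a _; rewrite summxE; apply: eq_bigr => b _.
rewrite mxE -mulmxA mxE big_distrr /=; apply: eq_bigr => c _.
rewrite [(F a b *m _) c j]mxE !big_distrr /=; apply: eq_bigr => d _.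
by rewrite !mxE !mulrA.
Qed.

Lemma pull_outer J Ji U V k l : J *m Ji = 1%:M ->
  pullF J Ji (outer U V) k l = outer (Ji^T *m U *m J^T) (J *m V *m J^T) k l.
Proof.
move=> JJi; apply/matrixP => i j; rewrite outerE pullF_entry.
rewrite -mulmxA mxE -mulmxA mxE.
have -> : \sum_c Ji^T i c * (U *m J^T) c k = \sum_a \sum_c Ji c i * U c a * J k a.
  rewrite exchange_big /=; apply: eq_bigr => c _; rewrite [(U *m _) c k]mxE big_distrr /=.
  by apply: eq_bigr => a _; rewrite !mxE mulrA.
have -> : \sum_b J l b * (V *m J^T) b j = \sum_b \sum_d J l b * V b d * J j d.
  apply: eq_bigr => b _; rewrite [(V *m _) b j]mxE big_distrr /=.
  by apply: eq_bigr => d _; rewrite !mxE mulrA.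
rewrite big_distrl; apply: eq_bigr => a _ /=.
rewrite big_distrr; apply: eq_bigr => b _ /=.
rewrite big_distrl; apply: eq_bigr => c _ /=.
rewrite big_distrr; apply: eq_bigr => d _ /=.
by rewrite outerE; ring.
Qed.

Lemma ricM_pull J Ji F : J *m Ji = 1%:M -> ricM (pullF J Ji F) = J *m ricM F *m J^T.
Proof.
move=> JJi; have JiJ := mulmx1C JJi.
apply/matrixP => j l; rewrite -mulmxA !mxE.
transitivity (\sum_i \sum_a \sum_c Ji c i * J i a * (\sum_b \sum_d J l b * F a b c d * J j d)).
  apply: eq_bigr => i _; rewrite pullF_entry; apply: eq_bigr => a _.
  rewrite exchange_big /=; apply: eq_bigr => c _.
  rewrite big_distrr; apply: eq_bigr => b _ /=.
  by rewrite big_distrr; apply: eq_bigr => d _ /=; ring.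
rewrite exchange_big /=.
transitivity (\sum_a \sum_c (c == a)%:R * (\sum_b \sum_d J l b * F a b c d * J j d)).
  apply: eq_bigr => a _; rewrite exchange_big /=; apply: eq_bigr => c _.
  rewrite -big_distrl /=; congr (_ * _).
  by have := congr1 (fun X : 'M[K]_n => X c a) JiJ; rewrite !mxE.
transitivity (\sum_a \sum_b \sum_d J l b * F a b a d * J j d).
  apply: eq_bigr => a _; under eq_bigr do rewrite eq_sym.
  exact: (sum_delta_l a (fun c => \sum_b \sum_d J l b * F a b c d * J j d)).
transitivity (\sum_d \sum_b \sum_a J l b * F a b a d * J j d).
  rewrite exchange_big [RHS]exchange_big /=; apply: eq_bigr => b _.
  exact: exchange_big.
apply: eq_bigr => d _; rewrite [(ricM F *m _) d l]mxE big_distrr /=; apply: eq_bigr => b _.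
rewrite !mxE big_distrl big_distrr /=.
by apply: eq_bigr => a _; ring.
Qed.

Lemma pullF_lin J Ji F F' a k l :
  pullF J Ji (fun k l => F k l + a *: F' k l) k l = pullF J Ji F k l + a *: pullF J Ji F' k l.
Proof.
rewrite /pullF scaler_sumr -big_split /=; apply: eq_bigr => b _.
rewrite scaler_sumr -big_split /=; apply: eq_bigr => c _.
by rewrite mulmxDr -scalemxAr mulmxDl -scalemxAl scalerDr !scalerA [a * _]mulrC.
Qed.

Lemma pull_swap J Ji F k l : pullF J Ji (fun k l => F l k) k l = pullF J Ji F l k.
Proof.
rewrite /pullF exchange_big /=; apply: eq_bigr => a _; apply: eq_bigr => b _.
by rewrite [J k _ * _]mulrC.
Qed.

Lemma eq_pullF J Ji F F' k l : (forall k l, F k l = F' k l) -> pullF J Ji F k l = pullF J Ji F' k l.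
Proof. by move=> E; apply: eq_bigr => a _; apply: eq_bigr => b _; rewrite E. Qed.

Lemma pull_alt J Ji F k l : pullF J Ji (alt F) k l = alt (pullF J Ji F) k l.
Proof.
rewrite /alt -(pull_swap _ _ _ k l) -scaleN1r -pullF_lin.
by apply: eq_pullF => a b; rewrite scaleN1r.
Qed.

Section Pullback.
Variables (J Ji g' gi' g gi : 'M[K]_n).
Hypotheses (JJi : J *m Ji = 1%:M) (gE : g = J *m g' *m J^T) (giE : gi = Ji^T *m gi' *m Ji).

Let JiJ : Ji *m J = 1%:M. Proof. exact: mulmx1C. Qed.
Let JitJt : Ji^T *m J^T = 1%:M. Proof. by rewrite -trmx_mul JJi trmx1. Qed.
Let JtJit : J^T *m Ji^T = 1%:M. Proof. by rewrite -trmx_mul JiJ trmx1. Qed.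

Lemma kn_pull B k l : kn g gi (J *m B *m J^T) k l = pullF J Ji (kn g' gi' B) k l.
Proof.
rewrite (@eq_pullF _ _ _ (fun k l => alt (outer 1%:M B^T) k l
    + 1 *: alt (outer (gi' *m B) g'^T) k l)); last by move=> a b; rewrite scale1r.
rewrite pullF_lin scale1r !pull_alt /alt !pull_outer // mulmx1 JitJt /kn /alt.
have -> : (J *m B *m J^T)^T = J *m B^T *m J^T by rewrite !trmx_mul trmxK mulmxA.
have -> : g^T = J *m g'^T *m J^T by rewrite gE !trmx_mul trmxK mulmxA.
have -> // : gi *m (J *m B *m J^T) = Ji^T *m (gi' *m B) *m J^T.
by rewrite giE !mulmxA -(mulmxA _ Ji J) JiJ mulmx1.
Qed.

Lemma weylM_pull F k l :
  weylM g gi (pullF J Ji F) k l = pullF J Ji (weylM g' gi' F) k l.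
Proof.
have -> : pullF J Ji (weylM g' gi' F) k l = pullF J Ji (fun k l =>
    (F k l + (- (n%:R - 2)^-1) *: kn g' gi' (ricM F) k l)
     + (\tr (gi' *m ricM F) / ((n%:R - 1) * (n%:R - 2))) *: alt (outer 1%:M g'^T) k l) k l.
  by apply: eq_pullF => a b; rewrite scaleNr.
rewrite pullF_lin pullF_lin -kn_pull pull_alt /alt !pull_outer // mulmx1 JitJt.
rewrite /weylM ricM_pull // scaleNr /alt.
have -> : g^T = J *m g'^T *m J^T by rewrite gE !trmx_mul trmxK mulmxA.
have -> // : \tr (gi *m (J *m ricM F *m J^T)) = \tr (gi' *m ricM F).
rewrite giE !mulmxA -(mulmxA _ Ji J) JiJ mulmx1 mxtrace_mulC !mulmxA JtJit.
by rewrite mul1mx.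
Qed.

Lemma contract_pull (Phi Phi' : 'I_n -> 'I_n -> K) :
  (forall k c, Phi k c = \sum_a \sum_e J k a * J c e * Phi' a e) ->
  contract gi Phi = contract gi' Phi'.
Proof.
move=> H.
have giE' : gi' = J^T *m gi *m J.
  by rewrite giE !mulmxA JtJit mul1mx -mulmxA JiJ mulmx1.
transitivity (\sum_k \sum_c \sum_a \sum_e J k a * gi k c * J c e * Phi' a e).
  apply: eq_bigr => k _; apply: eq_bigr => c _; rewrite H big_distrr /=.
  by apply: eq_bigr => a _; rewrite big_distrr /=; apply: eq_bigr => e _; ring.
transitivity (\sum_a \sum_e \sum_c \sum_k J k a * gi k c * J c e * Phi' a e).
  under eq_bigr do rewrite exchange_big; rewrite exchange_big /=.
  apply: eq_bigr => a _; under eq_bigr do rewrite exchange_big; rewrite exchange_big /=.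
  by apply: eq_bigr => e _; rewrite exchange_big.
apply: eq_bigr => a _; apply: eq_bigr => e _.
rewrite giE' mxE big_distrl /=; apply: eq_bigr => c _; rewrite mxE !big_distrl /=.
by apply: eq_bigr => k _; rewrite mxE.
Qed.

(** Serves for either copy of the 2-form in the quadratic expression [sqM], the other one being held
    fixed. *)
Lemma trace_sum (A : 'M[K]_n -> K) C c d : (forall a X Y, A (a *: X + Y) = a * A X + A Y) ->
  A (pullF J Ji C c d) = \sum_a \sum_b J c a * J d b * A (Ji^T *m C a b *m J^T).
Proof.
move=> Al.
have A0 : A 0 = 0 by have := Al (-1) 0 0; rewrite scaler0 addr0 mulN1r addNr.
have AD X Y : A (X + Y) = A X + A Y by have := Al 1 X Y; rewrite scale1r mul1r.
rewrite /pullF (big_morph A AD A0); apply: eq_bigr => a _.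
rewrite (big_morph A AD A0); apply: eq_bigr => b _.
by have := Al (J c a * J d b) (Ji^T *m C a b *m J^T) 0; rewrite A0 !addr0.
Qed.

Lemma sqM_pull C : sqM g gi (pullF J Ji C) = sqM g' gi' C.
Proof.
pose T (a b c d : 'I_n) := \tr ((C c d)^T *m g' *m C a b *m gi').
(* Cyclicity of the trace brings the last pair of [J] and [Ji] together. *)
have core a b c d : \tr ((Ji^T *m C c d *m J^T)^T *m g *m (Ji^T *m C a b *m J^T) *m gi) = T a b c d.
  rewrite !trmx_mul !trmxK gE giE !mulmxA.
  do 2! (rewrite -(mulmxA _ J^T Ji^T) JtJit mulmx1).
  by rewrite -(mulmxA _ Ji J) JiJ mulmx1 -!mulmxA mxtrace_mulC !mulmxA -(mulmxA _ Ji J) JiJ mulmx1.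
have exp k l c d : \tr ((pullF J Ji C c d)^T *m g *m pullF J Ji C k l *m gi) =
   \sum_a \sum_e J k a * J c e * (\sum_b \sum_f J l b * J d f * T a b e f).
  rewrite (trace_sum (A := fun X => \tr (X^T *m g *m pullF J Ji C k l *m gi))); last first.
    move=> a X Y; rewrite linearP /= !mulmxDl mxtraceD -!scalemxAl mxtraceZ.
    by [].
  transitivity (\sum_e \sum_f \sum_a \sum_b J c e * J d f * (J k a * J l b * T a b e f)).
    apply: eq_bigr => e _; apply: eq_bigr => f _.
    rewrite (trace_sum (A := fun X => \tr ((Ji^T *m C e f *m J^T)^T *m g *m X *m gi))); last first.
      by move=> a X Y; rewrite mulmxDr mulmxDl mxtraceD -scalemxAr -scalemxAl mxtraceZ.
    rewrite big_distrr; apply: eq_bigr => a _ /=; rewrite big_distrr; apply: eq_bigr => b _ /=.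
    by rewrite core.
  rewrite [RHS]exchange_big /=; apply: eq_bigr => e _.
  rewrite exchange_big /=; apply: eq_bigr => a _.
  rewrite exchange_big /= big_distrr; apply: eq_bigr => b _ /=.
  by rewrite big_distrr; apply: eq_bigr => f _ /=; ring.
(* The pairs (k, c) and (l, d) are treated one after the other; the second use of the lemma acts on
   the inner contraction, with [k] and [c] fixed. *)
apply: contract_pull => k c.
rewrite (@contract_pull _ (fun b f => \sum_a \sum_e J k a * J c e * T a b e f)); last first.
  move=> l d; rewrite exp.
  transitivity (\sum_a \sum_e \sum_b \sum_f J k a * J c e * (J l b * J d f * T a b e f)).
    apply: eq_bigr => a _; apply: eq_bigr => e _; rewrite big_distrr; apply: eq_bigr => b _ /=.
    by rewrite big_distrr.
  transitivity (\sum_b \sum_f \sum_a \sum_e J k a * J c e * (J l b * J d f * T a b e f)).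
    under eq_bigr do rewrite exchange_big; rewrite exchange_big /=.
    apply: eq_bigr => b _; under eq_bigr do rewrite exchange_big; rewrite exchange_big /=.
    by [].
  apply: eq_bigr => b _; apply: eq_bigr => f _.
  rewrite big_distrr; apply: eq_bigr => a _ /=; rewrite big_distrr; apply: eq_bigr => e _ /=.
  by ring.
rewrite /contract.
transitivity (\sum_b \sum_f \sum_a \sum_e J k a * J c e * (gi' b f * T a b e f)).
  apply: eq_bigr => b _; apply: eq_bigr => f _.
  rewrite big_distrr; apply: eq_bigr => a _ /=; rewrite big_distrr; apply: eq_bigr => e _ /=.
  by ring.
under eq_bigr do rewrite exchange_big; rewrite exchange_big /=; apply: eq_bigr => a _.
under eq_bigr do rewrite exchange_big; rewrite exchange_big /=; apply: eq_bigr => e _.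
rewrite big_distrr; apply: eq_bigr => b _ /=.
by rewrite big_distrr.
Qed.

End Pullback.

Lemma contractZ gi a (Phi : 'I_n -> 'I_n -> K) :
  contract (a *: gi) Phi = a * contract gi Phi.
Proof.
rewrite /contract big_distrr; apply: eq_bigr => k _ /=; rewrite big_distrr.
by apply: eq_bigr => c _ /=; rewrite mxE mulrA.
Qed.

Lemma eq_contract gi (Phi Phi' : 'I_n -> 'I_n -> K) :
  (forall k c, Phi k c = Phi' k c) -> contract gi Phi = contract gi Phi'.
Proof. by move=> E; apply: eq_bigr => k _; apply: eq_bigr => c _; rewrite E. Qed.

Lemma eq_sqM g gi C C' : (forall k l, C k l = C' k l) -> sqM g gi C = sqM g gi C'.
Proof.
by move=> E; apply: eq_contract => k c; apply: eq_contract => l d; rewrite !E.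
Qed.

Lemma eq_weylM g gi F F' : (forall k l, F k l = F' k l) ->
  forall k l, weylM g gi F k l = weylM g gi F' k l.
Proof.
move=> E k l; have -> // : F = F'.
by apply/boolp.funext => a; apply/boolp.funext => b.
Qed.

Lemma contractZr gi a (Phi : 'I_n -> 'I_n -> K) :
  contract gi (fun k c => a * Phi k c) = a * contract gi Phi.
Proof.
rewrite /contract big_distrr; apply: eq_bigr => k _ /=; rewrite big_distrr.
by apply: eq_bigr => c _ /=; ring.
Qed.

(** One factor [g] against three factors [gi], with C^i_jkl held fixed, leaves the weight -2. *)
Lemma sqM_conf g gi C a : a != 0 -> sqM (a *: g) (a^-1 *: gi) C = a^-1 ^+ 2 * sqM g gi C.
Proof.
move=> a0; rewrite /sqM contractZ expr2 -mulrA; congr (_ * _); rewrite -contractZr.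
apply: eq_contract => k c; rewrite contractZ; congr (_ * _).
apply: eq_contract => l d.
by rewrite -!(scalemxAr, scalemxAl) scalerA mulVf // scale1r.
Qed.

End WeylAlgebra.

(** * Curvature *)

Section Entries.
Context {V : pzRingType} {m p q : nat}.
Implicit Types A B : 'M[V]_(m, p).
Lemma entryD A B i j : (A + B) i j = A i j + B i j. Proof. by rewrite mxE. Qed.
Lemma entryB A B i j : (A - B) i j = A i j - B i j. Proof. by rewrite !mxE. Qed.
Lemma entryZ a A i j : (a *: A) i j = a * A i j. Proof. by rewrite mxE. Qed.
Lemma entryM A (B : 'M[V]_(p, q)) i j : (A *m B) i j = \sum_k A i k * B k j.
Proof. by rewrite mxE. Qed.
Lemma entryT A i j : A^T i j = A j i. Proof. by rewrite mxE. Qed.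
End Entries.

(** * Curvature expressions as differential operators of order at most two *)

Section CurvatureOperators.
Context {R : realType} {n : nat}.
Implicit Types (U : set 'rV[R]_n) (g : 'rV[R]_n -> 'M[R]_n).

Definition nondegenerate_field U g :=
  [/\ open U, msmooth U g & forall x, U x -> g x \in unitmx].

Lemma nondeg_open U g : nondegenerate_field U g -> open U. Proof. by case. Qed.
Lemma nondeg_smooth U g : nondegenerate_field U g -> msmooth U g. Proof. by case. Qed.
Lemma nondeg_unit U g : nondegenerate_field U g -> forall x, U x -> g x \in unitmx.
Proof. by case. Qed.

Local Notation op := (diffop nondegenerate_field).

Local Notation opS := (diffopS (adm := nondegenerate_field)).
Local Notation opd := (diffop_partial nondeg_open nondeg_smooth).

Lemma diffop_fld (a b : 'I_n) : op 0 (fun g x => g x a b).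
Proof. exact: (diffop_entry _ (inr (nil_bseq 0 _, (a, b)) : @jet_index n 0)). Qed.

Lemma diffop_inv (a b : 'I_n) : op 0 (fun g x => invmx (g x) a b).
Proof.
by apply: (diffop_invmx (A := fun g x => g x)) nondeg_unit _ => i j; apply: diffop_fld.
Qed.

Lemma diffop_christoffel (i j k : 'I_n) : op 1 (fun g => christoffel g i j k).
Proof.
apply: diffopM; first exact: diffop_cst.
apply: diffop_sum => l; apply: diffopM; first exact/opS/diffop_inv.
apply: diffopD; first apply: diffopD; last apply: diffopN; apply: opd; exact: diffop_fld.
Qed.

Lemma diffop_riemann (i j k l : 'I_n) : op 2 (fun g => riemann g i j k l).
Proof.
have C1 a b c : op 2 (fun g => christoffel g a b c) by apply/opS/diffop_christoffel.
apply: diffopD.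
  by apply: diffopD; last apply: diffopN; apply: opd; exact: diffop_christoffel.
apply: diffop_sum => m; apply: diffopD; last apply: diffopN; apply: diffopM; exact: C1.
Qed.

Lemma diffop_ricci_up (i l : 'I_n) : op 2 (fun g => ricci_up g i l).
Proof.
apply: diffop_sum => j; apply: diffopM; first exact/opS/opS/diffop_inv.
by apply: diffop_sum => m; apply: diffop_riemann.
Qed.

Lemma diffop_weyl (i j k l : 'I_n) : op 2 (fun g => weyl g i j k l).
Proof.
have Rc a b : op 2 (fun g => ricci g a b).
  by apply: diffop_sum => m; apply: diffop_riemann.
have G a b : op 2 (fun g x => g x a b) by exact/opS/opS/diffop_fld.
have K c : op 2 (fun _ _ => c) by exact: diffop_cst.
have Ru := diffop_ricci_up.
apply: diffopD; first apply: diffopD; first exact: diffop_riemann.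
  apply: diffopN; apply: diffopM => //.
  by do !apply: diffopD; do ?apply: diffopN; apply: diffopM.
apply: diffopM.
  by apply: diffopM => //; apply: diffop_sum => m; apply: Ru.
by apply: diffopD; do ?apply: diffopN; apply: diffopM.
Qed.

Lemma diffop_weyl_sq : op 2 (fun g => weyl_sq_loc g).
Proof.
have G a b : op 2 (fun g x => g x a b) by exact/opS/opS/diffop_fld.
have Gi a b : op 2 (fun g x => invmx (g x) a b) by exact/opS/opS/diffop_inv.
have W := diffop_weyl.
do 4! apply: diffop_sum => ?; apply: diffopM; first by apply: diffop_sum => a; apply: diffopM.
by do 3! apply: diffop_sum => ?; do !apply: diffopM.
Qed.

End CurvatureOperators.

(* Locked because comparing two distinct partial derivatives by conversion
   unfolds both down to limits. *)
HB.lock Definition mpartial (R : realType) (N m p : nat) (k : 'I_N)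
    (A : 'rV[R]_N -> 'M[R]_(m, p)) (x : 'rV[R]_N) : 'M[R]_(m, p) :=
  \matrix_(i, j) partial k (fun y => A y i j) x.
Arguments mpartial {R N m p} k A x.

(** * Differentiation of matrix-valued functions *)

Section MatrixCalculus.
Context {R : realType} {N : nat} {U : set 'rV[R]_N} (Uo : open U).

Lemma mpartialE m p (k : 'I_N) (A : 'rV[R]_N -> 'M[R]_(m, p)) x i j :
  mpartial k A x i j = partial k (fun y => A y i j) x.
Proof. by rewrite mpartial.unlock mxE. Qed.

Lemma partialC (f : 'rV[R]_N -> R) i j x : smooth_on U f -> U x ->
  partial i (partial j f) x = partial j (partial i f) x.
Proof.
move=> fs Ux.
apply: (@schwarz R 'rV[R]_N f (partial j f) (partial i f) (partial i (partial j f))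
   (partial j (partial i f)) (delta_mx 0 j) (delta_mx 0 i)) => //.
- have : nbhs x U by apply: open_nbhs_nbhs.
  apply: filterS => y Uy; split.
  + exact: smooth_derivable fs Uy.
  + exact: smooth_derivable fs Uy.
  + by apply: (smooth_derivable (U := U)) Uy; apply: smooth_partial.
  + by apply: (smooth_derivable (U := U)) Uy; apply: smooth_partial.
- by apply: smooth_continuous Ux; do 2 apply: smooth_partial.
- by apply: smooth_continuous Ux; do 2 apply: smooth_partial.
Qed.

Lemma smooth_partialD (f g : 'rV[R]_N -> R) i x : smooth_on U f -> smooth_on U g -> U x ->
  partial i (fun y => f y + g y) x = partial i f x + partial i g x.
Proof. by move=> fs gs Ux; apply: partialD; [exact: smooth_derivable fs Ux | exact: smooth_derivable gs Ux]. Qed.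

Lemma smooth_partialM (f g : 'rV[R]_N -> R) i x : smooth_on U f -> smooth_on U g -> U x ->
  partial i (fun y => f y * g y) x = f x * partial i g x + g x * partial i f x.
Proof. by move=> fs gs Ux; apply: partialM; [exact: smooth_derivable fs Ux | exact: smooth_derivable gs Ux]. Qed.

Lemma partial_cst (c : R) i (x : 'rV[R]_N) : partial i (fun=> c) x = 0.
Proof. exact: derive_cst. Qed.

Lemma smooth_partial_sum (I : Type) (r : seq I) (F : I -> 'rV[R]_N -> R) i x :
  (forall a, smooth_on U (F a)) -> U x ->
  partial i (fun y => \sum_(a <- r) F a y) x = \sum_(a <- r) partial i (F a) x.
Proof.
move=> Fs Ux; elim: r => [|a r IH].
  rewrite big_nil -[RHS](partial_cst 0 i x); congr (partial i _ x).
  by apply/funext => y; rewrite big_nil.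
rewrite big_cons -IH -smooth_partialD //; last exact: smooth_sum.
by congr (partial i _ x); apply/funext => y; rewrite big_cons.
Qed.

Section Rectangular.
Context {m p q : nat}.
Implicit Types (A : 'rV[R]_N -> 'M[R]_(m, p)) (B : 'rV[R]_N -> 'M[R]_(p, q)).

Lemma msmoothM A B : msmooth U A -> msmooth U B -> msmooth U (fun x => A x *m B x).
Proof.
move=> As Bs i j; apply: (eq_smooth Uo (f := fun x => \sum_k A x i k * B x k j)).
  by move=> x _; rewrite mxE.
by apply: smooth_sum => // k; apply: smoothM.
Qed.

Lemma msmoothZ (c : 'rV[R]_N -> R) A : smooth_on U c -> msmooth U A ->
  msmooth U (fun x => c x *: A x).
Proof.
move=> cs As i j; apply: (eq_smooth Uo (f := fun x => c x * A x i j)).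
  by move=> x _; rewrite mxE.
exact: (smoothM Uo cs (As i j)).
Qed.

Lemma msmooth_tr A : msmooth U A -> msmooth U (fun x => (A x)^T).
Proof.
move=> As i j; apply: (eq_smooth Uo (f := fun x => A x j i)) => // x _.
by rewrite mxE.
Qed.

Lemma msmooth_mpartial k A : msmooth U A -> msmooth U (mpartial k A).
Proof.
move=> As i j; apply: (eq_smooth Uo (f := partial k (fun y => A y i j))).
  by move=> x _; rewrite mpartialE.
exact: smooth_partial.
Qed.

Lemma eq_msmooth A A' : {in U, A =1 A'} -> msmooth U A -> msmooth U A'.
Proof. by move=> E As i j; apply: eq_smooth (As i j) => // x xU; rewrite E. Qed.

Lemma eq_mpartial k A A' x : {in U, A =1 A'} -> U x -> mpartial k A x = mpartial k A' x.
Proof.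
move=> E Ux; apply/matrixP => i j; rewrite !mpartialE; apply: (eq_partial Uo); last by rewrite inE.
by move=> y yU; rewrite E.
Qed.

Lemma mpartialD k A A' x : msmooth U A -> msmooth U A' -> U x ->
  mpartial k (fun y => A y + A' y) x = mpartial k A x + mpartial k A' x.
Proof.
move=> As As' Ux; apply/matrixP => i j; rewrite [RHS]mxE !mpartialE -smooth_partialD //.
by congr (partial k _ x); apply/funext => y; rewrite mxE.
Qed.

Lemma mpartialM k A B x : msmooth U A -> msmooth U B -> U x ->
  mpartial k (fun y => A y *m B y) x = mpartial k A x *m B x + A x *m mpartial k B x.
Proof.
move=> As Bs Ux; apply/matrixP => i j; rewrite [RHS]mxE ![(_ *m _) i j]mxE mpartialE -big_split /=.
transitivity (partial k (fun y => \sum_a A y i a * B y a j) x).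
  by congr (partial k _ x); apply/funext => y; rewrite mxE.
rewrite smooth_partial_sum //; last by move=> a; apply: smoothM.
apply: eq_bigr => a _; rewrite (smooth_partialM k (As i a) (Bs a j) Ux) !mpartialE.
by rewrite addrC [B x a j * _]mulrC.
Qed.

Lemma mpartialZ k (c : 'rV[R]_N -> R) A x : smooth_on U c -> msmooth U A -> U x ->
  mpartial k (fun y => c y *: A y) x = partial k c x *: A x + c x *: mpartial k A x.
Proof.
move=> cs As Ux; apply/matrixP => i j; rewrite entryD !entryZ !mpartialE.
transitivity (partial k (fun y => c y * A y i j) x).
  by congr (partial k _ x); apply/funext => y; rewrite mxE.
by rewrite (smooth_partialM k cs (As i j) Ux) addrC [A x i j * _]mulrC.
Qed.

Lemma mpartial_tr k A x : mpartial k (fun y => (A y)^T) x = (mpartial k A x)^T.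
Proof.
apply/matrixP => i j; rewrite [RHS]mxE !mpartialE; congr (partial k _ x).
by apply/funext => y; rewrite mxE.
Qed.

Lemma mpartialC k l A x : msmooth U A -> U x ->
  mpartial k (mpartial l A) x = mpartial l (mpartial k A) x.
Proof.
move=> As Ux; apply/matrixP => i j; rewrite [LHS]mpartialE [RHS]mpartialE.
have E c : (fun y => mpartial c A y i j) = partial c (fun y => A y i j).
  by apply/funext => y; rewrite mpartialE.
by rewrite (E l) (E k); exact: partialC (As i j) Ux.
Qed.

End Rectangular.

Lemma mpartial_sum m p (I : finType) k (F : I -> 'rV[R]_N -> 'M[R]_(m, p)) x :
  (forall a, msmooth U (F a)) -> U x ->
  mpartial k (fun y => \sum_a F a y) x = \sum_a mpartial k (F a) x.
Proof.
move=> Fs Ux; apply/matrixP => i j; rewrite mpartialE summxE.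
under eq_bigr do rewrite mpartialE.
rewrite -smooth_partial_sum //; last by move=> a; apply: Fs.
by congr (partial k _ x); apply/funext => y; rewrite summxE.
Qed.

Lemma msmooth_sum m p (I : finType) (F : I -> 'rV[R]_N -> 'M[R]_(m, p)) :
  (forall a, msmooth U (F a)) -> msmooth U (fun y => \sum_a F a y).
Proof.
move=> Fs i j; apply: (eq_smooth Uo (f := fun x => \sum_a F a x i j)).
  by move=> x _; rewrite summxE.
by apply: smooth_sum => // a; apply: Fs.
Qed.

(** Smoothness is read off from matrix inversion being an operator of order 0. *)
Lemma msmooth_inv (A : 'rV[R]_N -> 'M[R]_N) : (forall x, U x -> A x \in unitmx) ->
  msmooth U A -> msmooth U (fun x => invmx (A x)).
Proof.
move=> Au As i j.
by apply: (diffop_smooth nondeg_open nondeg_smooth (diffop_inv i j)); split.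
Qed.

End MatrixCalculus.

Section MatrixChain.
Context {R : realType} {N : nat}.

Definition smooth_rvmap n (U : set 'rV[R]_n) (h : 'rV[R]_n -> 'rV[R]_N) :=
  forall k, smooth_on U (fun x => h x 0 k).

Lemma msmooth_comp n m p (U : set 'rV[R]_n) (V : set 'rV[R]_N)
    (A : 'rV[R]_N -> 'M[R]_(m, p)) h :
  open U -> open V -> (forall x, U x -> V (h x)) -> smooth_rvmap U h ->
  msmooth V A -> msmooth U (A \o h).
Proof.
move=> Uo Vo UV hs As i j.
exact: (smooth_comp Vo Uo UV hs (As i j)).
Qed.

Lemma mpartial_comp m p (U V : set 'rV[R]_N) (A : 'rV[R]_N -> 'M[R]_(m, p)) h k x :
  open V -> (forall x, U x -> V (h x)) -> smooth_rvmap U h -> msmooth V A -> U x ->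
  mpartial k (A \o h) x = \sum_a jac h x k a *: mpartial a A (h x).
Proof.
move=> Vo UV hs As Ux; apply/matrixP => i j; rewrite mpartialE summxE.
rewrite (smooth_partial_comp (F := fun y => A y i j) k Vo (UV x Ux) (As i j) Ux hs).
by apply: eq_bigr => a _; rewrite [RHS]mxE [jac h x k a]mxE mpartialE mulrC.
Qed.

Lemma msmooth_jac (U : set 'rV[R]_N) h : open U -> smooth_rvmap U h -> msmooth U (jac h).
Proof.
move=> Uo hs i k; apply: (eq_smooth Uo (f := partial i (fun y => h y 0 k))).
  by move=> x _; rewrite mxE.
exact: smooth_partial.
Qed.

Lemma jac_comp (U V : set 'rV[R]_N) (h h' : 'rV[R]_N -> 'rV[R]_N) x :
  open V -> (forall x, U x -> V (h x)) -> smooth_rvmap U h -> smooth_rvmap V h' -> U x ->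
  jac (h' \o h) x = jac h x *m jac h' (h x).
Proof.
move=> Vo UV hs hs' Ux; apply/matrixP => i k; rewrite !mxE.
rewrite (smooth_partial_comp (F := fun y => h' y 0 k) i Vo (UV x Ux) (hs' k) Ux hs).
by apply: eq_bigr => a _; rewrite !mxE mulrC.
Qed.

Lemma eq_jac (U : set 'rV[R]_N) (h h' : 'rV[R]_N -> 'rV[R]_N) x :
  open U -> {in U, h =1 h'} -> U x -> jac h x = jac h' x.
Proof.
move=> Uo E Ux; apply/matrixP => i k; rewrite !mxE.
by apply: (eq_partial Uo); [move=> y yU; rewrite E | rewrite inE].
Qed.

Lemma jac_id (x : 'rV[R]_N) : jac id x = 1%:M.
Proof. by apply/matrixP => i k; rewrite !mxE (partial_coord k i x).2 eq_sym. Qed.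

End MatrixChain.

Section Curv.
Context {R : realType} {n : nat}.
Implicit Types (U : set 'rV[R]_n) (g : 'rV[R]_n -> 'M[R]_n).
Implicit Types A B : 'I_n -> 'rV[R]_n -> 'M[R]_n.

Fact gam_key : unit. Proof. exact: tt. Qed.

(* (gam g k x) i j = Gamma^i_kj and (curv (gam g) x k l) i j = R^i_jkl *)
Definition gam g (k : 'I_n) (x : 'rV[R]_n) : 'M[R]_n := \matrix[gam_key]_(i, j) christoffel g i k j x.

Definition curv A (x : 'rV[R]_n) (k l : 'I_n) : 'M[R]_n :=
  mpartial k (A l) x - mpartial l (A k) x + (A k x *m A l x - A l x *m A k x).

Lemma gamE g k x i j : gam g k x i j = christoffel g i k j x.
Proof. by rewrite mxE. Qed.

Lemma mpartial_gam g a b x i j : mpartial a (gam g b) x i j = partial a (christoffel g i b j) x.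
Proof. by rewrite mpartialE; congr (partial a _ x); apply/funext => y; rewrite gamE. Qed.

Lemma riemannE g i j k l x : riemann g i j k l x = curv (gam g) x k l i j.
Proof.
have H a b : (gam g a x *m gam g b x) i j =
    \sum_m christoffel g i a m x * christoffel g m b j x.
  by rewrite entryM; apply: eq_bigr => m _; rewrite !gamE.
by rewrite /curv entryD !entryB !mpartial_gam !H /riemann sumrB.
Qed.

Definition weyl_at g (x : 'rV[R]_n) : 'I_n -> 'I_n -> 'M[R]_n :=
  weylM (g x) (invmx (g x)) (curv (gam g) x).

Lemma ricciE g j l x : ricci g j l x = ricM (curv (gam g) x) j l.
Proof. by rewrite mxE; apply: eq_bigr => i _; rewrite riemannE. Qed.

Lemma ricci_upE g i l x : ricci_up g i l x = (invmx (g x) *m ricM (curv (gam g) x)) i l.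
Proof. by rewrite [RHS]mxE; apply: eq_bigr => j _; rewrite ricciE. Qed.

Lemma weylE g i j k l x : weyl g i j k l x = weyl_at g x k l i j.
Proof.
rewrite /weyl_at /weylM entryD entryB !entryZ knE alt_outerE !entryT.
rewrite /weyl riemannE !ricciE !ricci_upE.
have -> : scalar_curv g x = \tr (invmx (g x) *m ricM (curv (gam g) x)).
  by apply: eq_bigr => a _; rewrite ricci_upE.
have D a b : (1%:M : 'M[R]_n) a b = (a == b)%:R by rewrite mxE.
rewrite !D; congr (_ - _ * _ + _ * _).
by rewrite -!addrA ![g x j _ * _]mulrC.
Qed.

Lemma weyl_sq_locE g x : weyl_sq_loc g x = sqM (g x) (invmx (g x)) (weyl_at g x).
Proof.
rewrite /weyl_sq_loc /sqM /contract.
set gi := invmx (g x); set C := weyl_at g x.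
(* Most of what follows reorders sums: [k], [c], [l], [d] belong to the outer contractions of [sqM]
   and have to precede the indices of the trace. *)
transitivity (\sum_k \sum_l \sum_i \sum_j \sum_c \sum_d \sum_b
   weyl_low g i j k l x * (gi j b * gi k c * gi l d * C c d i b)).
  transitivity (\sum_i \sum_j \sum_k \sum_l \sum_c \sum_d \sum_b
     weyl_low g i j k l x * (gi j b * gi k c * gi l d * C c d i b)).
    apply: eq_bigr => i _; apply: eq_bigr => j _; apply: eq_bigr => k _; apply: eq_bigr => l _.
    rewrite /weyl_up big_distrr /=.
    transitivity (\sum_b \sum_c \sum_d
       weyl_low g i j k l x * (gi j b * gi k c * gi l d * C c d i b)).
      apply: eq_bigr => b _; rewrite big_distrr; apply: eq_bigr => c _ /=.
      by rewrite big_distrr; apply: eq_bigr => d _ /=; rewrite weylE.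
    rewrite exchange_big /=; apply: eq_bigr => c _; exact: exchange_big.
  under eq_bigr do rewrite exchange_big; rewrite exchange_big /=; apply: eq_bigr => k _.
  transitivity (\sum_i \sum_l \sum_j \sum_c \sum_d \sum_b
     weyl_low g i j k l x * (gi j b * gi k c * gi l d * C c d i b)).
    by apply: eq_bigr => i _; rewrite exchange_big.
  exact: exchange_big.
apply: eq_bigr => k _.
transitivity (\sum_l \sum_c \sum_d \sum_i \sum_j \sum_b
   weyl_low g i j k l x * (gi j b * gi k c * gi l d * C c d i b)).
  apply: eq_bigr => l _.
  transitivity (\sum_i \sum_c \sum_d \sum_j \sum_b
   weyl_low g i j k l x * (gi j b * gi k c * gi l d * C c d i b)).
    apply: eq_bigr => i _; rewrite exchange_big /=; apply: eq_bigr => c _; exact: exchange_big.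
  rewrite exchange_big /=; apply: eq_bigr => c _; exact: exchange_big.
rewrite exchange_big /=; apply: eq_bigr => c _; rewrite big_distrr; apply: eq_bigr => l _ /=.
rewrite big_distrr; apply: eq_bigr => d _ /=.
transitivity (\sum_b \sum_j \sum_i weyl_low g i j k l x * (gi j b * gi k c * gi l d * C c d i b)).
  under eq_bigr do rewrite exchange_big; rewrite exchange_big /=.
  by apply: eq_bigr => b _; rewrite exchange_big.
rewrite /mxtrace !big_distrr /=; apply: eq_bigr => b _.
rewrite entryM !big_distrr /=; apply: eq_bigr => j _.
rewrite -mulmxA (entryM _ (g x *m _)) big_distrl !big_distrr /=; apply: eq_bigr => i _.
have -> : weyl_low g i j k l x = (g x *m C k l) i j.
  by rewrite entryM; apply: eq_bigr => a _; rewrite weylE.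
by rewrite entryT; ring.
Qed.

End Curv.

(** * The Levi-Civita connection *)

Section LeviCivita.
Context {R : realType} {n : nat} {U : set 'rV[R]_n} {g : 'rV[R]_n -> 'M[R]_n}.
Hypotheses (gU : nondegenerate_field U g) (gsym : forall x, U x -> (g x)^T = g x).

Let Uo : open U := nondeg_open gU.
Let gs : msmooth U g := nondeg_smooth gU.
Let gu := nondeg_unit gU.

Lemma mpartial_sym k x i j : U x -> mpartial k g x i j = mpartial k g x j i.
Proof.
move=> Ux; rewrite -[RHS]entryT -mpartial_tr.
congr (fun_of_matrix _ i j); apply: (eq_mpartial Uo _ _ Ux) => y; rewrite inE => Uy.
by rewrite gsym.
Qed.

(** Twice the Christoffel symbols of the first kind. *)
Definition lc_first k x : 'M[R]_n := \matrix_(l, j)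
  (mpartial k g x l j + mpartial j g x l k - mpartial l g x k j).

Lemma gam_first k x : gam g k x = 2^-1 *: (invmx (g x) *m lc_first k x).
Proof.
apply/matrixP => i j; rewrite gamE entryZ entryM; congr (_ * _).
by apply: eq_bigr => l _; rewrite [lc_first _ _ _ _]mxE !mpartialE.
Qed.

Lemma gam_torsion k x i j : U x -> gam g k x i j = gam g j x i k.
Proof.
move=> Ux; rewrite !gam_first !entryZ !entryM; congr (_ * _).
apply: eq_bigr => l _; rewrite ![lc_first _ _ _ _]mxE; congr (_ * _).
by rewrite (mpartial_sym l j k Ux) [mpartial k g x l j + _]addrC.
Qed.

Lemma gam_compat k x : U x -> mpartial k g x = g x *m gam g k x + (g x *m gam g k x)^T.
Proof.
move=> Ux; rewrite gam_first -scalemxAr mulmxA mulmxV ?gu // mul1mx.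
apply/matrixP => l j; rewrite entryD entryT !entryZ ![lc_first _ _ _ _]mxE.
rewrite (mpartial_sym k j l Ux) (mpartial_sym j k l Ux) (mpartial_sym l k j Ux).
by field.
Qed.

(** Koszul's argument: in the combination of three derivatives of [g] that defines [lc_first], the
    symmetry of [A] cancels everything but 2 g A. It is pointwise, so [A] is just a family of
    matrices at [x]. *)
Lemma gam_unique (A : 'I_n -> 'M[R]_n) x : U x ->
  (forall k i j, A k i j = A j i k) ->
  (forall k, mpartial k g x = g x *m A k + (g x *m A k)^T) ->
  forall k, gam g k x = A k.
Proof.
move=> Ux At Ac k.
suff E : lc_first k x = 2 *: (g x *m A k).
  by rewrite gam_first E -scalemxAr scalerA mulVf // scale1r mulmxA mulVmx ?gu // mul1mx.
have S a b c : (g x *m A a) b c = (g x *m A c) b a.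
  by rewrite !entryM; apply: eq_bigr => i _; rewrite At.
apply/matrixP => l j; rewrite mxE !Ac entryZ !entryD !entryT.
rewrite (S j l k) (S j k l) (S k j l); ring.
Qed.

Lemma smooth_christoffel i j k : smooth_on U (christoffel g i j k).
Proof. exact: (diffop_smooth nondeg_open nondeg_smooth (diffop_christoffel i j k) gU). Qed.

Lemma msmooth_gam k : msmooth U (gam g k).
Proof.
move=> i j; apply: (eq_smooth Uo (f := christoffel g i k j)); last exact: smooth_christoffel.
by move=> x _; rewrite gamE.
Qed.

End LeviCivita.

(** * Gauge transformations and pullbacks of connection forms *)

Section Gauge.
Context {R : realType} {n : nat} {U : set 'rV[R]_n} (Uo : open U).
Implicit Types A B : 'I_n -> 'rV[R]_n -> 'M[R]_n.

Lemma eq_curv A B x : (forall k, {in U, A k =1 B k}) -> U x ->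
  forall k l, curv A x k l = curv B x k l.
Proof.
move=> E Ux k l; have E' a : A a x = B a x by apply: E; rewrite inE.
by rewrite /curv !E' (eq_mpartial Uo k (E l) Ux) (eq_mpartial Uo l (E k) Ux).
Qed.

(** The relation P A = B P + dP is differentiated and antisymmetrized: second derivatives of [P]
    cancel by symmetry, and terms with one derivative of [P] cancel against those produced by the
    products of [A] and of [B]. As no inverse of [P] enters, none has to be differentiated. *)
Lemma curv_gauge A B P x :
  (forall k, msmooth U (A k)) -> (forall k, msmooth U (B k)) -> msmooth U P -> U x ->
  (forall k y, U y -> P y *m A k y = B k y *m P y + mpartial k P y) ->
  forall k l, P x *m curv A x k l = curv B x k l *m P x.
Proof.
move=> As Bs Ps Ux H k l.
have D a b : mpartial a P x *m A b x + P x *m mpartial a (A b) x =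
    mpartial a (B b) x *m P x + B b x *m mpartial a P x + mpartial a (mpartial b P) x.
  rewrite -(mpartialM Uo a Ps (As b) Ux) -(mpartialM Uo a (Bs b) Ps Ux).
  rewrite -(mpartialD a (msmoothM Uo (Bs b) Ps) (msmooth_mpartial Uo b Ps) Ux).
  by apply: (eq_mpartial Uo _ _ Ux) => y; rewrite inE; apply: H.
have S : mpartial k (mpartial l P) x = mpartial l (mpartial k P) x by exact: (mpartialC Uo k l Ps Ux).
have Q a b : P x *m (A a x *m A b x) =
    B a x *m (B b x *m P x) + B a x *m mpartial b P x + mpartial a P x *m A b x.
  by rewrite mulmxA H // mulmxDl -mulmxA H // mulmxDr.
have D' a b : P x *m mpartial a (A b) x =
    mpartial a (B b) x *m P x + B b x *m mpartial a P x + mpartial a (mpartial b P) x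
    - mpartial a P x *m A b x.
  by rewrite -D addrC addKr.
rewrite /curv mulmxDr !mulmxBr !Q !D' S !mulmxDl !mulNmx -!mulmxA.
(* Once the products are generalised the identity is purely additive, and [ring] settles it on
   entries. *)
move: (mpartial l (mpartial k P) x) => z1.
move: (mpartial k (B l) x *m P x) (mpartial l (B k) x *m P x) => z2 z3.
move: (B l x *m mpartial k P x) (B k x *m mpartial l P x) => z4 z5.
move: (mpartial k P x *m A l x) (mpartial l P x *m A k x) => z6 z7.
move: (B k x *m (B l x *m P x)) (B l x *m (B k x *m P x)) => z8 z9.
apply/matrixP => i j; rewrite !mxE; ring.
Qed.

(** The second derivatives of [h] enter symmetrically in [k] and [l] and drop out; the remaining
    terms are bilinear in the Jacobian. *)
Lemma curv_pull (V : set 'rV[R]_n) (h : 'rV[R]_n -> 'rV[R]_n) B x :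
  open V -> (forall y, U y -> V (h y)) -> smooth_rvmap U h ->
  (forall a, msmooth V (B a)) -> U x ->
  forall k l, curv (fun k y => \sum_a jac h y k a *: B a (h y)) x k l =
    \sum_a \sum_b (jac h x k a * jac h x l b) *: curv B (h x) a b.
Proof.
move=> Vo UV hs Bs Ux k l.
have Js := msmooth_jac Uo hs.
have Bhs a : msmooth U (B a \o h) by exact: msmooth_comp (Bs a).
have dJ a b c : partial c (fun y => jac h y a b) x = partial c (partial a (fun y => h y 0 b)) x.
  by congr (partial c _ x); apply/funext => y; rewrite mxE.
(* The existential turns the second derivatives into values of an abstract function, so that they
   are never unfolded. *)
have [d2h d2hE] : exists d2h : 'I_n -> 'I_n -> 'I_n -> R,
    forall a b c, partial a (partial b (fun y => h y 0 c)) x = d2h a b c.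
  exists (fun a b c => partial a (partial b (fun y => h y 0 c)) x) => a b c.
  reflexivity.
have d2hC c : d2h k l c = d2h l k c by rewrite -!d2hE; exact: (partialC Uo k l (hs c) Ux).
have D a b : mpartial a (fun y => \sum_c jac h y b c *: B c (h y)) x =
   \sum_c (d2h a b c *: B c (h x)
     + \sum_d (jac h x b c * jac h x a d) *: mpartial d (B c) (h x)).
  rewrite (mpartial_sum Uo); [|by move=> c; exact: (msmoothZ Uo (Js b c) (Bhs c))|by []].
  apply: eq_bigr => c _; rewrite (mpartialZ _ (Js b c) (Bhs c) Ux) dJ d2hE; congr (_ + _).
  rewrite (mpartial_comp a Vo UV hs (Bs c) Ux) scaler_sumr.
  by apply: eq_bigr => d _; rewrite scalerA.
have Pr a b : (\sum_c jac h x a c *: B c (h x)) *m (\sum_d jac h x b d *: B d (h x)) =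
    \sum_c \sum_d (jac h x a c * jac h x b d) *: (B c (h x) *m B d (h x)).
  rewrite mulmx_suml; apply: eq_bigr => c _; rewrite mulmx_sumr; apply: eq_bigr => d _.
  by rewrite -scalemxAl -scalemxAr scalerA.
rewrite /curv !D !Pr !big_split /=.
have -> : \sum_c d2h k l c *: B c (h x) = \sum_c d2h l k c *: B c (h x).
  by apply: eq_bigr => c _; rewrite d2hC.
have E1 : \sum_c \sum_d (jac h x l c * jac h x k d) *: mpartial d (B c) (h x) =
   \sum_a \sum_b (jac h x k a * jac h x l b) *: mpartial a (B b) (h x).
  rewrite exchange_big; apply: eq_bigr => a _; apply: eq_bigr => b _ /=.
  by rewrite mulrC.
have E2 : \sum_c \sum_d (jac h x l c * jac h x k d) *: (B c (h x) *m B d (h x)) =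
   \sum_a \sum_b (jac h x k a * jac h x l b) *: (B b (h x) *m B a (h x)).
  rewrite exchange_big; apply: eq_bigr => a _; apply: eq_bigr => b _ /=.
  by rewrite mulrC.
have cancel (S X Y : 'M[R]_n) : S + X - (S + Y) = X - Y by rewrite opprD addrACA subrr add0r.
rewrite E1 E2 cancel -!sumrB -big_split /=.
apply: eq_bigr => a _; rewrite -!sumrB -big_split; apply: eq_bigr => b _ /=.
by rewrite -!scalerBr -scalerDr.
Qed.

End Gauge.

Lemma invmx_uniq (K : fieldType) n (A B : 'M[K]_n) : A *m B = 1%:M -> invmx A = B.
Proof.
move=> AB; have [Au _] := mulmx1_unit AB.
by rewrite -[RHS]mul1mx -(mulVmx Au) -mulmxA AB mulmx1.
Qed.

(** * Change of coordinates *)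

Section CoordinateChange.
Context {R : realType} {n : nat} {U V : set 'rV[R]_n} {g g' : 'rV[R]_n -> 'M[R]_n}.
Context {h : 'rV[R]_n -> 'rV[R]_n}.
Hypotheses (gU : nondegenerate_field U g) (gV : nondegenerate_field V g').
Hypotheses (gsym : forall x, V x -> (g' x)^T = g' x).
Hypotheses (UV : forall x, U x -> V (h x)) (hs : smooth_rvmap U h).
Hypothesis jac_unit : forall x, U x -> jac h x \in unitmx.
Hypothesis gE : forall x, U x -> g x = jac h x *m g' (h x) *m (jac h x)^T.

Let Uo : open U := nondeg_open gU.
Let Vo : open V := nondeg_open gV.
Let Js := msmooth_jac Uo hs.

Definition pull_gam k (x : 'rV[R]_n) := \sum_a jac h x k a *: gam g' a (h x).

(** The classical transformation law of the Christoffel symbols, read as the pulled-back connection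
    form gauged by the transposed Jacobian. *)
Definition new_gam k x := (invmx (jac h x))^T *m
   (pull_gam k x *m (jac h x)^T + mpartial k (fun y => (jac h y)^T) x).

Let JJit x : U x -> (jac h x)^T *m (invmx (jac h x))^T = 1%:M.
Proof. by move=> Ux; rewrite -trmx_mul mulVmx ?jac_unit // trmx1. Qed.

Lemma gam_change k x : U x -> gam g k x = new_gam k x.
Proof.
move=> Ux.
have PA k' : (jac h x)^T *m new_gam k' x =
    pull_gam k' x *m (jac h x)^T + mpartial k' (fun y => (jac h y)^T) x.
  by rewrite mulmxA JJit // mul1mx.
apply: (gam_unique gU Ux (A := fun k => new_gam k x)) => {k} [k i j|k].
  (* The symmetry is shown before multiplying by the inverse Jacobian: one summand is symmetric
     because [g'] has a torsion-free connection, the other by the symmetry of the second derivatives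
     of [h]. *)
  have T a c d : ((jac h x)^T *m new_gam c x) a d = ((jac h x)^T *m new_gam d x) a c.
    have E1 c' d' : mpartial c' (fun y => (jac h y)^T) x a d' =
        partial c' (partial d' (fun y => h y 0 a)) x.
      rewrite mpartialE; congr (partial c' _ x); apply/funext => y.
      by rewrite !mxE.
    have E2 c' d' : (pull_gam c' x *m (jac h x)^T) a d' =
        \sum_b \sum_e jac h x c' b * jac h x d' e * gam g' b (h x) a e.
      rewrite mulmx_suml summxE; apply: eq_bigr => b _.
      rewrite -scalemxAl entryZ entryM big_distrr; apply: eq_bigr => e _ /=.
      by rewrite entryT; ring.
    rewrite !PA !entryD !E1 !E2 (partialC Uo c d (hs a) Ux); congr (_ + _).
    rewrite exchange_big; apply: eq_bigr => e _; apply: eq_bigr => b _ /=.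
    by rewrite (gam_torsion gV gsym _ _ _ (UV Ux)); ring.
  have E c d : new_gam c x i d =
      \sum_a (invmx (jac h x))^T i a * ((jac h x)^T *m new_gam c x) a d.
    by rewrite -entryM mulmxA -trmx_mul mulmxV ?jac_unit // trmx1 mul1mx.
  by rewrite !E; apply: eq_bigr => a _; rewrite T.
(* Compatibility results from differentiating g = J g' J^T: the derivatives of the outer factors
   match the inhomogeneous term of [new_gam]. *)
have -> : mpartial k g x = mpartial k (fun y => jac h y *m (g' \o h) y *m (jac h y)^T) x.
  by apply: (eq_mpartial Uo _ _ Ux) => y; rewrite inE => Uy; rewrite gE.
have g's := nondeg_smooth gV.
have ghs : msmooth U (g' \o h) by exact: msmooth_comp g's.
rewrite (mpartialM Uo k (msmoothM Uo Js ghs) (msmooth_tr Uo Js) Ux).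
rewrite (mpartialM Uo k Js ghs Ux) (mpartial_comp k Vo UV hs g's Ux).
have -> : \sum_a jac h x k a *: mpartial a g' (h x) =
    g' (h x) *m pull_gam k x + (g' (h x) *m pull_gam k x)^T.
  rewrite mulmx_sumr linear_sum -big_split; apply: eq_bigr => a _ /=.
  by rewrite (gam_compat gV gsym a (UV Ux)) scalerDr -scalemxAr linearZ.
rewrite gE // -[X in _ = X + _]mulmxA -[X in _ = _ + X^T]mulmxA PA.
rewrite [X in X + _]mulmxDl !mulmxDr !mulmxDl !trmx_mul !linearD /= !trmx_mul !trmxK.
rewrite mpartial_tr trmxK (gsym (UV Ux)) !mulmxA.
move: (mpartial k (jac h) x *m _ *m _) (_ *m pull_gam k x *m _) => t1 t2.
move: (_ *m (pull_gam k x)^T *m _ *m _) (_ *m (mpartial k (jac h) x)^T) => t3 t4.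
by apply/matrixP => a b; rewrite !entryD; ring.
Qed.

(** The gauge transformation by the transposed Jacobian accounts for the conjugation in [pullF], and
    the pullback by [h] for its two Jacobian factors. *)
Lemma curv_change x : U x -> forall k l,
  curv (gam g) x k l = pullF (jac h x) (invmx (jac h x)) (curv (gam g') (h x)) k l.
Proof.
move=> Ux k l.
have Jts : msmooth U (fun y => (jac h y)^T) by exact: msmooth_tr.
have gs' a : msmooth V (gam g' a) by exact: msmooth_gam.
have ps a : msmooth U (pull_gam a).
  apply: (msmooth_sum Uo) => b.
  exact: (msmoothZ Uo (Js a b) (msmooth_comp Uo Vo UV hs (gs' b))).
have := curv_gauge Uo (msmooth_gam gU) ps Jts Ux.
have H k' y : U y -> (jac h y)^T *m gam g k' y =
    pull_gam k' y *m (jac h y)^T + mpartial k' (fun y => (jac h y)^T) y.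
  by move=> Uy; rewrite gam_change // mulmxA JJit // mul1mx.
move=> /(_ H k l) E.
have -> : curv (gam g) x k l = (invmx (jac h x))^T *m ((jac h x)^T *m curv (gam g) x k l).
  by rewrite mulmxA -trmx_mul mulmxV ?jac_unit // trmx1 mul1mx.
rewrite E (curv_pull Uo Vo UV hs gs' Ux) mulmx_suml mulmx_sumr.
apply: eq_bigr => a _; rewrite mulmx_suml mulmx_sumr; apply: eq_bigr => b _.
by rewrite -scalemxAl -scalemxAr mulmxA.
Qed.

Lemma invmx_change x : U x ->
  invmx (g x) = (invmx (jac h x))^T *m invmx (g' (h x)) *m invmx (jac h x).
Proof.
move=> Ux; rewrite gE //.
have Ju := jac_unit Ux.
have gu' : g' (h x) \in unitmx by exact: nondeg_unit gV _ (UV Ux).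
apply: invmx_uniq; rewrite !mulmxA -(mulmxA _ (jac h x)^T) JJit // mulmx1.
by rewrite -(mulmxA _ (g' _)) mulmxV // mulmx1 mulmxV.
Qed.

Lemma weyl_sq_change x : U x -> weyl_sq_loc g x = weyl_sq_loc g' (h x).
Proof.
move=> Ux; have JJi : jac h x *m invmx (jac h x) = 1%:M by rewrite mulmxV ?jac_unit.
rewrite !weyl_sq_locE -(sqM_pull JJi (gE Ux) (invmx_change Ux)).
apply: eq_sqM => k l; rewrite -(weylM_pull JJi (gE Ux) (invmx_change Ux)).
by apply: eq_weylM => a b; exact: curv_change.
Qed.

End CoordinateChange.

(** * Conformal change of a metric: the identity at a point *)

Section ConformalAlgebra.
Context {K : fieldType} {n : nat}.
Hypothesis two0 : (2 : K) != 0.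
Variables (g gi : 'M[K]_n) (u : 'rV[K]_n) (w : 'cV[K]_n).
Variables (G dg : 'I_n -> 'M[K]_n) (du : 'I_n -> 'rV[K]_n) (dw : 'I_n -> 'cV[K]_n).
Hypotheses (ggi : g *m gi = 1%:M) (gsym : g^T = g).
Hypothesis wE : w = gi *m u^T.
Hypothesis duC : forall k l, du k 0 l = du l 0 k.
Hypothesis GC : forall k i j, G k i j = G j i k.
Hypothesis dgE : forall k, dg k = g *m G k + (g *m G k)^T.
Hypothesis dwE : forall k, dw k = gi *m (du k - u *m G k)^T - G k *m w.

(* conf_diff l is the difference of the connection matrices in direction l of al g
   and g, where u = d(log al)/2 and w is its gradient for g; d_conf_diff k l is its
   derivative in direction k. The curvatures then differ by the Kulkarni-Nomizu
   product of g and conf_schouten. *)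
Fact conf_diff_key : unit. Proof. exact: tt. Qed.

Definition conf_diff (l : 'I_n) : 'M[K]_n := \matrix[conf_diff_key]_(i, j)
  ((i == l)%:R * u 0 j + u 0 l * (i == j)%:R - w i 0 * g l j).

Definition d_conf_diff (k l : 'I_n) : 'M[K]_n := \matrix[conf_diff_key]_(i, j)
  ((i == l)%:R * du k 0 j + du k 0 l * (i == j)%:R - (dw k i 0 * g l j + w i 0 * dg k l j)).

Let usq : K := (u *m w) 0 0.

(** The covariant derivative of [u], minus the square of [u], plus half its squared norm times [g]:
    the amount by which the Schouten tensor decreases. *)
Definition conf_schouten : 'M[K]_n :=
  \matrix_(j, k) (du k 0 j - (u *m G k) 0 j - u 0 k * u 0 j + 2^-1 * usq * g k j).

Lemma conf_diffE l i j : conf_diff l i j =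
  (i == l)%:R * u 0 j + u 0 l * (i == j)%:R - w i 0 * g l j.
Proof. by rewrite mxE. Qed.

Lemma d_conf_diffE k l i j : d_conf_diff k l i j =
  (i == l)%:R * du k 0 j + du k 0 l * (i == j)%:R - (dw k i 0 * g l j + w i 0 * dg k l j).
Proof. by rewrite mxE. Qed.

Lemma sum_delta_r (i : 'I_n) (f : 'I_n -> K) : \sum_k f k * (k == i)%:R = f i.
Proof. by under eq_bigr do rewrite mulrC eq_sym; exact: sum_delta_l. Qed.

Lemma mul_conf_diff (X : 'M[K]_n) l i j : (X *m conf_diff l) i j =
  X i l * u 0 j + u 0 l * X i j - (X *m w) i 0 * g l j.
Proof.
rewrite !entryM.
transitivity (\sum_k (X i k * (k == l)%:R * u 0 j + u 0 l * (X i k * (k == j)%:R)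
   - X i k * w k 0 * g l j)).
  by apply: eq_bigr => k _; rewrite conf_diffE; ring.
by rewrite !big_split sumrN /= -!mulr_suml -mulr_sumr !sum_delta_r.
Qed.

Lemma conf_diff_mul (Y : 'M[K]_n) l i j : (conf_diff l *m Y) i j =
  (i == l)%:R * (u *m Y) 0 j + u 0 l * Y i j - w i 0 * (g *m Y) l j.
Proof.
rewrite !entryM.
transitivity (\sum_k ((i == l)%:R * (u 0 k * Y k j) + u 0 l * ((i == k)%:R * Y k j)
   - w i 0 * (g l k * Y k j))).
  by apply: eq_bigr => k _; rewrite conf_diffE; ring.
by rewrite !big_split sumrN /= -!mulr_sumr sum_delta_l.
Qed.

Let gwE k : (g *m w) k 0 = u 0 k.
Proof. by rewrite wE mulmxA ggi mul1mx entryT. Qed.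

Let conf_diff_w k i : (conf_diff k *m w) i 0 = (i == k)%:R * usq.
Proof.
rewrite entryM.
transitivity (\sum_m ((i == k)%:R * (u 0 m * w m 0) + u 0 k * ((i == m)%:R * w m 0)
   - w i 0 * (g k m * w m 0))).
  by apply: eq_bigr => m _; rewrite conf_diffE; ring.
rewrite !big_split sumrN /= -!mulr_sumr sum_delta_l.
have -> : \sum_m g k m * w m 0 = u 0 k by rewrite -entryM gwE.
by rewrite /usq entryM; ring.
Qed.

(** The left side is the antisymmetrization of dS + G S + S G + S S, where S is the difference of
    the connections. At a single point the derivatives are mere matrices tied by the hypotheses of
    the section; eliminating those of [g] and [w] leaves an identity over a field. *)
Lemma conf_curvature k l :
  d_conf_diff k l - d_conf_diff l k
  + (G k *m conf_diff l + conf_diff k *m G l + conf_diff k *m conf_diff l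
     - (G l *m conf_diff k + conf_diff l *m G k + conf_diff l *m conf_diff k)) =
  - kn g gi conf_schouten k l.
Proof.
apply/matrixP => i j.
have gib c : (gi *m conf_schouten) i c = (gi *m (du c - u *m G c)^T) i 0 - u 0 c * w i 0
    + 2^-1 * usq * (i == c)%:R.
  have -> : (i == c)%:R = (gi *m g) i c by rewrite (mulmx1C ggi) mxE.
  rewrite wE !entryM !big_distrr -sumrB -big_split; apply: eq_bigr => m _ /=.
  rewrite !entryT entryB [conf_schouten _ _]mxE -(entryT g) gsym; ring.
have Ts a b c : (g *m G a) b c = (g *m G c) b a.
  by rewrite !entryM; apply: eq_bigr => m _; rewrite GC.
rewrite entryD entryB !d_conf_diffE entryB !entryD !mul_conf_diff !conf_diff_mul.
rewrite !conf_diff_w !conf_diffE [RHS]mxE knE !gib ![conf_schouten _ _]mxE !dwE !dgE.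
rewrite !(entryD, entryB, entryT) (duC l k) (GC l i k).
have gC a b : g a b = g b a by rewrite -[LHS]entryT gsym.
have entryN (X : 'cV[K]_n) c : (- X) c 0 = - X c 0 by rewrite mxE.
rewrite (Ts l j k) (gC k l) (gC j l) (gC j k) !entryN.
by field.
Qed.

End ConformalAlgebra.

(** * Conformal change of a metric on an open set *)

Section ConformalChange.
Context {R : realType} {n : nat} {U : set 'rV[R]_n}.
Variables (g gc : 'rV[R]_n -> 'M[R]_n) (al : 'rV[R]_n -> R).
Hypotheses (gU : nondegenerate_field U g) (gcU : nondegenerate_field U gc).
Hypotheses (gsym : forall x, U x -> (g x)^T = g x).
Hypotheses (als : smooth_on U al) (al0 : forall x, U x -> al x != 0).
Hypothesis gcE : forall x, U x -> gc x = al x *: g x.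

Let Uo : open U := nondeg_open gU.
Let gs : msmooth U g := nondeg_smooth gU.
Let gu := nondeg_unit gU.
Let gis : msmooth U (fun x => invmx (g x)) := msmooth_inv Uo gu gs.

Fact half_dlog_key : unit. Proof. exact: tt. Qed.

(** Written without a logarithm, so that a factor of either sign is allowed. *)
Definition half_dlog (x : 'rV[R]_n) : 'rV[R]_n :=
  \matrix[half_dlog_key]_(i, j) (partial j al x * (2 * al x)^-1).

Definition half_grad_log (x : 'rV[R]_n) : 'cV[R]_n := invmx (g x) *m (half_dlog x)^T.

Local Notation u := half_dlog.
Local Notation w := half_grad_log.
Local Notation S := (fun k x => conf_diff (g x) (u x) (w x) k).

Let half_dlogE x j : u x 0 j = partial j al x * (2 * al x)^-1.
Proof. by rewrite mxE. Qed.

Let al2s : smooth_on U (fun x => 2 * al x).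
Proof. exact: (smoothM Uo (smooth_cst Uo 2) als). Qed.

Let al20 x : U x -> 2 * al x != 0.
Proof. by move=> Ux; rewrite mulf_neq0 // al0. Qed.

Let al2Vs : smooth_on U (fun x => (2 * al x)^-1).
Proof. exact: (smoothV Uo al20 al2s). Qed.

Let us : msmooth U u.
Proof.
move=> i j; rewrite ord1; apply: (eq_smooth Uo (f := fun x => partial j al x * (2 * al x)^-1)).
  by move=> x _; rewrite half_dlogE.
exact: (smoothM Uo (smooth_partial j als) al2Vs).
Qed.

Let ws : msmooth U w.
Proof. exact: (msmoothM Uo gis (msmooth_tr Uo us)). Qed.

Let duC x k l : U x -> mpartial k u x 0 l = mpartial l u x 0 k.
Proof.
move=> Ux.
have E a b : mpartial a u x 0 b = partial b al x * partial a (fun y => (2 * al y)^-1) x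
    + (2 * al x)^-1 * partial a (partial b al) x.
  rewrite -(smooth_partialM a (smooth_partial b als) al2Vs Ux) mpartialE.
  by congr (partial a _ x); apply/funext => y; rewrite half_dlogE.
have V a : partial a (fun y => (2 * al y)^-1) x =
    - ((2 * al x)^-1 * (2 * al x)^-1 * (2 * partial a al x)).
  rewrite (partialV (al20 Ux) (smooth_derivable (i := a) al2s Ux)).
  by rewrite (smooth_partialM a (smooth_cst Uo 2) als Ux) partial_cst mulr0 addr0.
by rewrite !E !V (partialC Uo k l als Ux); ring.
Qed.

Let gwE x : U x -> g x *m w x = (u x)^T.
Proof. by move=> Ux; rewrite mulmxA mulmxV ?gu // mul1mx. Qed.

Let dwE x k : U x -> mpartial k w x =
  invmx (g x) *m (mpartial k u x - u x *m gam g k x)^T - gam g k x *m w x.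
Proof.
move=> Ux.
(* Differentiating g w = u^T avoids the derivative of the inverse matrix. *)
have : mpartial k (fun y => g y *m w y) x = (mpartial k u x)^T.
  rewrite -mpartial_tr; apply: (eq_mpartial Uo _ _ Ux) => y; rewrite inE; exact: gwE.
rewrite (mpartialM Uo k gs ws Ux) => E.
have -> : mpartial k w x = invmx (g x) *m (g x *m mpartial k w x).
  by rewrite mulmxA mulVmx ?gu // mul1mx.
have -> : g x *m mpartial k w x = (mpartial k u x)^T - mpartial k g x *m w x.
  by rewrite -E [X in _ = X - _]addrC addrK.
rewrite (gam_compat gU gsym k Ux) trmx_mul (gsym Ux) mulmxDl opprD addrA.
rewrite -!mulmxA (gwE Ux) -trmx_mul !mulmxDr !mulmxN.
have -> : invmx (g x) *m (g x *m (gam g k x *m w x)) = gam g k x *m w x.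
  exact: (mulKmx (gu Ux)).
by rewrite linearB mulmxBr addrAC.
Qed.

Let Ss k : msmooth U (S k).
Proof.
move=> i j; apply: (eq_smooth Uo (f := fun x => (i == k)%:R * u x 0 j +
   (u x 0 k * (i == j)%:R + -1 * (w x i 0 * g x k j)))).
  by move=> x _; rewrite conf_diffE mulN1r addrA.
have c (b : R) : smooth_on U (fun=> b) by exact: smooth_cst.
exact: (smoothD Uo (smoothM Uo (c _) (us 0 j)) (smoothD Uo (smoothM Uo (us 0 k) (c _))
   (smoothM Uo (c _) (smoothM Uo (ws i 0) (gs k j))))).
Qed.

Let dSE x k l : U x -> mpartial k (S l) x = d_conf_diff (g x) (w x)
  (fun k => mpartial k g x) (fun k => mpartial k u x) (fun k => mpartial k w x) k l.
Proof.
move=> Ux; apply/matrixP => i j; rewrite d_conf_diffE.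
have c (b : R) : smooth_on U (fun=> b) by exact: smooth_cst.
have s1 := smoothM Uo (c (i == l)%:R) (us 0 j).
have s2 := smoothM Uo (us 0 l) (c (i == j)%:R).
have s3 := smoothM Uo (ws i 0) (gs l j).
have s4 := smoothM Uo (c (-1)) s3.
transitivity (partial k (fun x => (i == l)%:R * u x 0 j +
   (u x 0 l * (i == j)%:R + -1 * (w x i 0 * g x l j))) x).
  rewrite mpartialE; congr (partial k _ x); apply/funext => y.
  by rewrite conf_diffE mulN1r addrA.
rewrite (smooth_partialD k s1 (smoothD Uo s2 s4) Ux) (smooth_partialD k s2 s4 Ux).
rewrite (smooth_partialM k (c (i == l)%:R) (us 0 j) Ux).
rewrite (smooth_partialM k (us 0 l) (c (i == j)%:R) Ux).
rewrite (smooth_partialM k (c (-1)) s3 Ux) (smooth_partialM k (ws i 0) (gs l j) Ux).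
rewrite !partial_cst -!mpartialE; ring.
Qed.

Let gc_gam x k : U x -> gam gc k x = gam g k x + S k x.
Proof.
move=> Ux; have gC a b : g x a b = g x b a by rewrite -[LHS]entryT gsym.
apply: (gam_unique gcU Ux (A := fun k => gam g k x + S k x)) => {k} [k i j|k].
  rewrite !entryD (gam_torsion gU gsym k i j Ux) !conf_diffE (gC k j); congr (_ + _).
  by rewrite [u x 0 k * _]mulrC addrC ![_ * u x 0 j]mulrC; ring.
have -> : mpartial k gc x = mpartial k (fun y => al y *: g y) x.
  by apply: (eq_mpartial Uo _ _ Ux) => y; rewrite inE => Uy; exact: gcE.
rewrite (mpartialZ k als gs Ux) (gam_compat gU gsym k Ux) (gcE Ux).
rewrite mulmxDr -!scalemxAl.
apply/matrixP => i j; rewrite !(entryD, entryZ, entryT) !mul_conf_diff (gwE Ux) !entryT.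
rewrite (half_dlogE x k) (gC j k) (gC j i).
have := al0 Ux; move: (al x) (partial k al x) => a b a0.
rewrite (gC k i) (gC k j); field.
by rewrite a0.
Qed.

Lemma curv_conformal x : U x -> forall k l, curv (gam gc) x k l = curv (gam g) x k l -
  kn (g x) (invmx (g x)) (conf_schouten (g x) (u x) (w x) (fun k => gam g k x)
    (fun k => mpartial k u x)) k l.
Proof.
move=> Ux k l.
have two0 : (2 : R) != 0 by [].
have K := @conf_curvature _ _ two0 (g x) (invmx (g x)) (u x) (w x) (fun k => gam g k x)
  (fun k => mpartial k g x) (fun k => mpartial k u x) (fun k => mpartial k w x)
  (mulmxV (gu Ux)) (gsym Ux) erefl (fun c d => duC c d Ux)
  (fun c i j => gam_torsion gU gsym c i j Ux) (fun c => gam_compat gU gsym c Ux)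
  (fun c => dwE c Ux) k l.
rewrite -K.
rewrite -!dSE // (@eq_curv _ _ _ Uo _ (fun k x => gam g k x + S k x) _ _ Ux); last first.
  by move=> c y; rewrite inE; exact: gc_gam.
have gams a : msmooth U (gam g a) by exact: msmooth_gam.
rewrite /curv !(mpartialD _ (gams _) (Ss _) Ux) !mulmxDr !mulmxDl.
move: (mpartial k (gam g l) x) (mpartial l (gam g k) x) (mpartial k _ x) (mpartial l _ x).
move: (gam g k x *m gam g l x) (gam g l x *m gam g k x).
move: (gam g k x *m conf_diff _ _ _ l) (gam g l x *m conf_diff _ _ _ k).
move: (conf_diff _ _ _ k *m gam g l x) (conf_diff _ _ _ l *m gam g k x).
move: (conf_diff _ _ _ k *m conf_diff _ _ _ l) (conf_diff _ _ _ l *m conf_diff _ _ _ k).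
by move=> *; apply/matrixP => i j; rewrite !mxE; ring.
Qed.

Lemma weyl_sq_conformal x : n%:R - 1 != 0 :> R -> n%:R - 2 != 0 :> R -> U x ->
  weyl_sq_loc gc x = (al x)^-1 ^+ 2 * weyl_sq_loc g x.
Proof.
move=> n1 n2 Ux.
have giE : invmx (gc x) = (al x)^-1 *: invmx (g x).
  apply: invmx_uniq; rewrite (gcE Ux) -scalemxAl -scalemxAr scalerA mulfV ?al0 //.
  by rewrite scale1r mulmxV ?gu.
rewrite !weyl_sq_locE giE (gcE Ux) -(sqM_conf _ _ _ (al0 Ux)).
apply: eq_sqM => k l; rewrite /weyl_at giE (gcE Ux) (eq_weylM _ _ (curv_conformal Ux)).
by rewrite weylM_conf ?al0 // mulmxV ?gu.
Qed.

End ConformalChange.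

(** * Metrics and conformal structures on a manifold *)

Section Charts.
Context {R : realType} {n : nat} {M : manifold R n}.
Implicit Types (c : chart M) (W : set M) (f : M -> M).

Definition img c W : set 'rV[R]_n := crd c @` (dom c `&` W).

Lemma mem_img c W m : dom c m -> W m -> img c W (crd c m).
Proof. by move=> cm Wm; exists m. Qed.

Lemma open_img c W : open W -> open (img c W).
Proof.
move=> Wo.
have -> : img c W = [set x | (crd c @` dom c) x /\ W (par c x)].
  apply/seteqP; split=> [x [m [cm Wm] <-]|x [[m cm <-]]].
    by split; [exists m | rewrite (crdK cm)].
  by rewrite (crdK cm) => Wm; exists m.
apply: open_preimage => //; first exact: cod_open.
exact: par_continuous.
Qed.

Arguments open_img c [W] _ [t] _.

Lemma img_sub c W W' : W `<=` W' -> img c W `<=` img c W'.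
Proof. by move=> WW x [m [cm Wm] <-]; exists m => //; split => //; exact: WW. Qed.

Definition loc f c c' : 'rV[R]_n -> 'rV[R]_n := crd c' \o f \o par c.

Lemma locE f c c' m : dom c m -> loc f c c' (crd c m) = crd c' (f m).
Proof. by move=> cm; rewrite /loc /= (crdK cm). Qed.

Lemma smooth_map_id : smooth_map [set: M] id.
Proof.
split=> [m _|c c' k]; first exact: cvg_id.
by rewrite setIT; exact: crd_smooth.
Qed.

Lemma smooth_loc W f c c' : smooth_map W f ->
  smooth_rvmap (img c [set m | W m /\ dom c' (f m)]) (loc f c c').
Proof.
move=> [_ fs] k; apply: (smooth_sub _ (fs c c' k)).
by move=> x [m [cm [Wm fm]] <-]; exists m.
Qed.

Lemma open_loc_dom W f W' : open W -> smooth_map W f -> open W' ->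
  open [set m | W m /\ W' (f m)].
Proof. by move=> Wo [fc _] W'o; apply: open_preimage. Qed.

Lemma jac_loc_comp W W' f f' c c' c'' m : open W -> open W' ->
  smooth_map W f -> smooth_map W' f' -> dom c m -> W m -> dom c' (f m) -> W' (f m) ->
  dom c'' (f' (f m)) ->
  jac (loc (f' \o f) c c'') (crd c m) =
  jac (loc f c c') (crd c m) *m jac (loc f' c' c'') (crd c' (f m)).
Proof.
move=> Wo Wo' fs fs' cm Wm cfm Wfm cffm.
(* On [X] and [Y] every point involved lies in the domain of the chart in which it is read;
   elsewhere the values of [crd] and [par] carry no information. *)
pose Y := [set m | W' m /\ dom c'' (f' m)].
have Yo : open Y by apply: open_loc_dom => //; exact: dom_open.
pose X := [set m | W m /\ (dom c' `&` Y) (f m)].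
have Xo : open X by apply: open_loc_dom => //; apply: openI => //; exact: dom_open.
have Xm : img c X (crd c m) by apply: mem_img.
have XY x : img c X x -> img c' Y (loc f c c' x).
  by move=> [m' [cm' [? [? ?]]] <-]; rewrite locE //; apply: mem_img.
have hs : smooth_rvmap (img c X) (loc f c c').
  move=> k; apply: (smooth_sub _ (smooth_loc fs k)); apply: img_sub.
  by move=> y [? []].
rewrite (@eq_jac _ _ (img c X) _ (loc f' c' c'' \o loc f c c')) //; last 2 first.
- exact: open_img.
- move=> x; rewrite inE => -[m' [cm' [? [? ?]]] <-].
  by rewrite /= !locE.
rewrite (jac_comp (open_img c' Yo) XY hs (smooth_loc fs') Xm).
by rewrite locE.
Qed.

Lemma jac_loc_id c m : dom c m -> jac (loc id c c) (crd c m) = 1%:M.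
Proof.
move=> cm; rewrite -(jac_id (crd c m)); apply: (@eq_jac _ _ (img c setT)).
- exact/open_img/openT.
- by move=> x; rewrite inE => -[m' [cm' _] <-]; rewrite locE.
- exact: mem_img.
Qed.

Definition trans c c' : 'rV[R]_n -> 'rV[R]_n := crd c' \o par c.

Lemma trans_loc c c' : trans c c' = loc id c c'. Proof. by []. Qed.

Lemma jac_trans_comp c c' c'' m : dom c m -> dom c' m -> dom c'' m ->
  jac (trans c c'') (crd c m) = jac (trans c c') (crd c m) *m jac (trans c' c'') (crd c' m).
Proof.
move=> *; rewrite !trans_loc.
by apply: (jac_loc_comp openT openT smooth_map_id smooth_map_id).
Qed.

Lemma jac_trans_id c m : dom c m -> jac (trans c c) (crd c m) = 1%:M.
Proof. exact: jac_loc_id. Qed.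

Lemma jac_trans_unit c c' m : dom c m -> dom c' m -> jac (trans c c') (crd c m) \in unitmx.
Proof.
move=> cm cm'; have := jac_trans_comp cm cm' cm.
by rewrite jac_trans_id // => /esym /mulmx1_unit[].
Qed.

Lemma jac_loc_transl W f c c' c'' m : open W -> smooth_map W f -> dom c m -> dom c' m -> W m ->
  dom c'' (f m) ->
  jac (loc f c c'') (crd c m) = jac (trans c c') (crd c m) *m jac (loc f c' c'') (crd c' m).
Proof.
by move=> Wo fs *; rewrite -(jac_loc_comp openT Wo smooth_map_id fs).
Qed.

Lemma jac_loc_transr W f c c' c'' m : open W -> smooth_map W f -> dom c m -> W m ->
  dom c' (f m) -> dom c'' (f m) ->
  jac (loc f c c'') (crd c m) =
  jac (loc f c c') (crd c m) *m jac (trans c' c'') (crd c' (f m)).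
Proof.
by move=> Wo fs *; rewrite -(jac_loc_comp Wo openT fs smooth_map_id).
Qed.

(** The Jacobian of [phi] in the same charts is a right inverse, by the chain rule. *)
Lemma jac_inv_unit (phi : local_diffeo M) c c' m : dom c m -> (phi @` ld_dom phi) m ->
  dom c' (ld_inv phi m) -> jac (loc (ld_inv phi) c c') (crd c m) \in unitmx.
Proof.
move=> cm [m' phim' E] c'm.
have invE : ld_inv phi m = m' by rewrite -E ld_funK.
have im : (phi @` ld_dom phi) m by exists m'.
have := jac_loc_comp (ld_cod_open phi) (@ld_dom_open _ _ _ phi) (ld_inv_smooth phi) (ld_fun_smooth phi)
  cm im c'm.
rewrite invE E => /(_ c phim' cm) J.
have /mulmx1_unit[] // : jac (loc (ld_inv phi) c c') (crd c m) *m jac (loc phi c' c) (crd c' m') = 1%:M.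
rewrite -J -(jac_id (crd c m)); apply: (@eq_jac _ _ (img c (phi @` ld_dom phi))).
- exact/open_img/ld_cod_open.
- move=> x; rewrite inE => -[m1 [cm1 [m2 phim2 E2]] <-].
  by rewrite locE //= -E2 ld_funK.
- exact: mem_img.
Qed.

Lemma chart_atP (m : M) : dom (chart_at m) m.
Proof. exact: svalP (cid (dom_cover m)). Qed.

End Charts.
Arguments open_img {R n M} c [W] _ [t] _.

(** * The fibres of the bundles of metrics and of conformal structures *)

Section FibreAlgebra.
Context {R : realType} {n : nat}.
Hypothesis n0 : (0 < n)%N.
Implicit Types (P A : 'M[R]_n).

Definition unimod A : 'M[R]_n := (`|\det A| `^ (- n%:R^-1)) *: A.

Let nR : (n%:R : R) != 0. Proof. by rewrite pnatr_eq0 -lt0n. Qed.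

Lemma act_OM P Q A : act_O (P *m Q) A = act_O P (act_O Q A).
Proof. by rewrite /act_O trmx_mul !mulmxA. Qed.

Lemma act_OZ P a A : act_O P (a *: A) = a *: act_O P A.
Proof. by rewrite /act_O -scalemxAr -scalemxAl. Qed.

Lemma unit_det_norm A : A \in unitmx -> 0 < `|\det A|.
Proof. by rewrite unitmxE unitfE normr_gt0. Qed.

(** The determinant is multiplied by the square of det P, so the exponent -1/n of [unimod] becomes
    the -2/n of [act_C]: normalization intertwines the two actions. *)
Lemma unimod_act P A : P \in unitmx -> unimod (act_O P A) = act_C P (unimod A).
Proof.
move=> Pu; have d0 := unit_det_norm Pu.
rewrite /act_C /unimod act_OZ scalerA; congr (_ *: _).
rewrite /act_O !det_mulmx det_tr mulrAC !normrM !powRM // -powRD; last first.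
  by apply/implyP => _; rewrite gt_eqF.
by congr (_ `^ _ * _); rewrite -opprD; field.
Qed.

Lemma unimod_id A : `|\det A| = 1 -> unimod A = A.
Proof. by move=> E; rewrite /unimod E powR1 scale1r. Qed.

Lemma det_unimod A : A \in unitmx -> `|\det (unimod A)| = 1.
Proof.
move=> Au; have d0 := unit_det_norm Au.
rewrite /unimod detZ normrM normrX ger0_norm ?powR_ge0 //.
rewrite -powR_mulrn ?powR_ge0 // -powRrM mulNr mulVf // powR_inv1 ?ltW //.
by rewrite mulVf ?gt_eqF.
Qed.

Variables (p q : nat).
Hypothesis pqn : (p + q)%N = n.

Lemma sigmx_det : `|\det (@sigmx R n p q)| = 1.
Proof.
rewrite /sigmx det_diag normr_prod big1 // => i _; rewrite mxE pqn ltn_ord.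
by case: ifP; rewrite ?normrN normr1.
Qed.

Lemma sigmx_unit : @sigmx R n p q \in unitmx.
Proof. by rewrite unitmxE unitfE -normr_gt0 sigmx_det. Qed.

Lemma act_O_unit P A : P \in unitmx -> A \in unitmx -> act_O P A \in unitmx.
Proof. by move=> Pu Au; rewrite !unitmx_mul Pu Au unitmx_tr. Qed.

Lemma fibre_O_unit A : fibre act_O p q A -> A \in unitmx.
Proof. by move=> [P Pu ->]; apply: act_O_unit => //; exact: sigmx_unit. Qed.

Lemma fibre_O_sym A : fibre act_O p q A -> A^T = A.
Proof.
move=> [P Pu ->]; rewrite /act_O !trmx_mul trmxK mulmxA; congr (_ *m _ *m _).
by rewrite /sigmx tr_diag_mx.
Qed.

Lemma fibre_O_act P A : P \in unitmx -> fibre act_O p q A -> fibre act_O p q (act_O P A).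
Proof. by move=> Pu [Q Qu ->]; exists (P *m Q); rewrite ?unitmx_mul ?Pu // act_OM. Qed.

Lemma fibre_O_scale a A : 0 < a -> fibre act_O p q A -> fibre act_O p q (a *: A).
Proof.
move=> a0 [P Pu ->]; exists (Num.sqrt a *: P).
  by rewrite unitmxZ // unitfE gt_eqF // sqrtr_gt0.
rewrite /act_O linearZ /= -!scalemxAl -scalemxAr scalerA -expr2 sqr_sqrtr //.
exact: ltW.
Qed.

Lemma fibre_C_unimod A : fibre act_O p q A -> fibre act_C p q (unimod A).
Proof.
by move=> [P Pu ->]; exists P => //; rewrite unimod_act // (unimod_id sigmx_det).
Qed.

Lemma fibre_C_O A : fibre act_C p q A -> fibre act_O p q A.
Proof.
move=> [P Pu ->]; apply: fibre_O_scale; last by exists P.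
by apply: powR_gt0; exact: unit_det_norm.
Qed.

Lemma fibre_C_det A : fibre act_C p q A -> `|\det A| = 1.
Proof.
move=> [P Pu ->]; rewrite -(unimod_id sigmx_det) -unimod_act // det_unimod //.
by apply: act_O_unit => //; exact: sigmx_unit.
Qed.

End FibreAlgebra.

(** * Generic points and preferred metrics *)

Section LocalSections.
Context {R : realType} {n : nat} {M : manifold R n}.
Variables (p q : nat).
Hypotheses (n0 : (0 < n)%N) (pqn : (p + q)%N = n).
Implicit Types (g s : mxfield M) (c : chart M).

Lemma metric_field g c : metric p q g -> nondegenerate_field (img c (fdom g)) (fmat g c).
Proof.
move=> [go gf gs _]; split; first exact: open_img.
  by move=> i j; apply: gs.
by move=> x [m [cm gm] <-]; apply: fibre_O_unit (gf c m cm gm).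
Qed.

Lemma metric_sym g c x : metric p q g -> img c (fdom g) x -> (fmat g c x)^T = fmat g c x.
Proof. by move=> [go gf gs _] [m [cm gm] <-]; apply: fibre_O_sym (gf c m cm gm). Qed.

Lemma smooth_act_loc (f : M -> M) (W Y : set M) (X : set M) c c' (A : 'rV[R]_n -> 'M[R]_n) :
  open W -> open X -> open Y -> smooth_map W f -> msmooth (img c' Y) A ->
  (forall m, X m -> [/\ W m, dom c' (f m) & Y (f m)]) ->
  msmooth (img c X) (fun x => act_O (jac (loc f c c') x) (A (loc f c c' x))).
Proof.
move=> Wo Xo Yo fs As XY.
have Xio := open_img c Xo.
have hs : smooth_rvmap (img c X) (loc f c c').
  move=> k; apply: (smooth_sub _ (smooth_loc fs k)); apply: img_sub.
  by move=> m /XY[].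
have Js := msmooth_jac Xio hs.
have Ah : msmooth (img c X) (A \o loc f c c').
  apply: (msmooth_comp Xio (open_img c' Yo) _ hs As) => x [m [cm Xm] <-].
  by have [? ? ?] := XY m Xm; rewrite locE //; apply: mem_img.
exact: (msmoothM Xio (msmoothM Xio Js Ah) (msmooth_tr Xio Js)).
Qed.

(** Covers two cases at once: the identity read in two charts, for independence of the chart, and
    the inverse of a local diffeomorphism, for the behaviour under [push]. *)
Lemma weyl_sq_loc_pull g g' (f : M -> M) (W : set M) c c' m :
  metric p q g -> metric p q g' -> open W -> smooth_map W f ->
  (forall m', W m' -> fdom g m' -> dom c m' -> dom c' (f m') -> fdom g' (f m') ->
     jac (loc f c c') (crd c m') \in unitmx /\
     fmat g c (crd c m') = act_O (jac (loc f c c') (crd c m')) (fmat g' c' (crd c' (f m')))) ->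
  W m -> fdom g m -> dom c m -> dom c' (f m) -> fdom g' (f m) ->
  weyl_sq_loc (fmat g c) (crd c m) = weyl_sq_loc (fmat g' c') (crd c' (f m)).
Proof.
move=> mg mg' Wo fs H Wm gm cm c'm g'm.
pose X := [set m' | W m' /\ (dom c' `&` fdom g') (f m')] `&` fdom g.
have g'o : open (fdom g') by case: mg'.
have go : open (fdom g) by case: mg.
have Xo : open X.
  apply: openI => //; apply: open_loc_dom => //; apply: openI => //; exact: dom_open.
have Xm : img c X (crd c m) by apply: mem_img.
have [_ gs gu] := metric_field c mg.
have gX : nondegenerate_field (img c X) (fmat g c).
  have sub : img c X `<=` img c (fdom g) by apply: img_sub => y [].
  split; first exact: open_img.
    by move=> i j; apply: smooth_sub (gs i j).
  by move=> x /sub; apply: gu.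
rewrite (weyl_sq_change gX (metric_field c' mg') (h := loc f c c')) ?locE //.
- by move=> x; apply: metric_sym.
- by move=> x [m' [cm' [[Wm' [c'm' g'm']] gm']] <-]; rewrite locE //; apply: mem_img.
- move=> k; apply: (smooth_sub _ (smooth_loc fs k)); apply: img_sub.
  by move=> y [[? []]].
- by move=> x [m' [cm' [[Wm' [c'm' g'm']] gm']] <-]; have [] := H m' Wm' gm' cm' c'm' g'm'.
- move=> x [m' [cm' [[Wm' [c'm' g'm']] gm']] <-]; rewrite locE //.
  by have [_ ->] := H m' Wm' gm' cm' c'm' g'm'.
Qed.

Lemma metric_trans g c c' m : metric p q g -> dom c m -> dom c' m -> fdom g m ->
  fmat g c (crd c m) = act_O (jac (trans c c') (crd c m)) (fmat g c' (crd c' m)).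
Proof. by move=> [_ _ _ gt]; apply: gt. Qed.

Lemma weyl_sqE g c m : metric p q g -> fdom g m -> dom c m ->
  weyl_sq g m = weyl_sq_loc (fmat g c) (crd c m).
Proof.
move=> mg gm cm; rewrite /weyl_sq.
apply: (weyl_sq_loc_pull (f := id) mg mg openT smooth_map_id) => //; last exact: chart_atP.
move=> m' _ gm' c'm' cm' _; split; first exact: jac_trans_unit.
exact: metric_trans.
Qed.

Lemma smooth_weyl_sq g c : metric p q g ->
  smooth_on (img c (fdom g)) (weyl_sq_loc (fmat g c)).
Proof.
by move=> mg; apply: (diffop_smooth nondeg_open nondeg_smooth diffop_weyl_sq); apply: metric_field.
Qed.

(** The chart used by [weyl_sq] varies with the point without any continuity; near a given point the
    expression in one fixed chart replaces it. *)
Lemma open_generic g : metric p q g -> open [set m | fdom g m /\ weyl_sq g m != 0].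
Proof.
move=> mg; have go : open (fdom g) by case: mg.
rewrite openE => m [gm Hm]; pose c := chart_at m.
have cm : dom c m := chart_atP m.
have io := open_img c go.
have Zo : open [set x | img c (fdom g) x /\ weyl_sq_loc (fmat g c) x != 0].
  apply: open_smooth_neq0 => //; exact: smooth_weyl_sq.
have : open [set m' | (dom c `&` fdom g) m' /\
   [set x | img c (fdom g) x /\ weyl_sq_loc (fmat g c) x != 0] (crd c m')].
  apply: open_preimage => //; first by apply: openI => //; exact: dom_open.
  by move=> m' [cm' _]; apply: crd_continuous.
move=> Oo; apply: (filterS _ (open_nbhs_nbhs (conj Oo _))).
  by move=> m' [[cm' gm'] [_ H']]; split => //; rewrite (weyl_sqE mg gm' cm').
exact: (conj (conj cm gm) (conj (mem_img cm gm) Hm)).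
Qed.

Lemma dim_factors_neq0 : (4 <= n)%N -> n%:R - 1 != 0 :> R /\ n%:R - 2 != 0 :> R.
Proof.
move=> n4; split; rewrite subr_eq0 ?pnatr_eq1 ?eqr_nat.
  by move: n4; case: n => [|[|]].
by move: n4; case: n => [|[|[|]]].
Qed.

Hypothesis n4 : (4 <= n)%N.

(** Stated in one chart, with [al] a function of the coordinates, since it has to apply to
    [conf_section g], which is not a metric: its factor is a power of a determinant and differs from
    chart to chart. *)
Lemma weyl_sq_scale g h (al : 'rV[R]_n -> R) c m : metric p q g -> open (fdom h) ->
  fdom h m -> fdom h `<=` fdom g -> dom c m -> smooth_on (img c (fdom h)) al ->
  (forall x, img c (fdom h) x -> al x != 0) ->
  (forall x, img c (fdom h) x -> fmat h c x = al x *: fmat g c x) ->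
  weyl_sq_loc (fmat h c) (crd c m) =
  (al (crd c m))^-1 ^+ 2 * weyl_sq_loc (fmat g c) (crd c m).
Proof.
move=> mg ho hm hg cm als al0 hE.
have [n1 n2] := dim_factors_neq0 n4.
have io := open_img c ho.
have [_ gs gu] := metric_field c mg.
have sub : img c (fdom h) `<=` img c (fdom g) by apply: img_sub.
have gs' : msmooth (img c (fdom h)) (fmat g c) by move=> i j; apply: smooth_sub (gs i j).
have gF : nondegenerate_field (img c (fdom h)) (fmat g c).
  by split=> // x /sub; apply: gu.
have hF : nondegenerate_field (img c (fdom h)) (fmat h c).
  split; first exact: io.
    apply: (eq_msmooth io (A := fun x => al x *: fmat g c x)).
      by move=> x; rewrite inE => xh; rewrite hE.
    exact: msmoothZ.
  move=> x xh; rewrite hE // unitmxZ ?unitfE ?al0 //; exact/gu/sub.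
apply: (weyl_sq_conformal gF hF _ als al0 hE n1 n2); last exact: mem_img.
by move=> x /sub; apply: metric_sym.
Qed.

Lemma conf_class_refl g : conf_class g g.
Proof.
split=> //; exists (fun=> 1); split=> [c|m _|c m cm gm]; last by rewrite scale1r.
  by apply: (smooth_sub _ (@smooth_cst R n setT openT 1)).
exact: ltr01.
Qed.

Lemma genericE g m : metric p q g -> fdom g m -> generic g m <-> weyl_sq g m != 0.
Proof.
move=> mg gm; split=> [[h [hg [a [as_ a0 hE]]] Hh]|Hg]; last first.
  by exists g => //; exact: conf_class_refl.
pose c := chart_at m; have cm : dom c m := chart_atP m.
have go : open (fdom g) by case: mg.
move: Hh; rewrite /weyl_sq -/c (@weyl_sq_scale g h (a \o par c)) //; first last.
- by rewrite hg => x [m' [cm' gm'] <-]; rewrite /= (crdK cm') hE.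
- by rewrite hg => x [m' [cm' gm'] <-]; rewrite /= (crdK cm') gt_eqF // a0.
- by rewrite hg; apply: as_.
- by rewrite hg.
- by rewrite hg.
- by rewrite hg.
by rewrite mulf_eq0 negb_or => /andP[].
Qed.

Lemma smooth_det g c : metric p q g -> smooth_on (img c (fdom g)) (fun x => \det (fmat g c x)).
Proof.
move=> mg; have D : diffop nondegenerate_field 0
    (fun (A : 'rV[R]_n -> 'M[R]_n) x => \det (A x)).
  by apply: diffop_det => i j; exact: diffop_fld.
exact: (diffop_smooth nondeg_open nondeg_smooth D (metric_field c mg)).
Qed.

Lemma conf_factor_smooth g c : metric p q g ->
  smooth_on (img c (fdom g)) (fun x => `|\det (fmat g c x)| `^ (- n%:R^-1)).
Proof.
move=> mg; have [io _ gu] := metric_field c mg.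
apply: smooth_powR => //; last exact: smooth_det.
by move=> x /gu; rewrite unitmxE unitfE.
Qed.

Lemma conf_section_section g : metric p q g -> local_section act_C p q (conf_section g).
Proof.
move=> mg; have [go gf gs gt] := mg; split; first exact: go.
- by move=> c m cm gm; apply: fibre_C_unimod => //; exact: gf.
- move=> c i j; have [io gs' _] := metric_field c mg.
  exact: (msmoothZ io (conf_factor_smooth mg) gs' i j).
- move=> c c' m cm c'm gm; rewrite -/(trans c c').
  rewrite -[LHS]/(unimod (fmat g c (crd c m))) (metric_trans mg cm c'm gm).
  by rewrite unimod_act //; exact: jac_trans_unit.
Qed.

(** A real power in place of the square root, so that [smooth_powR] and [diffop_powR] apply. *)
Definition sqrt_weyl (A : 'rV[R]_n -> 'M[R]_n) (x : 'rV[R]_n) : R :=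
  `|weyl_sq_loc A x| `^ 2^-1.

Lemma sqrtE (x : R) : Num.sqrt `|x| = `|x| `^ 2^-1.
Proof. by rewrite powR12_sqrt. Qed.

Lemma preferred_metric g : metric p q g -> metric p q (preferred g).
Proof.
move=> mg; have [go gf gs gt] := mg.
have po := open_generic mg.
have prefE c m : dom c m -> fmat (preferred g) c (crd c m) =
    Num.sqrt `|weyl_sq g m| *: fmat g c (crd c m).
  by move=> cm; rewrite /= (crdK cm).
split; first exact: po.
- move=> c m cm [gm Hm]; rewrite prefE //; apply: fibre_O_scale; last exact: gf.
  by rewrite sqrtr_gt0 normr_gt0.
- move=> c i j; have sub : img c (fdom (preferred g)) `<=` img c (fdom g).
    by apply: img_sub => m [].
  have io := open_img c po.
  apply: (eq_smooth io (f := fun x => sqrt_weyl (fmat g c) x * fmat g c x i j)).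
    move=> x; rewrite inE => -[m [cm [gm Hm]] <-].
    by rewrite prefE // entryZ sqrtE (weyl_sqE mg gm cm).
  apply: smoothM => //; last exact: smooth_sub (gs c i j).
  apply: smooth_powR => //; last by apply: smooth_sub (smooth_weyl_sq mg).
  by move=> x [m [cm [gm Hm]] <-]; rewrite -(weyl_sqE mg gm cm).
- move=> c c' m cm c'm [gm Hm]; rewrite !prefE // (metric_trans mg cm c'm gm).
  by rewrite act_OZ.
Qed.

(* |H|^(1/2) scales with weight -1, which cancels the weight of the metric: the
   unimodular representative may be used in place of g. *)
Lemma preferred_conf g c m : metric p q g -> fdom (preferred g) m -> dom c m ->
  fmat (preferred g) c (crd c m) =
  sqrt_weyl (fmat (conf_section g) c) (crd c m) *: fmat (conf_section g) c (crd c m).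
Proof.
move=> mg [gm Hm] cm; have [io gs gu] := metric_field c mg.
pose la x := `|\det (fmat g c x)| `^ (- n%:R^-1).
have la0 x : img c (fdom g) x -> 0 < la x.
  by move=> xg; apply: powR_gt0; apply: unit_det_norm; exact: gu.
have lam : 0 < la (crd c m) by apply/la0/mem_img.
rewrite /= (crdK cm) -/(la _) scalerA; congr (_ *: _).
rewrite /sqrt_weyl (@weyl_sq_scale g (conf_section g) la c m) //; last first.
- by move=> x /la0/gt_eqF ->.
- exact: (@conf_factor_smooth g c mg).
- by case: mg.
have lV : 0 <= (la (crd c m))^-1 by rewrite invr_ge0 ltW.
rewrite normrM powRM // normrX (ger0_norm lV) -powR_mulrn // -powRrM mulfV // powRr1 //.
by rewrite mulrAC mulVf ?gt_eqF // mul1r sqrtE (weyl_sqE mg gm cm).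
Qed.

End LocalSections.

(** * Metrics representing a conformal structure, and push-forwards *)

Section Representative.
Context {R : realType} {n : nat} {M : manifold R n}.
Variables (p q : nat).
Hypotheses (n0 : (0 < n)%N) (pqn : (p + q)%N = n).
Implicit Types (g s : mxfield M) (c : chart M).

(* A conformal structure, restricted to the domain of c0, contains the metric
   whose matrix in c0 is the unimodular one. *)
Definition unimod_metric s c0 : mxfield M :=
  MxField (fdom s `&` dom c0)
    (fun c x => act_O (jac (trans c c0) x) (fmat s c0 (trans c c0 x))).

Lemma unimod_metricE s c0 c m : dom c m ->
  fmat (unimod_metric s c0) c (crd c m) =
  act_O (jac (trans c c0) (crd c m)) (fmat s c0 (crd c0 m)).
Proof. by move=> cm; rewrite /= trans_loc locE. Qed.

Lemma unimod_metricP s c0 : local_section act_C p q s -> metric p q (unimod_metric s c0).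
Proof.
move=> [so sf ss st]; have go : open (fdom s `&` dom c0).
  by apply: openI => //; exact: dom_open.
split; first exact: go.
- move=> c m cm [sm c0m]; rewrite unimod_metricE //.
  apply: fibre_O_act; first exact: jac_trans_unit.
  exact/fibre_C_O/sf.
- move=> c i j.
  apply: (smooth_act_loc (c := c) openT go so smooth_map_id (ss c0)) => m [sm c0m].
  by split.
- move=> c c' m cm c'm [sm c0m]; rewrite !unimod_metricE // -/(trans c c').
  by rewrite -act_OM -jac_trans_comp.
Qed.

(** In [c0] the matrix of [s] has determinant 1 or -1 and is unchanged by normalization;
    [unimod_act] turns the transformation law of metrics into that of conformal structures, which
    gives the other charts. *)
Lemma conf_unimod_metric s c0 c m : local_section act_C p q s -> dom c m ->
  fdom (unimod_metric s c0) m ->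
  fmat (conf_section (unimod_metric s c0)) c (crd c m) = fmat s c (crd c m).
Proof.
move=> [so sf ss st] cm [sm c0m].
rewrite -[LHS]/(unimod (fmat (unimod_metric s c0) c (crd c m))) unimod_metricE //.
rewrite unimod_act //; last exact: jac_trans_unit.
by rewrite unimod_id ?(fibre_C_det n0 pqn (sf _ _ c0m sm)) // [RHS](st c c0).
Qed.

Section Push.
Variable phi : local_diffeo M.

Let inv := ld_inv phi.
Let im := phi @` ld_dom phi.
Let imo : open im := ld_cod_open phi.
Let invs : smooth_map im inv := ld_inv_smooth phi.

Lemma pushE act s c m : dom c m ->
  fmat (push act phi s) c (crd c m) =
  act (jac (loc inv c (chart_at (inv m))) (crd c m))
      (fmat s (chart_at (inv m)) (crd (chart_at (inv m)) (inv m))).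
Proof. by move=> cm; rewrite /= (crdK cm). Qed.

Lemma push_chart g c c1 m : metric p q g -> dom c m -> fdom (push act_O phi g) m ->
  dom c1 (inv m) ->
  fmat (push act_O phi g) c (crd c m) =
  act_O (jac (loc inv c c1) (crd c m)) (fmat g c1 (crd c1 (inv m))).
Proof.
move=> mg cm [mi gm] c1m; rewrite pushE //.
have a1 : dom (chart_at (inv m)) (inv m) := chart_atP _.
rewrite (metric_trans mg a1 c1m gm) -act_OM.
by rewrite -(jac_loc_transr imo invs).
Qed.

Lemma push_metric g : metric p q g -> metric p q (push act_O phi g).
Proof.
move=> mg; have [go gf gs gt] := mg.
have po : open (fdom (push act_O phi g)) by exact: open_loc_dom.
split; first exact: po.
- move=> c m cm [mi gm]; rewrite pushE //; have a1 : dom (chart_at (inv m)) (inv m) := chart_atP _.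
  apply: fibre_O_act; last exact: gf.
  exact: jac_inv_unit.
- move=> c i j s x [m [cm [mi gm]] xE].
  (* One chart around the preimage of the given point serves on a whole neighbourhood, whereas the
     chart in [push] varies with the point. *)
  pose c1 := chart_at (inv m).
  have c1m : dom c1 (inv m) := chart_atP _.
  pose X := [set m' | im m' /\ (dom c1 `&` fdom g) (inv m')].
  have Xo : open X by apply: open_loc_dom => //; apply: openI => //; exact: dom_open.
  have S : msmooth (img c X) (fun x => act_O (jac (loc inv c c1) x) (fmat g c1 (loc inv c c1 x))).
    by apply: (smooth_act_loc (c := c) imo Xo go invs (gs c1)) => m' [? []].
  have io := open_img c Xo.
  have : smooth_on (img c X) (fun x => fmat (push act_O phi g) c x i j).
    apply: (eq_smooth io _ (S i j)) => y; rewrite inE => -[m' [cm' [mi' [c1m' gm']]] <-].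
    by rewrite (@push_chart g c c1 m') // locE.
  by apply; rewrite -xE; apply: mem_img.
- move=> c c' m cm c'm gm; rewrite -/(trans c c').
  have a1 : dom (chart_at (inv m)) (inv m) := chart_atP _.
  rewrite (push_chart mg cm gm a1) (push_chart mg c'm gm a1) -act_OM.
  have [mi _] := gm.
  by rewrite -(jac_loc_transl imo invs cm c'm mi a1).
Qed.

Lemma weyl_sq_push g m : metric p q g -> fdom (push act_O phi g) m ->
  weyl_sq (push act_O phi g) m = weyl_sq g (inv m).
Proof.
move=> mg pm; have [mi gm] := pm.
rewrite /weyl_sq.
apply: (weyl_sq_loc_pull pqn (push_metric mg) mg imo invs) => //; try exact: chart_atP.
move=> m' mi' pm' cm' c'm' gm'; split; first exact: jac_inv_unit.
exact: push_chart.
Qed.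

End Push.

End Representative.

(** * Jets of preferred metrics *)

Section Jets.
Context {R : realType} {n : nat} {M : manifold R n}.
Implicit Types (s : mxfield M) (c : chart M).

Lemma jet_crdE r c s m : dom c m ->
  jet_crd c (jet r s m) = jetmap r (fmat s c) (crd c m).
Proof.
move=> cm; apply/rowP => k; rewrite mxE [RHS]mxE.
case: (enum_val k) => [i|[l [a b]]] //=.
by rewrite asboolT // mxE.
Qed.

Lemma eq_jetmap r (U : set 'rV[R]_n) (A B : 'rV[R]_n -> 'M[R]_n) x :
  open U -> {in U, A =1 B} -> U x -> jetmap r A x = jetmap r B x.
Proof.
move=> Uo E Ux; apply/rowP => k; rewrite !mxE.
case: (enum_val k) => [i|[l [a b]]] //=.
by apply: (eq_partials Uo) => [y yU|]; rewrite ?inE // E.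
Qed.

Lemma jet_congr r s s' (W : set M) m : open W -> W m ->
  (forall c m', dom c m' -> W m' -> fmat s c (crd c m') = fmat s' c (crd c m')) ->
  jet r s m = jet r s' m.
Proof.
move=> Wo Wm E; congr Jet; apply/funext => c; apply/funext => l.
case: asboolP => // cm; apply/matrixP => a b; rewrite !mxE.
apply: (eq_partials (open_img c Wo)); last by rewrite inE; apply: mem_img.
by move=> x; rewrite inE => -[m' [cm' Wm'] <-]; rewrite E.
Qed.

Lemma jet_ext r s s' m :
  (forall c, dom c m -> jet_crd c (jet r s m) = jet_crd c (jet r s' m)) ->
  jet r s m = jet r s' m.
Proof.
move=> E; congr Jet; apply/funext => c; apply/funext => l.
case: asboolP => // cm; apply/matrixP => a b.
have := congr1 (fun u : 'rV_(jet_dim r) => u 0 (jcoord (inr (l, (a, b)) : @jet_index n r))) (E c cm).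
by rewrite !jet_crdE // !jetmapE => {}E; rewrite !mxE.
Qed.

End Jets.

(** * Jets of preferred metrics as smooth functions of jets *)

Section Prolongation.
Context {R : realType} {n : nat}.

Definition weyl_generic (U : set 'rV[R]_n) (A : 'rV[R]_n -> 'M[R]_n) :=
  nondegenerate_field U A /\ forall x, U x -> weyl_sq_loc A x != 0.

Lemma weyl_generic_open U A : weyl_generic U A -> open U. Proof. by case=> -[]. Qed.
Lemma weyl_generic_smooth U A : weyl_generic U A -> msmooth U A. Proof. by case=> -[]. Qed.

Definition pref (A : 'rV[R]_n -> 'M[R]_n) (x : 'rV[R]_n) : 'M[R]_n := sqrt_weyl A x *: A x.

Lemma diffop_sub (adm adm' : set 'rV[R]_n -> ('rV[R]_n -> 'M[R]_n) -> Prop) r T :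
  (forall U g, adm' U g -> adm U g) -> diffop adm r T -> diffop adm' r T.
Proof.
move=> S [ O [Psi [Oo Ps H]]]; exists O, Psi; split=> // U g ag.
exact: H (S _ _ ag).
Qed.

Lemma diffop_pref_jet r (k : @jet_index n r) :
  diffop weyl_generic r.+2 (fun A => jentry k (pref A)).
Proof.
case: k => [i|[l [a b]]] /=.
  exact: (diffop_entry weyl_generic (inl i : @jet_index n r.+2)).
have sub U A : weyl_generic U A -> nondegenerate_field U A by case.
have P : diffop weyl_generic 2 (fun A x => sqrt_weyl A x * A x a b).
  apply: diffopM.
    apply: diffop_powR; first by move=> U A [_].
    exact: diffop_sub sub diffop_weyl_sq.
  by apply: (diffop_sub sub); do 2 apply: diffopS; exact: diffop_fld.
have := diffop_partials weyl_generic_open weyl_generic_smooth l P.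
move=> /(diffop_leq (r' := r.+2)) H.
have {}H : diffop weyl_generic r.+2 (fun A => partials l (fun x => sqrt_weyl A x * A x a b)).
  (* At most [r] derivatives are applied to an operator of order 2. *)
  by apply: H; rewrite addn2 !ltnS size_bseq.
apply: eq_diffop H => U A wA x xU; congr (partials l _ x).
by apply/funext => y; rewrite entryZ.
Qed.

Lemma prolongation r : exists (O : set 'rV[R]_(@jet_dim n r.+2))
    (Phi : 'rV[R]_(@jet_dim n r.+2) -> 'rV[R]_(@jet_dim n r)),
  [/\ open O, forall k, smooth_on O (fun u => Phi u 0 k) &
      forall U A, weyl_generic U A -> forall x, U x ->
        O (jetmap r.+2 A x) /\ jetmap r (pref A) x = Phi (jetmap r.+2 A x)].
Proof.
have H (k : 'I_(@jet_dim n r)) :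
    exists OP : set 'rV[R]_(@jet_dim n r.+2) * ('rV[R]_(@jet_dim n r.+2) -> R),
    [/\ open OP.1, smooth_on OP.1 OP.2 &
      forall U A, weyl_generic U A -> forall x, U x ->
        OP.1 (jetmap r.+2 A x) /\ jentry (enum_val k) (pref A) x = OP.2 (jetmap r.+2 A x)].
  by have [ O [Psi ?]] := diffop_pref_jet (enum_val k); exists (O, Psi).
have {H} [OP H] := choice H.
exists [set u | forall k, (OP k).1 u], (fun u => \row_k (OP k).2 u).
have Oo : open [set u | forall k, (OP k).1 u].
  rewrite openE => u Ou.
  (* There are finitely many jet coordinates, so the intersection of their open sets is open. *)
  have : \forall v \near u, forall k, (OP k).1 v.
    apply: (@filter_forall _ _ (fun k => (OP k).1) (nbhs u) (nbhs_filter u)) => k.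
    by apply: open_nbhs_nbhs; split; [have [] := H k | exact: Ou].
  exact: filterS.
split=> // [k|U A wA x Ux].
  apply: (eq_smooth Oo (f := (OP k).2)); first by move=> u _; rewrite mxE.
  by have [_ s _] := H k; apply: smooth_sub s => u; apply.
split=> [k|]; first by have [_ _ /(_ U A wA x Ux)[]] := H k.
by apply/rowP => k; rewrite !mxE; have [_ _ /(_ U A wA x Ux)[_ ->]] := H k.
Qed.

(** Stated for all nondegenerate fields, so that vanishing and non-vanishing alike can be read off a
    jet. *)
Lemma weyl_sq_jet r : exists (O : set 'rV[R]_(@jet_dim n r.+2)) (Psi : 'rV[R]_(@jet_dim n r.+2) -> R),
  [/\ open O, smooth_on O Psi &
      forall U A, nondegenerate_field U A -> forall x, U x ->
        O (jetmap r.+2 A x) /\ weyl_sq_loc A x = Psi (jetmap r.+2 A x)].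
Proof. have le2 : (2 <= r.+2)%N by [].
exact: (diffop_leq le2 diffop_weyl_sq). Qed.

End Prolongation.

(** * Generic jets and the action of diffeomorphisms *)

Section GenericJets.
Context {R : realType} {n : nat} {M : manifold R n}.
Variables (p q r : nat).
Hypotheses (n4 : (4 <= n)%N) (pqn : (p + q)%N = n).
Implicit Types (g s : mxfield M) (c : chart M).

Let n0 : (0 < n)%N. Proof. exact: leq_trans n4. Qed.

Lemma conf_field s c : local_section act_C p q s ->
  nondegenerate_field (img c (fdom s)) (fmat s c).
Proof.
move=> [so sf ss _]; split; first exact: open_img.
  by move=> i j; apply: ss.
move=> x [m [cm sm] <-]; apply: (fibre_O_unit pqn).
exact/fibre_C_O/sf.
Qed.

Lemma weyl_sq_conf g c m : metric p q g -> fdom g m -> dom c m ->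
  (weyl_sq g m == 0) = (weyl_sq_loc (fmat (conf_section g) c) (crd c m) == 0).
Proof.
move=> mg gm cm; have [io gs gu] := metric_field pqn c mg.
pose la x := `|\det (fmat g c x)| `^ (- n%:R^-1).
have la0 x : img c (fdom g) x -> la x != 0.
  by move=> xg; rewrite gt_eqF //; apply: powR_gt0; apply: unit_det_norm; exact: gu.
have lam : la (crd c m) != 0 by apply/la0/mem_img.
rewrite (@weyl_sq_scale _ _ _ _ _ pqn n4 g (conf_section g) la c m) //.
- by rewrite (weyl_sqE pqn mg gm cm) mulf_eq0 expf_eq0 /= invr_eq0 (negbTE lam).
- by case: mg.
- exact: (conf_factor_smooth pqn mg).
Qed.

Lemma conf_weyl_generic g c : metric p q g ->
  weyl_generic (img c (fdom (preferred g))) (fmat (conf_section g) c).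
Proof.
move=> mg; have po := open_generic pqn mg.
have [io gs gu] := conf_field c (conf_section_section n0 pqn mg).
have sub : img c (fdom (preferred g)) `<=` img c (fdom (conf_section g)).
  by apply: img_sub => m [].
split; first split.
- exact: open_img.
- by move=> i j; apply: smooth_sub (gs i j).
- by move=> x /sub; apply: gu.
- by move=> x [m [cm [gm Hm]] <-]; rewrite -weyl_sq_conf.
Qed.

Lemma preferred_jetmap g c m : metric p q g -> fdom (preferred g) m -> dom c m ->
  jetmap r (fmat (preferred g) c) (crd c m) =
  jetmap r (pref (fmat (conf_section g) c)) (crd c m).
Proof.
move=> mg gm cm; have po := open_generic pqn mg.
apply: (eq_jetmap _ (open_img c po)); last exact: mem_img.
by move=> x; rewrite inE => -[m' [cm' gm'] <-]; rewrite (preferred_conf pqn n4).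
Qed.

(** The reason why F is well defined: in every chart, both sides are the same [Phi] applied to equal
    coordinates of (r + 2)-jets. *)
Lemma preferred_jet_eq g g' m m' : metric p q g -> metric p q g' ->
  fdom (preferred g) m -> fdom (preferred g') m' ->
  jet r.+2 (conf_section g) m = jet r.+2 (conf_section g') m' ->
  jet r (preferred g) m = jet r (preferred g') m'.
Proof.
move=> mg mg' gm gm' E.
have mm : m = m' by have := congr1 (@jet_base _ _ _ _) E.
rewrite -mm in gm' E *; apply: jet_ext => c cm.
rewrite !jet_crdE // !preferred_jetmap //.
have [ O [Phi [_ _ H]]] := @prolongation R n r.
have [_ ->] := H _ _ (conf_weyl_generic c mg) _ (mem_img cm gm).
have [_ ->] := H _ _ (conf_weyl_generic c mg') _ (mem_img cm gm').
by rewrite -!jet_crdE // E.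
Qed.

(** Every jet of a conformal structure is thus the jet of one given by a metric; this links the
    invariance conditions, which range over all local sections, with [generic_jets]. *)
Lemma unimod_metric_jet k s c m : local_section act_C p q s -> fdom s m -> dom c m ->
  jet k (conf_section (unimod_metric s c)) m = jet k s m.
Proof.
move=> ss sm cm; have [so _ _ _] := ss.
apply: (@jet_congr _ _ _ _ _ _ (fdom s `&` dom c)) => //.
  by apply: openI => //; exact: dom_open.
by move=> c' m' cm' gm'; apply: (conf_unimod_metric n0 pqn).
Qed.

Lemma weyl_sq_unimod s c m : local_section act_C p q s -> fdom s m -> dom c m ->
  (weyl_sq (unimod_metric s c) m == 0) = (weyl_sq_loc (fmat s c) (crd c m) == 0).
Proof.
move=> ss sm cm; have mg := unimod_metricP c ss.
have gm : fdom (unimod_metric s c) m by [].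
rewrite (weyl_sq_conf mg gm cm).
have [ O [Psi [_ _ H]]] := @weyl_sq_jet R n 0.
have [_ ->] := H _ _ (conf_field c ss) _ (mem_img cm sm).
have [_ ->] := H _ _ (conf_field c (conf_section_section n0 pqn mg)) _ (mem_img cm gm).
by rewrite -!jet_crdE // unimod_metric_jet.
Qed.

(** Membership asks for some metric, but it can be tested on any section with the same jet, since by
    [weyl_sq_jet] the expression H depends on the jet only. *)
Lemma generic_jetsE s c m : local_section act_C p q s -> fdom s m -> dom c m ->
  generic_jets M p q r.+2 (jet r.+2 s m) <-> weyl_sq_loc (fmat s c) (crd c m) != 0.
Proof.
move=> ss sm cm; split=> [[g [m' [mg gm' gen E]]]|Hs].
  have mm : m = m' by have := congr1 (@jet_base _ _ _ _) E.
  rewrite -mm in gm' gen E.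
  move/(genericE pqn n4 mg gm'): gen; rewrite (weyl_sq_conf mg gm' cm).
  have [ O [Psi [_ _ H]]] := @weyl_sq_jet R n r.
  have [_ ->] := H _ _ (conf_field c ss) _ (mem_img cm sm).
  have [_ ->] := H _ _ (conf_field c (conf_section_section n0 pqn mg)) _ (mem_img cm gm').
  by rewrite -!jet_crdE // -E.
have mg := unimod_metricP c ss.
have gm : fdom (unimod_metric s c) m by [].
exists (unimod_metric s c), m; split=> //; last by rewrite unimod_metric_jet.
by apply/(genericE pqn n4 mg gm); rewrite weyl_sq_unimod.
Qed.

Lemma generic_jets_bundle : generic_jets M p q r.+2 `<=` jet_bundle M act_C p q r.+2.
Proof.
move=> j [g [m [mg gm gen ->]]]; exists (conf_section g), m; split=> //.
exact: conf_section_section.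
Qed.

Lemma generic_jets_open : jet_open (jet_bundle M act_C p q r.+2) (generic_jets M p q r.+2).
Proof.
split; first exact: generic_jets_bundle.
have [ O [Psi [Oo Ps H]]] := @weyl_sq_jet R n r.
move=> c j Wj cj; exists [set u | O u /\ Psi u != 0]; split.
- exact: open_smooth_neq0.
- have [s [m [ss sm jE]]] := generic_jets_bundle Wj.
  rewrite jE in Wj cj *; rewrite jet_crdE //.
  have [Om E] := H _ _ (conf_field c ss) _ (mem_img cj sm).
  by split => //; rewrite -E; apply/(generic_jetsE ss sm cj).
- move=> j' [s [m [ss sm ->]]] cm; rewrite jet_crdE // => -[_].
  have [_ <-] := H _ _ (conf_field c ss) _ (mem_img cm sm).
  by move=> Hs; apply/(generic_jetsE ss sm cm).
Qed.

(** [unimod_act] is applied to the Jacobian of the inverse of [phi]. The fields agree on the open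
    set where the pushed metric is defined, which suffices for jets. *)
Lemma push_conf_jet k (phi : local_diffeo M) s m (g := unimod_metric s (chart_at m)) :
  local_section act_C p q s -> fdom s m -> ld_dom phi m ->
  jet k (push act_C phi s) (phi m) = jet k (conf_section (push act_O phi g)) (phi m).
Proof.
move=> ss sm pm; have mg : metric p q g := unimod_metricP _ ss.
have [so _ _ _] := push_metric phi mg.
apply: (@jet_congr _ _ _ _ _ _ (fdom (push act_O phi g)) _ so).
  by split; [exists m | rewrite /= ld_funK //; split => //; exact: chart_atP].
move=> c m' cm' [mi gm'].
have a1 : dom (chart_at (ld_inv phi m')) (ld_inv phi m') := chart_atP _.
rewrite pushE // -[RHS]/(unimod (fmat (push act_O phi g) c (crd c m'))) pushE //.
rewrite unimod_act //; last exact: jac_inv_unit.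
by rewrite -(conf_unimod_metric n0 pqn ss a1 gm').
Qed.

(** [act_O] commutes with scalar factors, so the factor of the preferred metric passes through it.
    The comparison is local, the values of the fields off their domains being arbitrary. *)
Lemma push_preferred_jet k (phi : local_diffeo M) g m : metric p q g ->
  fdom (preferred g) m -> ld_dom phi m ->
  jet k (preferred (push act_O phi g)) (phi m) = jet k (push act_O phi (preferred g)) (phi m).
Proof.
move=> mg [gm Hm] pm; have mpg := push_metric phi mg.
have fm : fdom (push act_O phi g) (phi m) by split; [exists m | rewrite /= ld_funK].
apply: (@jet_congr _ _ _ _ _ _ _ _ (open_generic pqn mpg)).
  by split => //; rewrite (weyl_sq_push pqn) // ld_funK.
move=> c m' cm' [fm' Hm'].
have a1 : dom (chart_at (ld_inv phi m')) (ld_inv phi m') := chart_atP _.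
rewrite pushE // [LHS]/= (crdK cm') (weyl_sq_push pqn) //.
rewrite -[fmat (preferred g) _ _]/(Num.sqrt `|weyl_sq g (par _ _)| *: fmat g _ _) (crdK a1).
by rewrite act_OZ -(pushE phi act_O g cm').
Qed.

End GenericJets.

Theorem mainTheorem1 (R : realType) (n p q : nat) (hn : (4 <= n)%N)
    (hpq : (p + q)%N = n) (M : manifold R n) (r : nat)
    (f : jet_space M r -> R) (hf : scalar_metric_invariant p q f) :
  jet_open (jet_bundle M act_C p q r.+2) (generic_jets M p q r.+2) /\
  jet_invariant_set act_C p q (generic_jets M p q r.+2) /\
  exists F : jet_space M r.+2 -> R,
    (forall (g : mxfield M) (m : M), metric p q g -> fdom g m -> generic g m ->
       jet_bundle M act_O p q r (jet r (preferred g) m) /\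
       F (jet r.+2 (conf_section g) m) = f (jet r (preferred g) m)) /\
    scalar_conformal_invariant p q F.
Proof.
have [f_smooth f_inv] := hf.
have prefB g m : metric p q g -> fdom (preferred g) m ->
    jet_bundle M act_O p q r (jet r (preferred g) m).
  by move=> mg gm; exists (preferred g), m; split=> //; apply: preferred_metric.
(* An arbitrary conformal section is replaced by metrics on both sides of the action. *)
have push_generic phi s m (g := unimod_metric s (chart_at m)) :
    local_section act_C p q s -> fdom s m -> ld_dom phi m ->
    generic_jets M p q r.+2 (jet r.+2 s m) ->
    [/\ metric p q g, metric p q (push act_O phi g), fdom (preferred g) m,
        fdom (preferred (push act_O phi g)) (phi m) &
        jet r.+2 (push act_C phi s) (phi m) =
        jet r.+2 (conf_section (push act_O phi g)) (phi m)].
  move=> ss sm pm Hg; have cm : dom (chart_at m) m := chart_atP m.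
  have mg : metric p q g := unimod_metricP (chart_at m) ss.
  have gm : fdom (preferred g) m.
    split=> //; rewrite (weyl_sq_unimod hn hpq ss sm cm).
    by apply/(generic_jetsE r hn hpq ss sm cm).
  have mpg := push_metric phi mg.
  have fm : fdom (push act_O phi g) (phi m).
    by split; [exists m | rewrite /= ld_funK //; case: gm].
  have fm' : fdom (preferred (push act_O phi g)) (phi m).
    split; first exact: fm.
    by rewrite (weyl_sq_push hpq mg fm) (ld_funK pm); exact: gm.2.
  split; [exact: mg | exact: mpg | exact: gm | exact: fm' |].
  exact: (push_conf_jet hn hpq r.+2 ss sm pm).
split; first exact: generic_jets_open.
split.
  move=> phi s m ss sm pm /(push_generic phi s m ss sm pm) [mg mpg gm [fm Hm] ->].
  by eexists; eexists; split; [exact: mpg| exact: fm| exact/(genericE hpq hn mpg fm)|].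
have [F FE] : exists F : jet_space M r.+2 -> R, forall g m, metric p q g ->
    fdom (preferred g) m -> F (jet r.+2 (conf_section g) m) = f (jet r (preferred g) m).
  (* The value has to fit all metrics that represent the jet, so F does not depend on a
     representative; it is 0 on jets without one. *)
  have /choice[F FP] : forall j : jet_space M r.+2, exists y, forall g m, metric p q g ->
      fdom (preferred g) m -> j = jet r.+2 (conf_section g) m -> y = f (jet r (preferred g) m).
    move=> j; have [[g [m [mg gm ->]]]|H] := pselect (exists g m,
      [/\ metric p q g, fdom (preferred g) m & j = jet r.+2 (conf_section g) m]).
      exists (f (jet r (preferred g) m)) => g' m' mg' gm' E.
      by rewrite (preferred_jet_eq hn hpq mg mg' gm gm' E).
    by exists 0 => g m mg gm E; case: H; exists g, m.
  by exists F => g m mg gm; apply: FP.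
have toP (g : mxfield M) (m : M) : metric p q g -> fdom g m -> generic g m -> fdom (preferred g) m.
  by move=> mg gm /(genericE hpq hn mg gm).
exists F; split=> [g m mg gm gen|].
  have pm := toP g m mg gm gen.
  by split; [exact: prefB | exact: FE].
split=> [c j [g [m [mg gm gen ->]]] cm|phi s m ss sm pm Wm].
  have pm := toP g m mg gm gen.
  have [V [h [Vo Vm hs hE]]] := f_smooth c _ (prefB g m mg pm) cm.
  have [ O [Phi [Oo Phis H]]] := @prolongation R n r.
  have jE g' m' : metric p q g' -> fdom (preferred g') m' -> dom c m' ->
      O (jet_crd c (jet r.+2 (conf_section g') m')) /\
      jet_crd c (jet r (preferred g') m') = Phi (jet_crd c (jet r.+2 (conf_section g') m')).
    move=> mg' gm' cm'; rewrite !jet_crdE // (preferred_jetmap r hn hpq) //.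
    exact: H (conf_weyl_generic hn hpq c mg') _ (mem_img cm' gm').
  have VO : open [set u | O u /\ V (Phi u)].
    apply: open_preimage => // u Ou; apply: continuous_row => k.
    exact: smooth_continuous (Phis k) Ou.
  (* Near the jet, F is the local extension [h] of [f] composed with [Phi]; the domain is cut down
     so that [Phi] takes its values where [h] is smooth. *)
  exists [set u | O u /\ V (Phi u)], (h \o Phi); split=> //.
  - have [Om E] := jE g m mg pm cm; split; first exact: Om.
    by rewrite -E.
  - apply: (smooth_comp Vo VO) => // [u []//|k].
    by apply: smooth_sub (Phis k) => u [].
  - move=> j' [g' [m' [mg' gm' gen' ->]]] cm' [_ Vm'].
    have pm' := toP g' m' mg' gm' gen'.
    have [_ E] := jE g' m' mg' pm' cm'.
    rewrite FE // (hE _ (prefB g' m' mg' pm') cm') ?E //.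
have cm : dom (chart_at m) m := chart_atP m.
have [mg mpg gm fm ->] := push_generic phi s m ss sm pm Wm.
(* On the pushed jet F equals [f] at the push-forward of the preferred metric, where the invariance
   of [f] applies; the last step returns from [unimod_metric] to [s]. *)
rewrite FE // (push_preferred_jet hpq r mg gm pm).
rewrite f_inv //; last exact: prefB.
- by rewrite -FE // (unimod_metric_jet hn hpq _ ss sm cm).
- exact: preferred_metric.
Qed.
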